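(* Suppose that the basic assumptions and the average smoothness assumption (both stated in the context) hold. Fix some $\hat\theta\ge 1$ and let $$\rho_k=k^{\nu},\quad \eta_k=\frac{k^{-\nu}}{4\log(k+2)},\quad \alpha_k=k^{-2\nu}\quad(k\ge1),\qquad\text{where } \nu=\min\{\hat\theta/(\hat\theta+2),\,1/2\}.$$ Let $\{x_k\}$ and $\{g_k\}$ be generated by the truncated recursive momentum method (see context) with these parameters, and for $k\ge 2$ let $\iota_k$ be a random variable drawn uniformly from $\{\lceil k/2\rceil+1,\dots,k\}$. Define $$\widetilde K_1=\left\lceil\max\left\{(2\bar L_{\nabla f})^{\frac1\nu},\ e^{6\times 2^{\nu/2}\bar L_{\nabla f}^2},\ e^{2L},\ e^{2\theta},\ \left(e^{-1}\gamma^{-2}2^{6-\theta}\log(e^{2\theta}+2)\right)^{2\theta}\right\}\right\rceil,$$ $$C_1=\max\left\{1,\ \widetilde K_1^{2\nu/\theta}C_c^2/2,\ 2^{3-\theta}L_f^2\gamma^{-2}\right\}.$$ Then for all $k\ge 2\widetilde K_1$, $$\begin{aligned} &\mathbb{E}\left[\mathrm{dist}^2\left(0,\nabla f(x_{\iota_k})+\rho_{\iota_k-1}\nabla c(x_{\iota_k})c(x_{\iota_k})+\mathcal N_X(x_{\iota_k})\right)\right]\\ &\le\frac{102\log(k+1)}{(k-1)^{1-\nu}}\Bigg(Q_1(x_1)-Q_1^*+\frac{\mathbb{E}[\|g_1-\nabla f(x_1)\|^2]}{2\log 3}+\frac12 C_1\max\{1,k^{\nu-\frac{2\nu}{\theta}}\}(1+\log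 k)+\frac12C_c^2\big(\widetilde K_1^{\nu}-1\big)\\ &\quad+\frac{3\sqrt2\,\sigma^2(1+\log k)}{2\log 3}+\frac1{16}(1+\log\widetilde K_1)\big(\bar L_{\nabla f}+\widetilde K_1^{\frac12}L+6\widetilde K_1^{\frac12}\bar L_{\nabla f}^2\big)\big(L_f^2+C_c^2L_c^2\widetilde K_1\big)\Bigg), \end{aligned}$$ and (with certainty) $$\|c(x_{\iota_k})\|^2\le 2C_1(k/2)^{-2\nu/\theta}.$$
   Context: Setting. $X\subseteq\mathbb{R}^n$ is a (nonempty) closed convex set; $\xi$ is a random variable with sample space $\Xi$; $\tilde f(\cdot,\xi)$ is continuously differentiable for each $\xi\in\Xi$; $f(x)=\mathbb{E}[\tilde f(x,\xi)]$; $c:\mathbb{R}^n\to\mathbb{R}^m$ is a deterministic smooth mapping. The problem is $\min_{x\in X} f(x)$ subject to $c(x)=0$. Notation. $\|\cdot\|$ is the Euclidean norm (operator norm for matrices); $\nabla c(x)$ is the transpose of the Jacobian of $c$ (an $n\times m$ matrix); $\mathcal N_X(x)$ is the normal cone of $X$ at $x$; $\mathrm{dist}(x,\Omega)$ is Euclidean distance; $\Pi_\Omega$ is Euclidean projection onto a closed convex set $\Omega$; $\mathscr B(r)=\{x:\|x\|\le r\}$; $\log$ is the natural logarithm. $Q_\rho(x)=f(x)+\frac{\rho}{2}\|c(x)\|^2$. Basic assumptions. (i) The optimal value $f^*$ of the problem and $Q_1^*:=\min_{x\in X}\{f(x)+\|c(x)\|^2/2\}$ are finite. (ii) $f$ is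 differentiable and $L_f$-Lipschitz continuous in an open neighborhood of $X$. (iii) For each $\xi\in\Xi$, $\tilde f(\cdot,\xi)$ is differentiable on $X$, and for some $\sigma\ge0$, $\mathbb{E}[\nabla\tilde f(x,\xi)]=\nabla f(x)$ and $\mathbb{E}[\|\nabla\tilde f(x,\xi)-\nabla f(x)\|^2]\le\sigma^2$ for all $x\in X$. (iv) $c$ is $L_c$-Lipschitz continuous and $L_{\nabla c}$-smooth (i.e. $\nabla c$ is $L_{\nabla c}$-Lipschitz) in an open neighborhood of $X$; $\|c(x)\|\le C_c$ for all $x\in X$; and there exist constants $\gamma>0$ and $\theta\ge1$ with $\mathrm{dist}(0,\nabla c(x)c(x)+\mathcal N_X(x))\ge\gamma\|c(x)\|^\theta$ for all $x\in X$. Constant. $L:=L_c^2+C_cL_{\nabla c}$. Average smoothness assumption. $\mathbb{E}[\|\nabla\tilde f(u,\xi)-\nabla\tilde f(v,\xi)\|^2]\le\bar L_{\nabla f}^2\|u-v\|^2$ for all $u,v\in X$. Truncated recursive momentum method. Input: a (deterministic) $x_1\in X$, $\{\alpha_k\}\subset(0,1]$, $\{\rho_k\},\{\eta_k\}\subset(0,\infty)$. Let $\xi_1,\xi_2,\dots$ be independent samples of $\xi$. Set $g_1=\Pi_{\mathscr B(L_f)}(\nabla\tilde f(x_1,\xi_1))$. For $k=1,2,\dots$: $G_k=g_k+\rho_k\nabla c(x_k)c(x_k)$; $x_{k+1}=\Pi_X(x_k-\eta_kG_k)$; $g_{k+1}=\Pi_{\mathscr B(L_f)}\big(\nabla\tilde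 f(x_{k+1},\xi_{k+1})+(1-\alpha_k)(g_k-\nabla\tilde f(x_k,\xi_{k+1}))\big)$. The index $\iota_k$ is drawn independently of the samples. *)

(* Defs.v *)
From HB Require Import structures.
From mathcomp Require Export all_boot all_order all_algebra.
From mathcomp Require Export all_classical all_reals all_analysis.
Export Order.TTheory GRing.Theory Num.Theory.
Export numFieldNormedType.Exports.

Set Implicit Arguments.
Unset Strict Implicit.
Unset Printing Implicit Defensive.

Local Open Scope classical_set_scope.
Local Open Scope ring_scope.

(* Points of R^n are row vectors. The library norm of 'rV[R]_n is the sup norm;
   it is only used through the topology it induces (open, closed, continuous,
   differentiable). All metric quantities use the Euclidean norm below. *)

Section Euclidean.
Context {R : realType}.

Definition dotv n (u v : 'rV[R]_n) : R := \sum_(i < n) u 0 i * v 0 i.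

Definition enorm n (u : 'rV[R]_n) : R := Num.sqrt (dotv u u).

(* A : R^m -> R^n acts on columns, hence on the row y as y *m A^T. *)
Definition opnorm n m (A : 'M[R]_(n, m)) : R :=
  sup [set enorm (y *m A^T) | y in [set y : 'rV[R]_m | enorm y <= 1]].

Definition edist n (v : 'rV[R]_n) (S : set 'rV[R]_n) : R :=
  inf [set enorm (v - s) | s in S].

Definition eball n (r : R) : set 'rV[R]_n := [set v | enorm v <= r].

Definition proj n (S : set 'rV[R]_n) (v : 'rV[R]_n) : 'rV[R]_n :=
  xget 0 [set p | S p /\ forall s, S s -> enorm (v - p) <= enorm (v - s)].

Definition normal_cone n (X : set 'rV[R]_n) (x : 'rV[R]_n) : set 'rV[R]_n :=
  [set v | X x /\ forall y, X y -> dotv v (y - x) <= 0].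

Definition grad n (h : 'rV[R]_n -> R) (x : 'rV[R]_n) : 'rV[R]_n :=
  \row_(i < n) 'D_(delta_mx 0 i) h x.

(* The row form of nabla c(x) c(x): the library's 'J c x is the n x m matrix
   (d c_j / d x_i)_{i, j}, that is, nabla c(x) itself and not its transpose. *)
Definition nablac_c n m (c : 'rV[R]_n -> 'rV[R]_m) (x : 'rV[R]_n) : 'rV[R]_n :=
  c x *m ('J c x)^T.

End Euclidean.

Section Problem.
Context {R : realType} {n m : nat} {d : measure_display} {Xi : measurableType d}.
Variables (X : set 'rV[R]_n) (mu : probability Xi R).
Variables (ft : 'rV[R]_n -> Xi -> R) (c : 'rV[R]_n -> 'rV[R]_m).

(* mu is the law of the random variable xi, so E[phi(xi)] is 'E_mu[phi]. *)
Definition objective (x : 'rV[R]_n) : R := fine ('E_mu[ft x])%E.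

Definition Qpen (rho : R) (x : 'rV[R]_n) : R :=
  objective x + rho / 2 * enorm (c x) ^+ 2.

(* Infima in \bar R: the infimum over the empty set is +oo, so finiteness of
   fstar includes feasibility. *)
Definition fstar : \bar R :=
  ereal_inf [set (objective x)%:E | x in [set x | X x /\ c x = 0]].

Definition Q1star : \bar R := ereal_inf [set (Qpen 1 x)%:E | x in X].

Record basic_setting : Prop := {
  X_nonempty : X !=set0;
  X_closed : closed X;
  X_convex : convex_set (X : set (convex_lmodType 'rV[R]_n));
  ft_differentiable : forall s x, differentiable (ft^~ s) x;
  ft_C1 : forall s, continuous (grad (ft^~ s)) }.

Record basic_assumptions
    (Lf sigma Lc Lgc Cc gamma theta : R) : Prop := {
  fstar_finite : fstar \is a fin_num;
  Q1star_finite : Q1star \is a fin_num;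
  Lf_ge0 : 0 <= Lf;
  (* The integrability of ft x is what makes objective the expectation of ft x
     near X, rather than the default value of fine. *)
  f_regular : exists U : set 'rV[R]_n, [/\ open U, X `<=` U,
    forall x, U x -> mu.-integrable [set: Xi] (EFin \o ft x),
    forall x, U x -> differentiable objective x &
    forall u v, U u -> U v ->
      `|objective u - objective v| <= Lf * enorm (u - v)];
  sigma_ge0 : 0 <= sigma;
  ft_unbiased : forall x, X x -> forall i : 'I_n,
    ('E_mu[fun s => (grad (ft^~ s) x 0 i)%R] = (grad objective x 0 i)%:E)%E;
  ft_variance : forall x, X x ->
    ('E_mu[fun s => (enorm (grad (ft^~ s) x - grad objective x) ^+ 2)%R]
       <= (sigma ^+ 2)%:E)%E;
  Lc_ge0 : 0 <= Lc;
  Lgc_ge0 : 0 <= Lgc;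
  c_regular : exists V : set 'rV[R]_n, [/\ open V, X `<=` V,
    forall x, V x -> differentiable c x,
    forall u v, V u -> V v -> enorm (c u - c v) <= Lc * enorm (u - v) &
    forall u v, V u -> V v -> opnorm ('J c u - 'J c v) <= Lgc * enorm (u - v)];
  c_bounded : forall x, X x -> enorm (c x) <= Cc;
  gamma_gt0 : 0 < gamma;
  theta_ge1 : 1 <= theta;
  c_error_bound : forall x, X x ->
    gamma * enorm (c x) `^ theta
      <= edist 0 [set nablac_c c x + v | v in normal_cone X x] }.

Definition average_smoothness (Lbar : R) : Prop :=
  0 <= Lbar /\ forall u v, X u -> X v ->
    ('E_mu[fun s => (enorm (grad (ft^~ s) u - grad (ft^~ s) v) ^+ 2)%R]
       <= (Lbar ^+ 2 * enorm (u - v) ^+ 2)%:E)%E.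

(* Iterates and samples are indexed from 1; index 0 is unused. The recursion is
   imposed at every outcome w. *)
Record truncated_recursive_momentum {T : Type} (Lf : R)
    (alpha rho eta : nat -> R) (x1 : 'rV[R]_n) (xi : nat -> T -> Xi)
    (x g : nat -> T -> 'rV[R]_n) : Prop := {
  trm_x1 : forall w, x 1%N w = x1;
  trm_g1 : forall w, g 1%N w = proj (eball Lf) (grad (ft^~ (xi 1%N w)) x1);
  trm_x : forall k w, (1 <= k)%N ->
    x k.+1 w =
      proj X (x k w - eta k *: (g k w + rho k *: nablac_c c (x k w)));
  trm_g : forall k w, (1 <= k)%N ->
    g k.+1 w = proj (eball Lf)
      (grad (ft^~ (xi k.+1 w)) (x k.+1 w)
       + (1 - alpha k) *: (g k w - grad (ft^~ (xi k.+1 w)) (x k w))) }.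

End Problem.

Section Sampling.
Context {R : realType} {d d' : measure_display}.
Context {T : measurableType d} {Xi : measurableType d'}.
Variables (P : probability T R) (mu : probability Xi R).

Record iid_samples (xi : nat -> {mfun T >-> Xi}) : Prop := {
  samples_law : forall k, (1 <= k)%N -> forall A, measurable A ->
    distribution P (xi k) A = mu A;
  samples_independent : forall J : seq nat, uniq J -> all (leq 1) J ->
    forall B : nat -> set Xi, (forall i, measurable (B i)) ->
    P (\bigcap_(i in [set` J]) xi i @^-1` B i) =
    (\prod_(i <- J) P (xi i @^-1` B i))%E }.

Definition sigma_samples (xi : nat -> T -> Xi) : set (set T) :=
  <<s [set A | exists k B, [/\ (1 <= k)%N, measurable B & A = xi k @^-1` B]] >>.

(* uphalf k is the ceiling of k / 2, and k - uphalf k is the number of elements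
   of {uphalf k + 1, ..., k}. *)
Record uniform_index (xi : nat -> T -> Xi) (k : nat) (i : {mfun T >-> nat}) :
    Prop := {
  index_range : forall w, (uphalf k < i w <= k)%N;
  index_uniform : forall j, (uphalf k < j <= k)%N ->
    P (i @^-1` [set j]) = ((k - uphalf k)%:R^-1)%:E;
  index_independent : forall j A, sigma_samples xi A ->
    P (i @^-1` [set j] `&` A) = (P (i @^-1` [set j]) * P A)%E }.

End Sampling.

Section Constants.
Context {R : realType}.

Definition smooth_const (Lc Cc Lgc : R) : R := Lc ^+ 2 + Cc * Lgc.

Definition nu_exp (thetahat : R) : R :=
  Num.min (thetahat / (thetahat + 2)) (1 / 2).

Definition K1_const (nu L Lbar gamma theta : R) : R :=
  (Num.ceil
    (Num.max ((2 * Lbar) `^ (1 / nu))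
    (Num.max (expR (6 * 2 `^ (nu / 2) * Lbar ^+ 2))
    (Num.max (expR (2 * L))
    (Num.max (expR (2 * theta))
             (((expR 1)^-1 * gamma ^- 2 * 2 `^ (6 - theta)
                 * ln (expR (2 * theta) + 2)) `^ (2 * theta))))))%R)%:~R.

Definition C1_const (nu K1 Lf Cc gamma theta : R) : R :=
  Num.max 1
  (Num.max (K1 `^ (2 * nu / theta) * Cc ^+ 2 / 2)
           (2 `^ (3 - theta) * Lf ^+ 2 * gamma ^- 2)).

End Constants.

(* Main.v *)
Require Import Defs.
From HB Require Import structures.
From mathcomp Require Import measurable_realfun ring lra zify.

(* Truncation keeps |g_k| <= Lf, so feasibility is a deterministic matter: one step
   decreases |c|^2 / 2 by a multiple of the squared residual of the error bound, up
   to an O(1 / rho_k^2) perturbation, and the decay |c(x_k)|^2 <= 2 C1 k^(-2 nu / theta)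
   propagates by induction from k = K1 on.

   For stationarity, write e_k = E|g_k - grad f(x_k)|^2 and d_k = E|x_(k+1) - x_k|^2.
   Descent of f + rho_k |c|^2 / 2 holds pathwise; its cost e_k is paid for by the
   momentum recursion e_(k+1) <= (1 - alpha_k)^2 e_k + 2 alpha_k^2 sigma^2
   + 2 Lbar^2 d_k, where the cross term vanishes because xi_(k+1) is independent of
   x_k, x_(k+1), g_k. Adding w_k e_k with w_k = k^nu / (2 ln (k + 2)) to the penalised
   objective gives a Lyapunov function that decreases by a multiple of
   eta_k e_k + d_k / eta_k for k >= K1, up to the feasibility decay and the noise;
   the finitely many earlier steps are bounded by their length. The squared
   stationarity residual at x_(k+1) is at most a multiple of
   rho_k ln (k + 2) (eta_k |g_k - grad f(x_k)|^2 + |x_(k+1) - x_k|^2 / eta_k), and the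
   independent uniform index averages these quantities over the second half of the
   run. *)

Set Implicit Arguments.
Unset Strict Implicit.
Unset Printing Implicit Defensive.

Local Open Scope classical_set_scope.
Local Open Scope ring_scope.

(** * Euclidean geometry and projections *)

(** The window [1 / 3 <= nu <= 1 / 2] balances the weights. The damping by [alpha_k] gains [2 eta_k]
    per unit of [e_k]; the growth of [w_k] over one step returns at most half of that, because
    [k^(2 nu) <= k], while the injected noise [w_(k+1) alpha_k^2] is at most a multiple of [1 / k],
    because [k^(3 nu) >= k]; hence a factor [1 + ln k]. The remaining gain [eta_k e_k] is split: one
    half pays for the descent step, the other is kept for the stationarity residual. The entries of
    the maximum defining [K1] have separate tasks: the first three make [1 / (2 eta_k)] dominate the
    smoothness and variance terms, the last two make the feasibility target fall more slowly than
    one step can achieve, and [e^(2 theta)] also forces [K1 >= 7] and [ln K1 >= 2]. A further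
    obstacle is that gradients are controlled on [X] only: random maps are therefore precomposed
    with the projection onto [X], which fixes the iterates, before their measurability is
    discussed. *)

Section EuclideanSpace.
Context {R : realType}.

Lemma coordD n (u v : 'rV[R]_n) i : (u + v) 0 i = u 0 i + v 0 i.
Proof. exact: mxE. Qed.

Lemma coordB n (u v : 'rV[R]_n) i : (u - v) 0 i = u 0 i - v 0 i.
Proof. by rewrite !mxE. Qed.

Lemma coordN n (u : 'rV[R]_n) i : (- u) 0 i = - u 0 i.
Proof. exact: mxE. Qed.

Lemma coordZ n a (u : 'rV[R]_n) i : (a *: u) 0 i = a * u 0 i.
Proof. exact: mxE. Qed.

Lemma dotvC n (u v : 'rV[R]_n) : dotv u v = dotv v u.
Proof. by apply: eq_bigr => i _; rewrite mulrC. Qed.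

Lemma dotvDl n (u v w : 'rV[R]_n) : dotv (u + v) w = dotv u w + dotv v w.
Proof. by rewrite /dotv -big_split; apply: eq_bigr => i _; rewrite mxE mulrDl. Qed.

Lemma dotvZl n a (u v : 'rV[R]_n) : dotv (a *: u) v = a * dotv u v.
Proof. by rewrite /dotv mulr_sumr; apply: eq_bigr => i _; rewrite mxE mulrA. Qed.

Lemma dotvNl n (u v : 'rV[R]_n) : dotv (- u) v = - dotv u v.
Proof. by rewrite -scaleN1r dotvZl mulN1r. Qed.

Lemma dotvDr n (u v w : 'rV[R]_n) : dotv w (u + v) = dotv w u + dotv w v.
Proof. by rewrite dotvC dotvDl !(dotvC w). Qed.

Lemma dotvZr n a (u v : 'rV[R]_n) : dotv u (a *: v) = a * dotv u v.
Proof. by rewrite dotvC dotvZl dotvC. Qed.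

Lemma dotvNr n (u v : 'rV[R]_n) : dotv u (- v) = - dotv u v.
Proof. by rewrite dotvC dotvNl dotvC. Qed.

Definition dotvE := (dotvDl, dotvDr, dotvNl, dotvNr, dotvZl, dotvZr).

Lemma dotv_ge0 n (u : 'rV[R]_n) : 0 <= dotv u u.
Proof. by apply: sumr_ge0 => i _; rewrite -expr2 sqr_ge0. Qed.

Lemma enorm_ge0 n (u : 'rV[R]_n) : 0 <= enorm u.
Proof. exact: sqrtr_ge0. Qed.

Lemma sqr_enorm n (u : 'rV[R]_n) : enorm u ^+ 2 = dotv u u.
Proof. by rewrite sqr_sqrtr ?dotv_ge0. Qed.

Lemma sqr_enormE n (u : 'rV[R]_n) : enorm u ^+ 2 = \sum_(i < n) u 0 i ^+ 2.
Proof. by rewrite sqr_enorm; apply: eq_bigr => i _; rewrite expr2. Qed.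

Lemma sqr_enormD n (u v : 'rV[R]_n) :
  enorm (u + v) ^+ 2 = enorm u ^+ 2 + 2 * dotv u v + enorm v ^+ 2.
Proof. by rewrite !sqr_enorm !dotvE (dotvC v u); ring. Qed.

Lemma sqr_enormB n (u v : 'rV[R]_n) :
  enorm (u - v) ^+ 2 = enorm u ^+ 2 - 2 * dotv u v + enorm v ^+ 2.
Proof. by rewrite !sqr_enorm !dotvE (dotvC v u); ring. Qed.

Lemma enorm_eq0 n (u : 'rV[R]_n) : enorm u = 0 -> u = 0.
Proof.
move=> u0; have /eqP := sqr_enormE u; rewrite u0 expr0n /= eq_sym psumr_eq0; last first.
  by move=> i _; rewrite sqr_ge0.
move=> /allP u0'; apply/rowP => i; rewrite mxE; apply/eqP.
by have := u0' i (mem_index_enum i); rewrite sqrf_eq0.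
Qed.

Lemma enorm0 n : enorm (0 : 'rV[R]_n) = 0.
Proof. by rewrite /enorm /dotv big1 ?sqrtr0// => i _; rewrite mxE mul0r. Qed.

Lemma enormN n (u : 'rV[R]_n) : enorm (- u) = enorm u.
Proof. by rewrite /enorm dotvNl dotvNr opprK. Qed.

Lemma enorm_distC n (u v : 'rV[R]_n) : enorm (u - v) = enorm (v - u).
Proof. by rewrite -enormN opprB. Qed.

Lemma enormZ n a (u : 'rV[R]_n) : enorm (a *: u) = `|a| * enorm u.
Proof. by rewrite /enorm dotvZl dotvZr mulrA -expr2 sqrtrM ?sqr_ge0// sqrtr_sqr. Qed.

Lemma dotv_le n (u v : 'rV[R]_n) : dotv u v <= enorm u * enorm v.
Proof.
have [u0|u0] := eqVneq (enorm u) 0.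
  by rewrite (enorm_eq0 u0) -(scale0r v) dotvZl mul0r mulr_ge0 ?enorm_ge0.
have [v0|v0] := eqVneq (enorm v) 0.
  by rewrite (enorm_eq0 v0) -(scale0r u) dotvZr mul0r mulr_ge0 ?enorm_ge0.
have ab : 0 < enorm u * enorm v by rewrite mulr_gt0 ?lt_def ?u0 ?v0 ?enorm_ge0.
have := dotv_ge0 (enorm v *: u - enorm u *: v).
rewrite !dotvE (dotvC v u) -!sqr_enorm => h.
have {}h : 0 <= (enorm u * enorm v) * (enorm u * enorm v - dotv u v) by nra.
by rewrite -subr_ge0 -(pmulr_rge0 _ ab).
Qed.

Lemma ler_enormD n (u v : 'rV[R]_n) : enorm (u + v) <= enorm u + enorm v.
Proof.
rewrite -(ler_pXn2r (n := 2)) ?nnegrE ?addr_ge0 ?enorm_ge0// sqr_enormD.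
by have := dotv_le u v; lra.
Qed.

Lemma ler_enormB n (u v : 'rV[R]_n) : enorm (u - v) <= enorm u + enorm v.
Proof. by rewrite -(enormN v) ler_enormD. Qed.

Lemma ler_enorm_dist n (u v : 'rV[R]_n) : `|enorm u - enorm v| <= enorm (u - v).
Proof.
rewrite ler_norml; apply/andP; split.
  by have := ler_enormB u (u - v); rewrite subKr; lra.
by have := ler_enormD (u - v) v; rewrite subrK; lra.
Qed.

Lemma sqr_enormD_le n (u v : 'rV[R]_n) :
  enorm (u + v) ^+ 2 <= 2 * enorm u ^+ 2 + 2 * enorm v ^+ 2.
Proof.
have := ler_enormD u v; have := enorm_ge0 (u + v).
by have := sqr_ge0 (enorm u - enorm v); nra.
Qed.

Lemma ler_coord_enorm n (u : 'rV[R]_n) i : `|u 0 i| <= enorm u.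
Proof.
rewrite -(ler_pXn2r (n := 2)) ?nnegrE ?enorm_ge0// real_normK ?num_real//.
by rewrite sqr_enormE (bigD1 i)//= lerDl sumr_ge0// => j _; rewrite sqr_ge0.
Qed.

Lemma ler_enorm_coord n (u : 'rV[R]_n) (r : R) :
  (forall i, `|u 0 i| <= r) -> 0 <= r -> enorm u <= n%:R * r.
Proof.
move=> ur r0; rewrite -(ler_pXn2r (n := 2)) ?nnegrE ?enorm_ge0 ?mulr_ge0//.
rewrite sqr_enormE.
have : \sum_(i < n) u 0 i ^+ 2 <= \sum_(i < n) r ^+ 2.
  apply: ler_sum => i _; rewrite -(real_normK (num_real (u 0 i))).
  by rewrite ler_pXn2r ?nnegrE.
move=> /le_trans; apply; rewrite sumr_const card_ord -(mulr_natl (r ^+ 2)) exprMn.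
by rewrite ler_wpM2r ?sqr_ge0// -natrX ler_nat; case: n {u ur} => // n; rewrite leq_pmulr.
Qed.

Lemma coord_mx_norm n (u : 'rV[R]_n) i : `|u 0 i| <= `|u|.
Proof.
rewrite [leRHS]/Num.norm /= mx_normrE; apply/bigmax_geP; right => /=.
by exists (0, i).
Qed.

Lemma enorm_mx_norm n (u : 'rV[R]_n) : enorm u <= n%:R * `|u|.
Proof. by apply: ler_enorm_coord => // i; exact: coord_mx_norm. Qed.

Lemma mx_norm_enorm n (u : 'rV[R]_n) : `|u| <= enorm u.
Proof.
rewrite /Num.norm /= mx_normrE; apply/bigmax_leP; split; first exact: enorm_ge0.
by move=> [i j] _ /=; rewrite ord1 ler_coord_enorm.
Qed.

(** Sup norm and Euclidean norm differ at most by the factor [n], so the library topology can be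
    tested on Euclidean balls. Dividing by [n.+1] also covers dimension zero. *)
Lemma nbhs_enormP n (u : 'rV[R]_n) (A : set 'rV[R]_n) :
  nbhs u A <-> exists2 e, 0 < e & forall v, enorm (v - u) < e -> A v.
Proof.
split.
  move=> /nbhs_ballP [e e0 eA]; exists e => // v uv; apply: eA.
  rewrite -ball_normE /ball_ /= distrC; apply: le_lt_trans uv.
  exact: mx_norm_enorm.
case=> e e0 eA; apply/nbhs_ballP; exists (e / n.+1%:R); first by rewrite /= divr_gt0.
move=> v; rewrite -ball_normE /ball_ /= distrC => uv; apply: eA.
apply: le_lt_trans (enorm_mx_norm _) _.
apply: (@le_lt_trans _ _ (n.+1%:R * `|v - u|)); first by rewrite ler_wpM2r// ler_nat.
by rewrite mulrC -ltr_pdivlMr.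
Qed.

Lemma enorm_lipschitz_continuous n m C (F : 'rV[R]_n -> 'rV[R]_m) (A : set 'rV[R]_n) u :
  open A -> A u ->
  (forall u v, A u -> A v -> enorm (F u - F v) <= C * enorm (u - v)) ->
  {for u, continuous F}.
Proof.
move=> oA Au FC B /nbhs_enormP [e e0 eB].
apply/nbhs_enormP.
have /nbhs_enormP [r r0 rA] : nbhs u A by exact: open_nbhs_nbhs.
exists (Num.min r (e / (`|C| + 1))).
  by rewrite lt_min r0 divr_gt0// ltr_wpDl.
move=> v; rewrite lt_min => /andP[vr ve]; apply: eB.
apply: le_lt_trans (FC _ _ (rA _ vr) Au) _.
move: ve; rewrite ltr_pdivlMr ?ltr_wpDl// mulrC.
apply: le_lt_trans; rewrite ler_wpM2r ?enorm_ge0//.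
by apply: le_trans (ler_norm _) _; rewrite lerDl.
Qed.

Lemma enorm_lipschitz_continuous1 n C (F : 'rV[R]_n -> R) (A : set 'rV[R]_n) u :
  open A -> A u ->
  (forall u v, A u -> A v -> `|F u - F v| <= C * enorm (u - v)) ->
  {for u, continuous F}.
Proof.
move=> oA Au FC B /nbhs_ballP [e e0 eB].
apply/nbhs_enormP.
have /nbhs_enormP [r r0 rA] : nbhs u A by exact: open_nbhs_nbhs.
exists (Num.min r (e / (`|C| + 1))).
  by rewrite lt_min r0 divr_gt0// ltr_wpDl.
move=> v; rewrite lt_min => /andP[vr ve]; apply: eB; rewrite -ball_normE /ball_ /=.
apply: le_lt_trans (FC _ _ Au (rA _ vr)) _; rewrite enorm_distC.
move: ve; rewrite ltr_pdivlMr ?ltr_wpDl// mulrC.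
apply: le_lt_trans; rewrite ler_wpM2r ?enorm_ge0//.
by apply: le_trans (ler_norm _) _; rewrite lerDl.
Qed.

Lemma enorm_continuous n : continuous (@enorm R n).
Proof.
move=> u; apply: (@enorm_lipschitz_continuous1 _ 1 _ setT) => //; first exact: openT.
by move=> v w _ _; rewrite mul1r ler_enorm_dist.
Qed.

Lemma dotv_mulmx_tr n m (A : 'M[R]_(n, m)) (y : 'rV[R]_m) (v : 'rV[R]_n) :
  dotv (y *m A^T) v = dotv y (v *m A).
Proof.
have dE k (a b : 'rV[R]_k) : dotv a b = (a *m b^T) 0 0.
  by rewrite mxE; apply: eq_bigr => i _; rewrite mxE.
by rewrite !dE trmx_mul mulmxA.
Qed.

(** A matrix and its transpose share their operator norm: with [z = y *m F^T],
    [|z|^2 = dotv y (z *m F) <= |y| C |z|]. *)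
Lemma enorm_trmx_le n m (F : 'M[R]_(n, m)) C :
  0 <= C -> (forall v : 'rV[R]_n, enorm (v *m F) <= C * enorm v) ->
  forall y : 'rV[R]_m, enorm (y *m F^T) <= C * enorm y.
Proof.
move=> C0 FC y; set z := y *m F^T.
have adj : dotv z z = dotv y (z *m F) by exact: dotv_mulmx_tr.
have [z0|z0] := eqVneq (enorm z) 0; first by rewrite z0 mulr_ge0 ?enorm_ge0.
have z1 : 0 < enorm z by rewrite lt_def z0 enorm_ge0.
have := dotv_le y (z *m F); rewrite -adj -sqr_enorm => h.
rewrite -(ler_pM2r z1) -expr2; apply: le_trans h _.
have := ler_wpM2l (enorm_ge0 y) (FC z); nra.
Qed.

(** The a priori bound [C] makes the set under the [sup] of [opnorm] bounded above; otherwise [sup]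
    would carry no information. *)
Lemma opnorm_le n m (A : 'M[R]_(n, m)) C (y : 'rV[R]_m) :
  (forall v : 'rV[R]_m, enorm (v *m A^T) <= C * enorm v) ->
  enorm (y *m A^T) <= opnorm A * enorm y.
Proof.
move=> AC; have [y0|y0] := eqVneq (enorm y) 0.
  by rewrite (enorm_eq0 y0) mul0mx !enorm0 mulr0.
have y1 : 0 < enorm y by rewrite lt_def y0 enorm_ge0.
rewrite -ler_pdivrMr//.
have -> : enorm (y *m A^T) / enorm y = enorm (((enorm y)^-1 *: y) *m A^T).
  by rewrite -scalemxAl enormZ ger0_norm ?invr_ge0 ?enorm_ge0// mulrC.
apply: ub_le_sup; last first.
  exists ((enorm y)^-1 *: y) => //=.
  by rewrite enormZ ger0_norm ?invr_ge0 ?enorm_ge0// mulVf.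
exists `|C| => _ [v /= v1 <-]; apply: le_trans (AC v) _.
have := ler_norm C; have := enorm_ge0 v; have := normr_ge0 C; nra.
Qed.

Lemma edist_le n (v s : 'rV[R]_n) (S : set 'rV[R]_n) :
  S s -> edist v S <= enorm (v - s).
Proof.
move=> Ss; apply: ge_inf; last by exists s.
by exists 0 => _ [t _ <-]; exact: enorm_ge0.
Qed.

Lemma edist_ge0 n (v : 'rV[R]_n) (S : set 'rV[R]_n) : S !=set0 -> 0 <= edist v S.
Proof.
move=> [s Ss]; apply: lb_le_inf; first by exists (enorm (v - s)), s.
by move=> _ [t _ <-]; exact: enorm_ge0.
Qed.

End EuclideanSpace.

Section Projection.
Context {R : realType} {n : nat}.
Variable S : set 'rV[R]_n.
Hypothesis S0 : S !=set0.
Hypothesis Scl : closed S.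
Hypothesis Scv : forall (u v : 'rV[R]_n) (t : R),
  0 <= t -> t <= 1 -> S u -> S v -> S (u + t *: (v - u)).

Lemma proj_spec v :
  S (proj S v) /\ forall s, S s -> enorm (v - proj S v) <= enorm (v - s).
Proof.
apply: (@xgetPex _ 0 [set p | S p /\ forall s, S s -> enorm (v - p) <= enorm (v - s)]).
have [s0 Ss0] := S0.
(* Cutting [S] down to the points no farther from [v] than [s0] gives a compact set that still
   contains every minimiser. *)
pose A := S `&` [set s | enorm (v - s) <= enorm (v - s0)].
have Eco : continuous (fun s : 'rV[R]_n => enorm (v - s)).
  move=> s; apply: (@enorm_lipschitz_continuous1 _ _ 1 _ setT) => //; first exact: openT.
  move=> a b _ _; rewrite mul1r; apply: le_trans (ler_enorm_dist _ _) _.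
  by rewrite opprB addrC subrKA enorm_distC.
have Aco : compact A.
  apply: bounded_closed_compact.
    exists (enorm v + enorm (v - s0)); split; first exact: num_real.
    move=> r rM s [_ /= As]; apply: le_trans (mx_norm_enorm _) _; apply: ltW.
    apply: le_lt_trans rM; have := ler_enormB v (v - s); rewrite subKr; lra.
  apply: closedI => //.
  apply: (@preimage_closed _ _ (fun s : 'rV[R]_n => enorm (v - s)) [set r : R | r <= enorm (v - s0)]).
    by move=> s _; exact: Eco.
  exact: closed_le.
have A0 : A !=set0 by exists s0; split => //=.
have [p Ap pmin] := @compact_EVT_min _ _ _ _ A0 Aco (@continuous_subspaceT _ _ A _ Eco).
exists p; case: (set_mem Ap) => Sp Ap2; split => // s Ss.
have [h|h] := leP (enorm (v - s)) (enorm (v - s0)).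
  by apply: pmin; rewrite inE.
exact: le_trans Ap2 (ltW h).
Qed.

End Projection.

Section ProjectionTheory.
Context {R : realType} {n : nat}.
Variable S : set 'rV[R]_n.
Hypothesis S0 : S !=set0.
Hypothesis Scl : closed S.
Hypothesis Scv : forall (u v : 'rV[R]_n) (t : R),
  0 <= t -> t <= 1 -> S u -> S v -> S (u + t *: (v - u)).

Lemma proj_in v : S (proj S v).
Proof. by case: (proj_spec S0 Scl v). Qed.

Lemma proj_dotv_le v s : S s -> dotv (v - proj S v) (s - proj S v) <= 0.
Proof.
move=> Ss; have [Sp pmin] := proj_spec S0 Scl v; move: (proj S v) Sp pmin => p Sp pmin.
rewrite leNgt; apply/negP => a0.
set a := dotv _ _ in a0; pose b := dotv (s - p) (s - p).
have b0 : 0 <= b by exact: dotv_ge0.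
(* t lies below the minimiser a / b of t |-> |v - p - t (s - p)|^2, and below 1 so
   that p + t (s - p) stays in S. *)
pose t := a / (a + b).
have ab : 0 < a + b by rewrite ltr_wpDr.
have t0 : 0 < t by rewrite divr_gt0.
have t1 : t <= 1 by rewrite ler_pdivrMr// mul1r lerDl.
have := pmin _ (Scv (ltW t0) t1 Sp Ss).
rewrite -(ler_pXn2r (n := 2)) ?nnegrE ?enorm_ge0// opprD addrA (sqr_enormB (v - p)).
rewrite dotvZr enormZ exprMn real_normK ?num_real// (sqr_enorm (s - p)) -/a -/b => h.
have e : t * (a + b) = a by rewrite divfK ?gt_eqF.
have := mulr_gt0 t0 a0; have := mulr_gt0 t0 (mulr_gt0 t0 a0); nra.
Qed.

Lemma proj_dist_le v s : S s -> enorm (proj S v - s) <= enorm (v - s).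
Proof.
move=> Ss; have := proj_dotv_le v Ss; rewrite -(opprB (proj S v) s) dotvNr oppr_le0 => h.
have -> : v - s = (v - proj S v) + (proj S v - s) by rewrite addrA subrK.
rewrite -(ler_pXn2r (n := 2)) ?nnegrE ?enorm_ge0// (sqr_enormD (v - proj S v)).
have := sqr_ge0 (enorm (v - proj S v)); lra.
Qed.

(** Adding the obtuse-angle inequalities at the two projections gives
    [|pu - pv|^2 <= dotv (u - v) (pu - pv)]; Cauchy-Schwarz concludes. *)
Lemma proj_nonexpansive u v : enorm (proj S u - proj S v) <= enorm (u - v).
Proof.
have [->|] := eqVneq (enorm (proj S u - proj S v)) 0; first exact: enorm_ge0.
move=> p0; have p1 : 0 < enorm (proj S u - proj S v) by rewrite lt_def p0 enorm_ge0.
have := proj_dotv_le u (proj_in v); rewrite -(opprB (proj S u) (proj S v)) dotvNr oppr_le0 => h1.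
have h2 := proj_dotv_le v (proj_in u).
have h3 := dotv_le (u - v) (proj S u - proj S v).
rewrite -(ler_pM2r p1); apply: le_trans h3; rewrite -expr2 sqr_enorm.
have e : u - v = (u - proj S u) + (proj S u - proj S v) - (v - proj S v).
  by rewrite subrKA opprB subrKA.
rewrite {}e; move: (proj S u - proj S v) (u - proj S u) (v - proj S v) h1 h2 => d a b h1 h2.
by rewrite !dotvDl dotvNl -addrA addrCA lerDl subr_ge0 (le_trans h2).
Qed.

Lemma proj_id v : S v -> proj S v = v.
Proof.
move=> Sv; apply/eqP; rewrite -subr_eq0; apply/eqP/enorm_eq0/eqP.
rewrite eq_le enorm_ge0 andbT; apply: le_trans (proj_dist_le v Sv) _.
by rewrite subrr enorm0.
Qed.

End ProjectionTheory.

Section Sets.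
Context {R : realType} {n : nat}.

Lemma convex_setP (X : set 'rV[R]_n) : convex_set (X : set (convex_lmodType 'rV[R]_n)) ->
  forall (u v : 'rV[R]_n) (t : R), 0 <= t -> t <= 1 -> X u -> X v -> X (u + t *: (v - u)).
Proof.
move=> cX u v t t0 t1 Xu Xv.
have /set_mem := cX v u (Itv01 t0 t1) (mem_set Xv) (mem_set Xu).
rewrite /conv /= /conv /=; congr (X _).
by rewrite /unstable.onem scalerBl scale1r scalerBr addrCA.
Qed.

Lemma closed_eball (r : R) : closed (eball r : set 'rV[R]_n).
Proof.
apply: (@preimage_closed _ _ (@enorm R n) [set s : R | s <= r]).
  by move=> s _; exact: enorm_continuous.
exact: closed_le.
Qed.

Lemma convex_eball (r : R) (u v : 'rV[R]_n) t :
  0 <= t -> t <= 1 -> eball r u -> eball r v -> eball r (u + t *: (v - u)).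
Proof.
move=> t0 t1; rewrite /eball /= => ur vr.
have -> : u + t *: (v - u) = (1 - t) *: u + t *: v.
  by rewrite scalerBr scalerBl scale1r addrCA addrC.
apply: le_trans (ler_enormD _ _) _; rewrite !enormZ !ger0_norm ?subr_ge0//.
by nra.
Qed.

Lemma eball_nonempty (r : R) : 0 <= r -> (eball r : set 'rV[R]_n) !=set0.
Proof. by move=> r0; exists 0; rewrite /eball /= enorm0. Qed.

End Sets.

(** * Gradients and the descent lemma *)

Section Calculus.
Context {R : realType}.

Lemma dotv_grad n (F : 'rV[R]_n -> R) x v :
  differentiable F x -> 'D_v F x = dotv (grad F x) v.
Proof.
move=> dF; rewrite deriveE// {1}[v]row_sum_delta linear_sum.
apply: eq_bigr => i _; rewrite linearZ /= mxE mulrC.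
by rewrite -deriveE.
Qed.

(** The bound on difference quotients passes to the limit. The seminorm [N] is abstract because the
    lemma serves both the absolute value, for [f], and [enorm], for [c], which is not the library
    norm. *)
Lemma derive_bound n (W : normedModType R) (F : 'rV[R]_n -> W) (N : W -> R) (C : R)
    (A : set 'rV[R]_n) x v :
  derivable F x v -> continuous N ->
  (forall a w, N (a *: w) = `|a| * N w) ->
  open A -> A x ->
  (forall u v, A u -> A v -> N (F u - F v) <= C * enorm (u - v)) ->
  N ('D_v F x) <= C * enorm v.
Proof.
move=> dF cN NZ oA Ax FC; rewrite /derive.
have cq := cvg_comp _ _ dF (cN ('D_v F x)).
rewrite -(cvg_lim _ cq)//; apply: limr_le; first by apply/cvg_ex; eexists; exact: cq.
have : \forall h \near 0^', A (h *: v + x).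
  apply: nbhs_dnbhs.
  have c : continuous (fun h : R => h *: v + x).
    by move=> h; apply: cvgD; [exact: scalel_continuous|exact: cvg_cst].
  apply: (c 0); rewrite scale0r add0r; exact: open_nbhs_nbhs.
move=> hA; have hn : \forall h \near (0 : R)^', h != 0 by exact: nbhs_dnbhs_neq.
apply: filterS2 hA hn => h hA h0.
rewrite /= NZ normfV mulrC ler_pdivrMr ?normr_gt0//.
apply: le_trans (FC _ _ hA Ax) _.
by rewrite addrK enormZ mulrA mulrAC.
Qed.

Lemma grad_bound n (F : 'rV[R]_n -> R) (C : R) (A : set 'rV[R]_n) x :
  0 <= C -> open A -> A x -> differentiable F x ->
  (forall u v, A u -> A v -> `|F u - F v| <= C * enorm (u - v)) ->
  enorm (grad F x) <= C.
Proof.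
move=> C0 oA Ax dF FC.
have [->//|g0] := eqVneq (enorm (grad F x)) 0.
have g1 : 0 < enorm (grad F x) by rewrite lt_def g0 enorm_ge0.
have dv : derivable (F : 'rV[R]_n -> R^o) x (grad F x) by exact: diff_derivable.
(* Differentiating along the gradient itself yields [|grad|^2 <= C |grad|]. *)
have := @derive_bound n R^o F Num.norm C A x (grad F x) dv
  (@norm_continuous _ R^o) (@normrM R) oA Ax FC.
rewrite dotv_grad// -sqr_enorm => h.
rewrite -(ler_pM2r g1) -expr2; exact: le_trans (ler_norm _) h.
Qed.

Lemma is_derive_line n (F : 'rV[R]_n -> R) (x v : 'rV[R]_n) (t : R) :
  derivable F (x + t *: v) v ->
  is_derive t (1 : R) (fun s : R => F (x + s *: v)) ('D_v F (x + t *: v)).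
Proof.
move=> dF.
have e : (fun h : R => h^-1 *: (((fun s : R => F (x + s *: v)) \o shift t) (h *: (1 : R))
            - F (x + t *: v))) =
         (fun h : R => h^-1 *: ((F \o shift (x + t *: v)) (h *: v) - F (x + t *: v))).
  apply/funext => h /=; congr (_ *: (F _ - _)).
  by rewrite [h *: 1]mulr1 scalerDl addrCA.
by apply: DeriveDef; [rewrite /derivable e|rewrite /derive e].
Qed.

Lemma is_derive_quadratic (a b t : R) :
  is_derive t (1 : R) (fun s : R => s * a + b * s ^+ 2) (a + b * (2 * t)).
Proof.
have h := is_deriveD (is_deriveZ a (is_derive_id t (1 : R)))
  (is_deriveZ b (is_deriveX 2 (is_derive_id t (1 : R)))).
have -> : (fun s : R => s * a + b * s ^+ 2) = a *: (@id R) + b *: (@id R) ^+ 2.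
  by apply/funext => s /=; rewrite !fctE /= mulrC.
have -> : a + b * (2 * t) = a *: (1 : R) + b *: ((2%:R * t ^+ 1) *: (1 : R)).
  by rewrite ![_ *: (1 : R)]mulr1 expr1.
exact: h.
Qed.

(** The mean value theorem replaces the usual integral: [phi], the restriction of [F] to the segment
    minus its quadratic majorant, has a nonpositive derivative. Regularity is asked on [X] alone,
    where the Lipschitz bounds on gradients hold. *)
Lemma descent_lemma n (F : 'rV[R]_n -> R) (G : 'rV[R]_n -> 'rV[R]_n) (l : R)
    (X : set 'rV[R]_n) (x y : 'rV[R]_n) :
  (forall t : R, 0 <= t -> t <= 1 -> X (x + t *: (y - x))) ->
  (forall z v : 'rV[R]_n, X z -> derivable F z v /\ 'D_v F z = dotv (G z) v) ->
  (forall u v, X u -> X v -> enorm (G u - G v) <= l * enorm (u - v)) ->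
  F y <= F x + dotv (G x) (y - x) + l / 2 * enorm (y - x) ^+ 2.
Proof.
move=> Xs FG Gl; set d := y - x.
pose q (t : R) := t * dotv (G x) d + l / 2 * enorm d ^+ 2 * t ^+ 2.
pose phi := (fun t : R => F (x + t *: d)) - q.
pose dphi (t : R) := dotv (G (x + t *: d)) d - (dotv (G x) d + l / 2 * enorm d ^+ 2 * (2 * t)).
have phi' (t : R) : t \in `[0, 1] -> is_derive t (1:R) phi (dphi t).
  rewrite in_itv/= => /andP[t0 t1]; have [dF dE] := FG _ d (Xs t t0 t1).
  have := is_derive_line dF; rewrite dE => h.
  exact: (is_deriveB h (is_derive_quadratic _ _ _)).
have phic : {within `[0, 1], continuous phi}.
  apply: derivable_within_continuous => t /phi' h; exact: ex_derive.
have phi'' (t : R) : t \in `]0, 1[ -> is_derive t (1:R) phi (dphi t).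
  by move=> /subset_itv_oo_cc /phi'.
have [t t01] := MVT_segment ler01 phi'' phic.
have -> : phi 0 = F x.
  by rewrite /phi /q !fctE /= scale0r addr0 mul0r expr0n mulr0 addr0 subr0.
have xd : x + d = y by rewrite addrC subrK.
have -> : phi 1 = F y - (dotv (G x) d + l / 2 * enorm d ^+ 2).
  by rewrite /phi /q !fctE /= scale1r xd mul1r expr1n mulr1.
rewrite subr0 mulr1 => e.
suff : dphi t <= 0 by move: e; lra.
move: t01; rewrite in_itv/= => /andP[t0 t1].
have := Gl _ _ (Xs t t0 t1) (Xs 0 (lexx _) ler01).
rewrite scale0r addr0 addrAC subrr add0r enormZ ger0_norm// => h1.
have := dotv_le (G (x + t *: d) - G x) d; rewrite dotvDl dotvNl => h2.
have := ler_wpM2r (enorm_ge0 d) h1; rewrite /dphi; move: h2; rewrite -/d; nra.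
Qed.

Lemma enorm_jacobian n m (c : 'rV[R]_n -> 'rV[R]_m) (C : R) (V : set 'rV[R]_n) x v :
  open V -> V x -> differentiable c x ->
  (forall u v, V u -> V v -> enorm (c u - c v) <= C * enorm (u - v)) ->
  enorm (v *m 'J c x) <= C * enorm v.
Proof.
move=> oV Vx dc cC; rewrite -deriveEjacobian//.
apply: derive_bound oV Vx cC; [exact: diff_derivable|exact: enorm_continuous|].
exact: enormZ.
Qed.

(** Identifies [nablac_c c] as the gradient of the squared violation, which brings feasibility under
    the descent lemma. *)
Lemma derive_half_sqr_enorm n m (c : 'rV[R]_n -> 'rV[R]_m) (x v : 'rV[R]_n) :
  differentiable c x ->
  derivable (fun z : 'rV[R]_n => enorm (c z) ^+ 2 / 2) x v /\
  'D_v (fun z : 'rV[R]_n => enorm (c z) ^+ 2 / 2) x = dotv (nablac_c c x) v.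
Proof.
move=> dc; have dcv : derivable c x v by exact: diff_derivable.
have dci i : derivable (fun z : 'rV[R]_n => c z 0 i) x v by have /derivable_mxP := dcv; exact.
have -> : (fun z : 'rV[R]_n => enorm (c z) ^+ 2 / 2) =
          (2^-1 : R) *: \sum_(i < m) (fun z : 'rV[R]_n => c z 0 i) ^+ 2.
  apply/funext => z; rewrite sqr_enormE mulrC fctE; congr (_ * _).
  by rewrite fct_sumE; apply: eq_bigr => i _; rewrite fctE.
have h : is_derive x v ((2^-1 : R) *: \sum_(i < m) (fun z : 'rV[R]_n => c z 0 i) ^+ 2)
  (2^-1 *: \sum_(i < m) ((2%:R * c x 0 i ^+ 1) *: 'D_v (fun z : 'rV[R]_n => c z 0 i) x)).
  apply: is_deriveZ; apply: is_derive_sum => i; apply: is_deriveX.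
  exact: derivableP.
split; first exact: ex_derive.
rewrite derive_val /nablac_c dotv_mulmx_tr -deriveEjacobian// derive_mx//.
rewrite /dotv scaler_sumr; apply: eq_bigr => i _; rewrite mxE expr1.
by rewrite scalerA mulrA mulVf// mul1r.
Qed.

(** Origin of [smooth_const]: in the product rule, [Lc ^+ 2] comes from the variation of [c] and
    [Cc * Lgc] from that of the Jacobian. *)
Lemma nablac_c_lipschitz n m (c : 'rV[R]_n -> 'rV[R]_m) (Lc Lgc Cc : R)
    (V X : set 'rV[R]_n) :
  0 <= Lc -> 0 <= Lgc -> open V -> X `<=` V ->
  (forall x, V x -> differentiable c x) ->
  (forall u v, V u -> V v -> enorm (c u - c v) <= Lc * enorm (u - v)) ->
  (forall u v, V u -> V v -> opnorm ('J c u - 'J c v) <= Lgc * enorm (u - v)) ->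
  (forall x, X x -> enorm (c x) <= Cc) ->
  forall u v, X u -> X v ->
  enorm (nablac_c c u - nablac_c c v) <= smooth_const Lc Cc Lgc * enorm (u - v).
Proof.
move=> Lc0 Lgc0 oV XV dc cL JL cB u v Xu Xv.
have JT x (y : 'rV[R]_m) : V x -> enorm (y *m ('J c x)^T) <= Lc * enorm y.
  move=> Vx; apply: enorm_trmx_le => // w.
  exact: (enorm_jacobian w oV Vx (dc _ Vx) cL).
have -> : nablac_c c u - nablac_c c v =
    (c u - c v) *m ('J c u)^T + c v *m ('J c u - 'J c v)^T.
  by rewrite linearB /= mulmxBl mulmxBr addrA subrK.
apply: le_trans (ler_enormD _ _) _; rewrite /smooth_const mulrDl.
apply: lerD.
  apply: le_trans (JT _ _ (XV _ Xu)) _; rewrite expr2 -mulrA ler_wpM2l//.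
  by apply: cL; exact: XV.
(* A crude bound, there only to make the supremum in [opnorm] finite. *)
have JB w : enorm (w *m ('J c u - 'J c v)^T) <= (Lc + Lc) * enorm w.
  rewrite linearB /= mulmxBr mulrDl; apply: le_trans (ler_enormB _ _) _.
  by apply: lerD; apply: JT; exact: XV.
apply: le_trans (opnorm_le _ JB) _.
have := JL _ _ (XV _ Xu) (XV _ Xv); have := cB _ Xv.
have := enorm_ge0 (c v); have := mulr_ge0 Lgc0 (enorm_ge0 (u - v)).
move=> a b d e; apply: le_trans (ler_wpM2r b e) _.
by rewrite -(mulrA Cc) (mulrC Cc) ler_wpM2l.
Qed.

Lemma nablac_c_bound n m (c : 'rV[R]_n -> 'rV[R]_m) (Lc Cc : R) (V X : set 'rV[R]_n) :
  0 <= Lc -> open V -> X `<=` V ->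
  (forall x, V x -> differentiable c x) ->
  (forall u v, V u -> V v -> enorm (c u - c v) <= Lc * enorm (u - v)) ->
  (forall x, X x -> enorm (c x) <= Cc) ->
  forall x, X x -> enorm (nablac_c c x) <= Cc * Lc.
Proof.
move=> Lc0 oV XV dc cL cB x Xx; rewrite mulrC.
apply: (@le_trans _ _ (Lc * enorm (c x))); last by rewrite ler_wpM2l// cB.
apply: enorm_trmx_le => // w.
exact: (enorm_jacobian w oV (XV _ Xx) (dc _ (XV _ Xx)) cL).
Qed.

End Calculus.

(** * Measurability and freezing of independent arguments *)

Section MonotoneIntegral.
Context d (T : measurableType d) (R : realType) (mu : {measure set T -> \bar R}).

(* The integral of a nonnegative function is the supremum of the integrals of the
   simple functions below it, so monotonicity needs no measurability; the squared
   distance to the shifted normal cone is not known to be measurable. *)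
Lemma le_integral_nomeas (f g : T -> \bar R) :
  (forall x, 0 <= f x)%E -> (forall x, f x <= g x)%E ->
  (\int[mu]_x f x <= \int[mu]_x g x)%E.
Proof.
move=> f0 fg; have g0 x : (0 <= g x)%E by exact: le_trans (f0 x) (fg x).
rewrite !ge0_integralTE//; apply: le_ereal_sup => _ [h hf <-].
by exists h => // x; exact: le_trans (hf x) (fg x).
Qed.

End MonotoneIntegral.

Section Caratheodory.
Context {R : realType} {n : nat}.

Definition grid_index (N : nat) (y : 'rV[R]_n) : 'rV[int]_n :=
  \row_i Num.floor (N.+1%:R * y 0 i).

Definition grid_point (N : nat) (z : 'rV[int]_n) : 'rV[R]_n :=
  \row_i ((z 0 i)%:~R / N.+1%:R).

Lemma grid_cvg y : grid_point N (grid_index N y) @[N --> \oo] --> y.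
Proof.
apply/cvgrPdist_lt => e e0.
near=> N.
apply: le_lt_trans (mx_norm_enorm _) _.
apply: (@le_lt_trans _ _ (n%:R * N.+1%:R^-1)).
  apply: ler_enorm_coord => // i; rewrite !mxE.
  have /andP[h1 h2] := floor_itv (N.+1%:R * y 0 i).
  set fl := (Num.floor _)%:~R; have -> : y 0 i - fl / N.+1%:R = (N.+1%:R * y 0 i - fl) / N.+1%:R.
    by rewrite mulrBl mulrAC divff ?mul1r.
  rewrite normrM (ger0_norm (x := _^-1))// ler_piMl//.
  by move: h2; rewrite intrD ler_norml -/fl => h2; apply/andP; split; lra.
near: N; have [n0|n0] := eqVneq n%:R (0 : R).
  by apply: nearW => N; rewrite n0 mul0r.
have n1 : 0 < n%:R :> R by rewrite lt_def n0 /=.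
apply: filterS (near_infty_natSinv_lt (PosNum (divr_gt0 e0 n1))) => N /=.
by rewrite ltr_pdivlMr// mulrC.
Unshelve. all: by end_near.
Qed.

(* Rounding [Y] to a finer and finer grid gives countably valued approximations. *)
Lemma measurable_fun_caratheodory d (T : measurableType d) (Y : T -> 'rV[R]_n)
    (phi : 'rV[R]_n -> T -> R) :
  (forall i, measurable_fun setT (fun w => Y w 0 i)) ->
  (forall y, measurable_fun setT (phi y)) ->
  (forall w, {for Y w, continuous (phi ^~ w)}) ->
  measurable_fun setT (fun w => phi (Y w) w).
Proof.
move=> mY mphi cphi.
pose h N w := phi (grid_point N (grid_index N (Y w))) w.
apply: (@measurable_fun_cvg _ _ _ _ h); last first.
  by move=> w _; exact: (cvg_comp _ _ (@grid_cvg (Y w)) (cphi w)).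
move=> N _ B mB; rewrite setTI.
have -> : h N @^-1` B = \bigcup_(z : 'rV[int]_n)
    ([set w | grid_index N (Y w) = z] `&` (phi (grid_point N z) @^-1` B)).
  apply/seteqP; split => w /=; first by exists (grid_index N (Y w)).
  by move=> [z _ [/= <-]].
apply: countable_bigcupT_measurable => // z.
apply: measurableI; last by rewrite -[_ @^-1` _]setTI; exact: mphi.
have -> : [set w | grid_index N (Y w) = z] = \bigcap_(i in [set: 'I_n])
    ((fun w => Y w 0 i) @^-1` [set r | Num.floor (N.+1%:R * r) = z 0 i]).
  apply/seteqP; split => w /=; first by move=> <- i _; rewrite /= mxE.
  by move=> wz; apply/rowP => i; rewrite mxE wz.
apply: fin_bigcap_measurable; first exact: finite_finset.
move=> i _; rewrite -[_ @^-1` _]setTI; apply: mY => //.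
have -> : [set r : R | Num.floor (N.+1%:R * r) = z 0 i] =
    [set` `[(z 0 i)%:~R / N.+1%:R, (z 0 i + 1)%:~R / N.+1%:R[ ].
  apply/seteqP; split => r /=.
    move=> /eqP; rewrite floor_eq in_itv /= => /andP[a b].
    by rewrite ler_pdivrMr// ltr_pdivlMr// mulrC a.
  rewrite in_itv /= ler_pdivrMr// ltr_pdivlMr// => /andP[a b].
  by apply/eqP; rewrite floor_eq mulrC a.
exact: measurable_itv.
Qed.

End Caratheodory.

(** * Independence as a product law *)

Section Freezing.
Context {R : realType} {d d' : measure_display}.
Context {T : measurableType d} {Xi : measurableType d'}.
Variables (P : probability T R) (mu : probability Xi R) (Y : {mfun T >-> Xi}).
Variable G : set (set T).
Hypothesis Gm : G `<=` measurable.
Hypothesis GT : G setT.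
Hypothesis GI : setI_closed G.
Hypothesis Gindep : forall A B, G A -> measurable B ->
  P (A `&` Y @^-1` B) = (P A * mu B)%E.

(** For fixed [B] both sides are finite measures in [A] that agree on the pi-system [G]; since [G]
    contains [setT], they agree on the generated sigma-algebra. *)
Lemma indep_sigma A B : <<s G >> A -> measurable B ->
  P (A `&` Y @^-1` B) = (P A * mu B)%E.
Proof.
move=> sA mB.
have mYB : measurable (Y @^-1` B) by rewrite -[_ @^-1` _]setTI; exact: measurable_funP.
have b0 : 0 <= fine (mu B) by exact: fine_ge0.
pose m1 := mrestr P mYB.
pose m2 := mscale (NngNum b0) P.
have muBE : (fine (mu B))%:E = mu B by rewrite fineK// fin_num_measure.
have m12 C : G C -> m1 C = m2 C.
  by move=> GC; rewrite /m1 /m2 /mrestr /mscale /= Gindep// muBE muleC.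
transitivity (m2 A); last by rewrite /m2 /mscale /= muBE muleC.
apply: (@g_sigma_algebra_measure_unique _ R T G Gm (fun=> setT) (fun=> GT)
  _ m1 m2 GI m12 _ A sA); first by rewrite bigcup_const.
move=> _; rewrite /m1 /= /mrestr setTI.
by apply: le_lt_trans (probability_le1 _ mYB) _; rewrite ltry.
Qed.

Lemma measurable_to_sigma : measurable_fun setT (id : T -> g_sigma_algebraType G).
Proof.
move=> _ A mA; rewrite setTI; apply: (smallest_sub _ Gm mA).
exact: sigma_algebra_measurable.
Qed.

(** The identity into the coarser sigma-algebra; its law is the restriction of [P] to the events
    generated by [G]. *)
Let idG : {mfun T >-> g_sigma_algebraType G} :=
  HB.pack (id : T -> g_sigma_algebraType G)
    (isMeasurableFun.Build _ _ _ _ _ measurable_to_sigma).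

(** By independence the pair [(w, Y w)] has a product law on rectangles, hence everywhere, and
    Tonelli applies. Typing the first argument in [g_sigma_algebraType G] is what says that [phi]
    sees [w] only through the past. *)
Lemma freezing (phi : g_sigma_algebraType G * Xi -> \bar R) :
  measurable_fun setT phi -> (forall z, 0 <= phi z)%E ->
  (\int[P]_w phi (w, Y w) = \int[P]_w \int[mu]_s phi (w, s))%E.
Proof.
move=> mphi phi0.
pose psi (w : T) : g_sigma_algebraType G * Xi := (w, Y w).
have mpsi : measurable_fun setT psi.
  by apply: measurable_fun_pair; [exact: measurable_to_sigma|exact: measurable_funP].
pose Psi : {mfun T >-> (g_sigma_algebraType G * Xi)%type} :=
  HB.pack psi (isMeasurableFun.Build _ _ _ _ _ mpsi).
have prodE : forall C, measurable C ->
    (distribution P idG \x mu)%E C = distribution P Psi C.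
  apply: product_measure_unique => A B mA mB.
  rewrite /distribution /pushforward /= -indep_sigma//.
transitivity (\int[distribution P Psi]_z phi z)%E.
  by rewrite ge0_integral_distribution.
transitivity (\int[(distribution P idG \x mu)%E]_z phi z)%E.
  apply: eq_measure_integral => C mC _; first [exact: prodE | exact/esym/prodE].
rewrite fubini_tonelli1//.
rewrite ge0_integral_distribution//.
  exact: measurable_fun_fubini_tonelli_F.
by move=> y; apply: integral_ge0.
Qed.

End Freezing.

Section RealExpectation.
Context d (T : measurableType d) {R : realType} (P : probability T R).

(** Integrability travels with a real value, so that linear combinations of expectations need no
    side conditions in [\bar R]. *)
Definition has_expectation (f : T -> R) (e : R) : Prop :=
  P.-integrable setT (EFin \o f) /\ (\int[P]_w (f w)%:E = e%:E)%E.

Lemma has_expectation_cst a : has_expectation (cst a) a.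
Proof.
split; first exact: finite_measure_integrable_cst.
by rewrite -[RHS]mule1 -(probability_setT P) -(integral_cst P measurableT a%:E).
Qed.

Lemma has_expectationD f g a b : has_expectation f a -> has_expectation g b ->
  has_expectation (fun w => f w + g w) (a + b).
Proof.
move=> [fi fa] [gi gb]; split.
  have -> : EFin \o (fun w => f w + g w) = (EFin \o f) \+ (EFin \o g) by [].
  exact: integrableD.
under eq_integral => w _ do rewrite EFinD.
by rewrite integralD// fa gb.
Qed.

Lemma has_expectationZ f a k : has_expectation f a ->
  has_expectation (fun w => k * f w) (k * a).
Proof.
move=> [fi fa]; split.
  have -> : EFin \o (fun w => k * f w) = (fun w => k%:E * (EFin \o f) w)%E by [].
  exact: integrableZl.
under eq_integral => w _ do rewrite EFinM.
by rewrite integralZl// fa.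
Qed.

Lemma has_expectation_sum (I : eqType) (r : seq I) (f : I -> T -> R) (a : I -> R) :
  (forall i, i \in r -> has_expectation (f i) (a i)) ->
  has_expectation (fun w => \sum_(i <- r) f i w) (\sum_(i <- r) a i).
Proof.
elim: r => [_|i r ih fa].
  have -> : (fun w => \sum_(i <- [::]) f i w) = cst 0.
    by apply/funext => w; rewrite big_nil.
  by rewrite big_nil; exact: has_expectation_cst.
have -> : (fun w => \sum_(i <- i :: r) f i w) = (fun w => f i w + \sum_(i <- r) f i w).
  by apply/funext => w; rewrite big_cons.
rewrite big_cons; apply: has_expectationD; first exact/fa/mem_head.
by apply: ih => j jr; apply: fa; rewrite in_cons jr orbT.
Qed.

Lemma has_expectation_le f g a b : has_expectation f a -> has_expectation g b ->
  (forall w, f w <= g w) -> a <= b.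
Proof.
move=> [fi fa] [gi gb] fg; rewrite -lee_fin -fa -gb.
by apply: le_integral => // w _; rewrite lee_fin.
Qed.

Lemma has_expectation_ge0 f a : has_expectation f a -> (forall w, 0 <= f w) -> 0 <= a.
Proof. by move=> fa; apply: has_expectation_le (has_expectation_cst 0) fa. Qed.

Lemma has_expectation_bounded (f : T -> R) (M : R) :
  measurable_fun setT f -> (forall w, `|f w| <= M) ->
  has_expectation f (\int[P]_w f w).
Proof.
move=> mf fM.
have fi : P.-integrable setT (EFin \o f).
  apply: (@le_integrable _ _ _ _ _ _ _ (EFin \o cst M)) => //.
  - exact/measurable_EFinP.
  - by move=> w _; rewrite /= lee_fin (le_trans (fM w))// ler_norm.
  - exact: finite_measure_integrable_cst.
split => //; rewrite /Rintegral fineK//.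
exact: integrable_fin_num.
Qed.

(** A finite second moment dominates the first through [|f| <= 1 + f^2]. *)
Lemma has_expectation_sqr (f : T -> R) : measurable_fun setT f ->
  (\int[P]_w (f w ^+ 2)%:E < +oo)%E ->
  P.-integrable setT (EFin \o f) /\
  has_expectation (fun w => f w ^+ 2) (fine (\int[P]_w (f w ^+ 2)%:E)).
Proof.
move=> mf f2.
have mf2 : measurable_fun setT (fun w => f w ^+ 2) by exact: measurable_funX.
have i2 : P.-integrable setT (EFin \o (fun w => f w ^+ 2)).
  apply/integrableP; split; first exact/measurable_EFinP.
  by under eq_integral => w _ do rewrite /= ger0_norm ?sqr_ge0//.
split; last first.
  by split => //; rewrite fineK//; exact: integrable_fin_num i2.
have i1 : P.-integrable setT (EFin \o (fun w => 1 + f w ^+ 2)).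
  have -> : EFin \o (fun w => 1 + f w ^+ 2) = (EFin \o cst 1) \+ (EFin \o (fun w => f w ^+ 2)).
    by [].
  by apply: integrableD => //; exact: finite_measure_integrable_cst.
apply: (@le_integrable _ _ _ _ _ _ _ (EFin \o (fun w => 1 + f w ^+ 2))) => //.
  exact/measurable_EFinP.
move=> w _ /=; rewrite lee_fin [leRHS]ger0_norm ?addr_ge0 ?sqr_ge0//.
by rewrite ler_norml; apply/andP; split; have := sqr_ge0 (f w + 1); have := sqr_ge0 (f w - 1); nra.
Qed.

(** Nonnegativity of the variance, [0 <= E (f - a)^2 = b - a^2]. *)
Lemma sqr_expectation_le (f : T -> R) (a b : R) : has_expectation f a ->
  has_expectation (fun w => f w ^+ 2) b -> a ^+ 2 <= b.
Proof.
move=> fa fb.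
have := has_expectationD fb (has_expectationD (has_expectationZ (- 2 * a) fa)
  (has_expectation_cst (a ^+ 2))).
move=> /has_expectation_ge0 h.
suff : 0 <= b + (- 2 * a * a + a ^+ 2) by nra.
by apply: h => w /=; have := sqr_ge0 (f w - a); nra.
Qed.

(* [(p + q)^2 <= 2 p^2 + 2 q^2] makes the integrand affine in f, h, f^2, h^2, so
   no integrability of the product f h is needed. *)
Lemma integral_sqr_perturbed (f h : T -> R) (a al be z ef2 eh2 : R) :
  has_expectation f 0 -> has_expectation h z ->
  has_expectation (fun w => f w ^+ 2) ef2 -> has_expectation (fun w => h w ^+ 2) eh2 ->
  (\int[P]_w ((a + al * f w + be * (h w - z)) ^+ 2)%:E
    <= (a ^+ 2 + 2 * al ^+ 2 * ef2 + 2 * be ^+ 2 * eh2)%:E)%E.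
Proof.
move=> f1 h1 f2 h2.
have [_ hB] := has_expectationD
  (has_expectation_cst (a ^+ 2 - 2 * a * be * z + 2 * be ^+ 2 * z ^+ 2))
  (has_expectationD (has_expectationZ (2 * a * al) f1)
  (has_expectationD (has_expectationZ (2 * a * be - 4 * be ^+ 2 * z) h1)
  (has_expectationD (has_expectationZ (2 * al ^+ 2) f2) (has_expectationZ (2 * be ^+ 2) h2)))).
apply: (@le_trans _ _ _ _ _ (le_integral_nomeas P _ _)); last first.
- apply: le_trans (eq_ind _ (fun x => (_ <= x)%E) (lexx _) _ hB) _.
  (* The mean of [h] leaves a term [- 2 be^2 z^2], which is dropped. *)
  by rewrite lee_fin; have := mulr_ge0 (sqr_ge0 be) (sqr_ge0 z); nra.
- move=> w /=; rewrite lee_fin.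
  by have := sqr_ge0 (al * f w - be * (h w - z)); nra.
- by move=> w; rewrite lee_fin sqr_ge0.
Qed.

End RealExpectation.

Section VectorMoments.
Context d (T : measurableType d) {R : realType} (P : probability T R) {n : nat}.

Lemma measurable_sqr_enorm (D : T -> 'rV[R]_n) :
  (forall i, measurable_fun setT (fun w => D w 0 i)) ->
  measurable_fun setT (fun w => enorm (D w) ^+ 2).
Proof.
move=> mD; under eq_fun => w do rewrite sqr_enormE.
by apply: measurable_sum => i; exact: measurable_funX.
Qed.

(** Passes from assumptions on Euclidean norms to single coordinates, where unbiasedness is stated
    and where expectations are real numbers. *)
Lemma coord_second_moments (D : T -> 'rV[R]_n) (B : R) :
  (forall i, measurable_fun setT (fun w => D w 0 i)) ->
  (\int[P]_w (enorm (D w) ^+ 2)%:E <= B%:E)%E ->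
  exists e : 'I_n -> R, [/\ forall i, has_expectation P (fun w => D w 0 i ^+ 2) (e i),
    \sum_i e i <= B & forall i, P.-integrable setT (EFin \o (fun w => D w 0 i))].
Proof.
move=> mD DB.
have h i := has_expectation_sqr (mD i).
have {}h i : P.-integrable setT (EFin \o (fun w => D w 0 i)) /\
   has_expectation P (fun w => D w 0 i ^+ 2) (fine (\int[P]_w (D w 0 i ^+ 2)%:E)).
  apply: h; apply: le_lt_trans (ltry B); apply: le_trans DB.
  apply: le_integral_nomeas => w; rewrite lee_fin ?sqr_ge0// sqr_enormE (bigD1 i)//=.
  by rewrite lerDl sumr_ge0// => j _; exact: sqr_ge0.
exists (fun i => fine (\int[P]_w (D w 0 i ^+ 2)%:E)); split=> [i||i]; last 2 first.
- have [_ hs] := has_expectation_sum (r := index_enum 'I_n) (fun i _ => (h i).2).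
  rewrite -lee_fin -hs; apply: le_trans DB.
  by apply: le_integral_nomeas => w; rewrite ?sqr_enormE// lee_fin sumr_ge0// => j _; exact: sqr_ge0.
- exact: (h i).1.
- exact: (h i).2.
Qed.

End VectorMoments.

Section GradientMeasurability.
Context {R : realType} {n : nat} d (T : measurableType d).

Lemma cvg_harmonic_dnbhs : @harmonic R @ \oo --> 0^'.
Proof.
move=> A hA; have h0 : nbhs (0 : R) [set x | x != 0 -> A x] by exact: hA.
have h : \forall N \near \oo, (harmonic N : R) != 0 -> A (harmonic N) by exact: cvg_harmonic h0.
suff : \forall N \near \oo, A (harmonic N : R) by [].
by apply: filterS h => N; apply; rewrite gt_eqF// harmonic_gt0.
Qed.

Lemma measurable_partial (F : 'rV[R]_n -> T -> R) (U : set 'rV[R]_n) x v :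
  open U -> U x -> (forall y, U y -> measurable_fun setT (F y)) ->
  (forall w, derivable (F^~ w) x v) ->
  measurable_fun setT (fun w => 'D_v (F^~ w) x).
Proof.
move=> oU Ux mF dF.
pose pt N := @harmonic R N *: v + x.
(* Difference quotients along [1 / (N + 1)]. The test is there because [F] is known to be measurable
   only at points of [U], which the sequence enters eventually. *)
pose h N w := if `[< U (pt N) >] then (harmonic N)^-1 *: (F (pt N) w - F x w) else 0.
apply: (@measurable_fun_cvg _ _ _ _ h).
  move=> N; rewrite /h; case: asboolP => UN; last exact: measurable_cst.
  apply: measurable_funM; first exact: measurable_cst.
  by apply: measurable_funB; exact: mF.
move=> w _.
have := cvg_comp _ _ cvg_harmonic_dnbhs (dF w).
apply: cvg_trans; apply: near_eq_cvg.
have ptx : pt N @[N --> \oo] --> x.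
  rewrite -[X in _ --> X]add0r -(scale0r v); apply: cvgD; last exact: cvg_cst.
  by apply: cvgZr_tmp; exact: cvg_harmonic.
have : \forall N \near \oo, U (pt N) by apply: ptx; exact: open_nbhs_nbhs.
by apply: filterS => N UN; rewrite /h /=; case: asboolP.
Qed.

End GradientMeasurability.

(** * The stochastic gradient and one projected step *)

Section Regularity.
Context {R : realType} {n m : nat} {d : measure_display} {Xi : measurableType d}.
Variables (X : set 'rV[R]_n) (mu : probability Xi R).
Variables (ft : 'rV[R]_n -> Xi -> R) (c : 'rV[R]_n -> 'rV[R]_m).
Variables (Lf sigma Lc Lgc Cc gamma theta Lbar : R).
Hypothesis Hset : basic_setting X ft.
Hypothesis Hbasic : basic_assumptions X mu ft c Lf sigma Lc Lgc Cc gamma theta.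
Hypothesis Havg : average_smoothness X mu ft Lbar.

Local Notation gradf := (grad (objective mu ft)).
Local Notation L := (smooth_const Lc Cc Lgc).

Lemma feasible_convex (u v : 'rV[R]_n) (t : R) :
  0 <= t -> t <= 1 -> X u -> X v -> X (u + t *: (v - u)).
Proof. exact: convex_setP (X_convex Hset) _ _ _. Qed.

Lemma projX_in v : X (proj X v).
Proof. exact: proj_in (X_nonempty Hset) (X_closed Hset) _. Qed.

Lemma projX_nonexpansive u v : enorm (proj X u - proj X v) <= enorm (u - v).
Proof. exact: proj_nonexpansive (X_nonempty Hset) (X_closed Hset) feasible_convex u v. Qed.

Lemma projX_id v : X v -> proj X v = v.
Proof. exact: proj_id (X_nonempty Hset) (X_closed Hset) feasible_convex v. Qed.

Lemma Cc_ge0 : 0 <= Cc.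
Proof.
have [x Xx] := X_nonempty Hset.
exact: le_trans (enorm_ge0 _) (c_bounded Hbasic Xx).
Qed.

Lemma L_ge0 : 0 <= L.
Proof. by rewrite addr_ge0 ?sqr_ge0// mulr_ge0 ?Cc_ge0// (Lgc_ge0 Hbasic). Qed.

Lemma gradf_bound x : X x -> enorm (gradf x) <= Lf.
Proof.
move=> Xx; have [U [oU XU _ fd fL]] := f_regular Hbasic.
exact: grad_bound (Lf_ge0 Hbasic) oU (XU _ Xx) (fd _ (XU _ Xx)) fL.
Qed.

Lemma derive_objective x v : X x ->
  derivable (objective mu ft) x v /\ 'D_v (objective mu ft) x = dotv (gradf x) v.
Proof.
move=> Xx; have [U [_ XU _ fd _]] := f_regular Hbasic.
by split; [exact/diff_derivable/fd/XU|exact/dotv_grad/fd/XU].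
Qed.

Lemma nablac_c_lip u v : X u -> X v ->
  enorm (nablac_c c u - nablac_c c v) <= L * enorm (u - v).
Proof.
have [V [oV XV cd cL JL]] := c_regular Hbasic.
exact: (nablac_c_lipschitz (Lc_ge0 Hbasic) (Lgc_ge0 Hbasic) oV XV cd cL JL
  (c_bounded Hbasic)).
Qed.

Lemma nablac_c_le x : X x -> enorm (nablac_c c x) <= Cc * Lc.
Proof.
have [V [oV XV cd cL JL]] := c_regular Hbasic.
exact: (nablac_c_bound (Lc_ge0 Hbasic) oV XV cd cL (c_bounded Hbasic)).
Qed.

Lemma derive_feasibility x v : X x ->
  derivable (fun z => enorm (c z) ^+ 2 / 2) x v /\
  'D_v (fun z => enorm (c z) ^+ 2 / 2) x = dotv (nablac_c c x) v.
Proof.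
move=> Xx; have [V [_ XV cd _ _]] := c_regular Hbasic.
exact/derive_half_sqr_enorm/cd/XV.
Qed.

Lemma measurable_sgrad x i : X x -> measurable_fun setT (fun s => grad (ft^~ s) x 0 i).
Proof.
move=> Xx; have [U [oU XU fi _ _]] := f_regular Hbasic.
under eq_fun => s do rewrite mxE.
apply: (measurable_partial oU (XU _ Xx)) => [y Uy|s].
  exact/measurable_EFinP/measurable_int/fi.
exact/diff_derivable/(ft_differentiable Hset).
Qed.

Lemma sgrad_noise x : X x -> exists e : 'I_n -> R,
  [/\ forall i, has_expectation mu (fun s => grad (ft^~ s) x 0 i - gradf x 0 i) 0,
      forall i, has_expectation mu (fun s => (grad (ft^~ s) x 0 i - gradf x 0 i) ^+ 2) (e i)
    & \sum_i e i <= sigma ^+ 2].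
Proof.
move=> Xx.
have hv := ft_variance Hbasic Xx; rewrite unlock in hv.
have [i|e [h1 h2 h3]] := @coord_second_moments _ _ _ mu _
   (fun s => grad (ft^~ s) x - gradf x) (sigma ^+ 2) _ hv.
  under eq_fun => s do rewrite coordB.
  by apply: measurable_funB; [exact: measurable_sgrad|exact: measurable_cst].
have cE i : (fun s => (grad (ft^~ s) x - gradf x) 0 i) =
  (fun s => grad (ft^~ s) x 0 i - gradf x 0 i).
  by apply/funext => s; rewrite coordB.
exists e; split => // i; last by have := h1 i; under eq_fun => s do rewrite coordB.
have := h3 i; rewrite cE => hi.
(* Unbiasedness only gives the value of an integral; integrability comes from the square-integrable
   noise plus a constant. *)
have hg : has_expectation mu (fun s => grad (ft^~ s) x 0 i) (gradf x 0 i).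
  split; last by have := ft_unbiased Hbasic Xx i; rewrite unlock.
  have := (has_expectation_cst mu (gradf x 0 i)).1.
  move=> /(integrableD measurableT hi); congr (mu.-integrable _ _).
  by apply/funext => s /=; rewrite -EFinD subrK.
have := has_expectationD hg (has_expectation_cst mu (- gradf x 0 i)).
by rewrite subrr.
Qed.

Lemma sgrad_increment u v : X u -> X v -> exists e : 'I_n -> R,
  [/\ forall i, has_expectation mu (fun s => grad (ft^~ s) u 0 i - grad (ft^~ s) v 0 i)
                  (gradf u 0 i - gradf v 0 i),
      forall i, has_expectation mu
        (fun s => (grad (ft^~ s) u 0 i - grad (ft^~ s) v 0 i) ^+ 2) (e i)
    & \sum_i e i <= Lbar ^+ 2 * enorm (u - v) ^+ 2].
Proof.
move=> Xu Xv.
have hv := Havg.2 _ _ Xu Xv; rewrite unlock in hv.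
have [i|e [h1 h2 h3]] := @coord_second_moments _ _ _ mu _
   (fun s => grad (ft^~ s) u - grad (ft^~ s) v) (Lbar ^+ 2 * enorm (u - v) ^+ 2) _ hv.
  under eq_fun => s do rewrite coordB.
  by apply: measurable_funB; exact: measurable_sgrad.
exists e; split => // i; last first.
  by have := h1 i; under eq_fun => s do rewrite coordB.
have [eu [hu _ _]] := sgrad_noise Xu; have [ev [hw _ _]] := sgrad_noise Xv.
have := has_expectationD (hu i) (has_expectationD (has_expectationZ (-1) (hw i))
  (has_expectation_cst mu (gradf u 0 i - gradf v 0 i))).
rewrite mulr0 !add0r; congr has_expectation.
by apply/funext => s /=; ring.
Qed.

(** Smoothness of [f] follows from average smoothness: the difference of gradients is the mean of
    the stochastic increment, and squaring the mean can only decrease it. *)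
Lemma gradf_lip u v : X u -> X v -> enorm (gradf u - gradf v) <= Lbar * enorm (u - v).
Proof.
move=> Xu Xv; have [e [h1 h2 h3]] := sgrad_increment Xu Xv.
rewrite -(ler_pXn2r (n := 2)) ?nnegrE ?mulr_ge0 ?enorm_ge0 ?Havg.1//.
rewrite exprMn; apply: le_trans h3; rewrite sqr_enormE.
apply: ler_sum => i _; rewrite coordB.
exact: sqr_expectation_le (h1 i) (h2 i).
Qed.

Definition recursion_target (u v gk : 'rV[R]_n) (al : R) (s : Xi) : 'rV[R]_n :=
  grad (ft^~ s) u + (1 - al) *: (gk - grad (ft^~ s) v).

Lemma measurable_recursion_target u v gk al : X u -> X v ->
  forall i, measurable_fun setT (fun s => (recursion_target u v gk al s - gradf u) 0 i).
Proof.
move=> Xu Xv i.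
have -> : (fun s => (recursion_target u v gk al s - gradf u) 0 i) = (fun s =>
  grad (ft^~ s) u 0 i + (1 - al) * (gk 0 i - grad (ft^~ s) v 0 i) - gradf u 0 i).
  by apply/funext => s; rewrite !(coordB, coordD, coordZ).
apply: measurable_funB; last exact: measurable_cst.
apply: measurable_funD; first exact: measurable_sgrad.
apply: measurable_funM; first exact: measurable_cst.
by apply: measurable_funB; [exact: measurable_cst|exact: measurable_sgrad].
Qed.

(** Each coordinate of the error is [(1 - al) (gk - gradf v)], plus [al] times the noise at [u],
    plus [1 - al] times the centred increment. The last two have mean zero, so only the factor 2
    between them is lost. *)
Lemma recursion_error u v gk al : X u -> X v ->
  (\int[mu]_s (enorm (recursion_target u v gk al s - gradf u) ^+ 2)%:E
   <= ((1 - al) ^+ 2 * enorm (gk - gradf v) ^+ 2 + 2 * al ^+ 2 * sigma ^+ 2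
       + 2 * (1 - al) ^+ 2 * (Lbar ^+ 2 * enorm (u - v) ^+ 2))%:E)%E.
Proof.
move=> Xu Xv.
have [e1 [a1 a2 a3]] := sgrad_noise Xu; have [e2 [b1 b2 b3]] := sgrad_increment Xu Xv.
pose D s := recursion_target u v gk al s - gradf u.
have mD := @measurable_recursion_target u v gk al Xu Xv.
have -> : (\int[mu]_s (enorm (D s) ^+ 2)%:E = \sum_(i < n) \int[mu]_s (D s 0 i ^+ 2)%:E)%E.
  under eq_integral => s _ do rewrite sqr_enormE -sumEFin.
  rewrite ge0_integral_sum// => i; last by move=> s _; rewrite lee_fin sqr_ge0.
  by apply/measurable_EFinP; apply: measurable_funX; exact: mD.
apply: (@le_trans _ _ (\sum_(i < n) (((1 - al) * (gk 0 i - gradf v 0 i)) ^+ 2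
    + 2 * al ^+ 2 * e1 i + 2 * (1 - al) ^+ 2 * e2 i)%:E)%E).
  apply: lee_sum => i _.
  have := @integral_sqr_perturbed _ _ _ mu _ _ ((1 - al) * (gk 0 i - gradf v 0 i)) al
    (1 - al) _ _ _ (a1 i) (b1 i) (a2 i) (b2 i).
  apply: le_trans; rewrite le_eqVlt; apply/orP; left; apply/eqP/eq_integral => s _.
  congr (_ ^+ 2)%:E.
  by rewrite /D /recursion_target !(coordB, coordD, coordZ); ring.
rewrite sumEFin lee_fin !big_split/= -!mulr_sumr.
apply: lerD; first apply: lerD.
- rewrite sqr_enormE mulr_sumr; apply: ler_sum => i _.
  by rewrite exprMn coordB.
- by rewrite ler_wpM2l// mulr_ge0// sqr_ge0.
- by rewrite ler_wpM2l// mulr_ge0// sqr_ge0.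
Qed.

End Regularity.

Section ResidualIdentities.
Context {R : realType} {n : nat}.
Implicit Types u v g D : 'rV[R]_n.

(** Here [u], [u'] are gradients of [f] and [v], [v'] values of [nablac_c c] at the new and the old
    point, and [D] is the move. Adding the normal vector produced by the projection turns the
    residual at the new point into differences that Lipschitz bounds control. *)
Lemma penalty_residualE u v u' v' g D (rho eta : R) : eta != 0 ->
  u + rho *: v + eta^-1 *: - (D + eta *: (g + rho *: v')) =
  (u - u') + rho *: (v - v') - (g - u') - eta^-1 *: D.
Proof.
move=> e0; rewrite scalerN scalerDr scalerA mulVf// scale1r.
by apply/rowP => i; rewrite !(coordB, coordD, coordZ, coordN); ring.
Qed.

Lemma feasibility_residualE v v' g D (rho eta : R) : eta != 0 -> rho != 0 ->
  v + rho^-1 *: (eta^-1 *: - (D + eta *: (g + rho *: v'))) =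
  (v - v') - (eta * rho)^-1 *: D - rho^-1 *: g.
Proof.
move=> e0 r0; apply/rowP => i.
rewrite !(coordB, coordD, coordZ, coordN).
by field; rewrite e0 r0.
Qed.

End ResidualIdentities.

Section ProjectedStep.
Context {R : realType} {n m : nat} {d : measure_display} {Xi : measurableType d}.
Variables (X : set 'rV[R]_n) (mu : probability Xi R).
Variables (ft : 'rV[R]_n -> Xi -> R) (c : 'rV[R]_n -> 'rV[R]_m).
Variables (Lf sigma Lc Lgc Cc gamma theta Lbar : R).
Hypothesis Hset : basic_setting X ft.
Hypothesis Hbasic : basic_assumptions X mu ft c Lf sigma Lc Lgc Cc gamma theta.
Hypothesis Havg : average_smoothness X mu ft Lbar.

Local Notation f := (objective mu ft).
Local Notation gradf := (grad (objective mu ft)).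
Local Notation L := (smooth_const Lc Cc Lgc).
Local Notation H := (nablac_c c).
Local Notation h := (fun z => enorm (c z) ^+ 2 / 2).

Lemma truncation_in z : enorm (proj (eball Lf) z : 'rV[R]_n) <= Lf.
Proof.
have /= := proj_in (eball_nonempty (Lf_ge0 Hbasic)) (@closed_eball _ n Lf) z.
by [].
Qed.

(** The true gradient lies in the truncation ball, so projecting onto that ball cannot move the
    estimate away from it. *)
Lemma truncation_error z x : X x ->
  enorm (proj (eball Lf) z - gradf x) ^+ 2 <= enorm (z - gradf x) ^+ 2.
Proof.
move=> Xx; rewrite ler_pXn2r ?nnegrE ?enorm_ge0//.
apply: (proj_dist_le (eball_nonempty (Lf_ge0 Hbasic)) (@closed_eball _ n Lf)).
  exact: convex_eball.
exact: (gradf_bound Hbasic).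
Qed.

Variables (x g : 'rV[R]_n) (rho eta : R).
Hypothesis Xx : X x.
Hypothesis rho0 : 0 < rho.
Hypothesis eta0 : 0 < eta.

Let G := g + rho *: H x.
Let y := proj X (x - eta *: G).
Let D := y - x.

Let Xy : X y. Proof. exact: (projX_in Hset). Qed.

Let segX (t : R) : 0 <= t -> t <= 1 -> X (x + t *: (y - x)).
Proof. by move=> t0 t1; exact: (feasible_convex Hset). Qed.

(** The optimality condition of the projection, used as an explicit witness in both residual bounds
    below. *)
Lemma step_normal : normal_cone X y (eta^-1 *: (x - eta *: G - y)).
Proof.
split => // z Xz; rewrite dotvZl mulr_ge0_le0 ?invr_ge0 ?(ltW eta0)//.
exact: (proj_dotv_le (X_nonempty Hset) (X_closed Hset) (feasible_convex Hset)).
Qed.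

Lemma step_dotv_le : eta * dotv G D <= - enorm D ^+ 2.
Proof.
have := proj_dotv_le (X_nonempty Hset) (X_closed Hset) (feasible_convex Hset)
  (x - eta *: G) Xx.
rewrite -/y -(opprB y x) -/D.
have -> : x - eta *: G - y = - (D + eta *: G) by rewrite /D addrAC opprD opprB.
rewrite dotvNl dotvNr opprK dotvDl dotvZl -sqr_enorm; lra.
Qed.

Lemma step_length : enorm D <= eta * enorm G.
Proof.
have [->|D0] := eqVneq (enorm D) 0; first by rewrite mulr_ge0 ?enorm_ge0 ?ltW.
have D1 : 0 < enorm D by rewrite lt_def D0 enorm_ge0.
rewrite -(ler_pM2r D1) -expr2 -mulrA.
have := step_dotv_le; have := dotv_le (- G) D; rewrite dotvNl enormN => a b.
have := ler_wpM2l (ltW eta0) a; lra.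
Qed.

(** A deterministic bound, thanks to truncation. It provides integrability and controls the steps
    before [K1]. *)
Lemma step_length_sqr : enorm g <= Lf ->
  enorm D ^+ 2 <= 2 * eta ^+ 2 * (Lf ^+ 2 + rho ^+ 2 * (Cc ^+ 2 * Lc ^+ 2)).
Proof.
move=> gL.
have hl : enorm D ^+ 2 <= (eta * enorm G) ^+ 2.
  by rewrite ler_pXn2r ?nnegrE ?enorm_ge0 ?step_length// mulr_ge0 ?enorm_ge0 ?ltW.
apply: le_trans hl _; rewrite exprMn -(mulrA 2) (mulrCA 2) ler_wpM2l ?sqr_ge0//.
apply: le_trans (sqr_enormD_le _ _) _; rewrite mulrDr.
apply: lerD; first by rewrite ler_wpM2l// ler_pXn2r ?nnegrE ?enorm_ge0// (Lf_ge0 Hbasic).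
rewrite ler_wpM2l// enormZ exprMn real_normK ?num_real// -(exprMn _ Cc) ler_wpM2l ?sqr_ge0//.
rewrite ler_pXn2r ?nnegrE ?enorm_ge0 ?(nablac_c_le Hbasic)//.
by rewrite mulr_ge0 ?(Cc_ge0 Hset Hbasic) ?(Lc_ge0 Hbasic).
Qed.

Lemma step_h_le : h y <= h x + dotv (H x) D + L / 2 * enorm D ^+ 2.
Proof.
apply: (descent_lemma segX (derive_feasibility Hbasic)).
exact: (nablac_c_lip Hbasic).
Qed.

Lemma step_f_le : f y <= f x + dotv (gradf x) D + Lbar / 2 * enorm D ^+ 2.
Proof.
apply: (descent_lemma segX (derive_objective Hbasic)).
exact: (gradf_lip Hset Hbasic Havg).
Qed.

Lemma step_penalty_descent :
  f y + rho * h y + ((2 * eta)^-1 - (Lbar + rho * L) / 2) * enorm D ^+ 2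
  <= f x + rho * h x + eta / 2 * enorm (g - gradf x) ^+ 2.
Proof.
have hf := step_f_le; have hh := ler_wpM2l (ltW rho0) step_h_le.
have hG := step_dotv_le; rewrite /G dotvDl dotvZl in hG.
(* Young's inequality for [dotv (gradf x - g) D]; it spends half of [|D|^2 / eta], hence the
   coefficient [(2 * eta)^-1]. *)
have := dotv_ge0 (D + eta *: (g - gradf x)).
rewrite -sqr_enorm sqr_enormD dotvZr enormZ exprMn real_normK ?num_real//.
rewrite (dotvC D) dotvDl dotvNl => hy.
have i0 : 0 < eta^-1 by rewrite invr_gt0.
have {}hG : dotv g D + rho * dotv (H x) D <= - (eta^-1 * enorm D ^+ 2).
  by rewrite -(ler_pM2l eta0) mulrN mulVKf ?gt_eqF.
have {}hy : 0 <= eta^-1 * enorm D ^+ 2 + 2 * (dotv g D - dotv (gradf x) D)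
              + eta * enorm (g - gradf x) ^+ 2.
  rewrite -(pmulr_rge0 _ eta0) 2!(mulrDr eta) mulVKf ?gt_eqF//; apply: le_trans hy _.
  by set a := dotv g D; set b := dotv (gradf x) D; lra.
rewrite invfM; move: hf hh hG hy.
set a := dotv g D; set b := dotv (gradf x) D; set e := dotv (H x) D; lra.
Qed.

Lemma step_stationarity :
  edist 0 [set (gradf y + rho *: H y + v)%R | v in normal_cone X y]
  <= enorm (g - gradf x) + (Lbar + rho * L + eta^-1) * enorm D.
Proof.
apply: le_trans (edist_le _ _) _; first by exists (eta^-1 *: (x - eta *: G - y)); [exact: step_normal|reflexivity].
rewrite sub0r enormN.
have -> : x - eta *: G - y = - (D + eta *: G) by rewrite /D addrAC opprD opprB.
rewrite /G (penalty_residualE _ _ (gradf x)) ?gt_eqF//.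
apply: le_trans (ler_enormB _ _) _.
rewrite enormZ ger0_norm ?invr_ge0 ?(ltW eta0)// mulrDl addrA lerD2r.
apply: le_trans (ler_enormB _ _) _; rewrite [leLHS]addrC lerD2l.
apply: le_trans (ler_enormD _ _) _; rewrite mulrDl; apply: lerD.
  exact: (gradf_lip Hset Hbasic Havg).
rewrite enormZ ger0_norm ?(ltW rho0)// -mulrA ler_wpM2l ?(ltW rho0)//.
exact: (nablac_c_lip Hbasic).
Qed.

(** From the viewpoint of [h], the update is a projected gradient step of size [eta * rho] perturbed
    by [g / rho], of norm at most [Lf / rho]. The descent version below reads the step in the same
    way. *)
Lemma step_feasibility_stationarity : enorm g <= Lf ->
  edist 0 [set (H y + v)%R | v in normal_cone X y]
  <= Lf / rho + (L + (eta * rho)^-1) * enorm D.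
Proof.
move=> gL.
apply: le_trans (edist_le _ _) _.
  exists (rho^-1 *: (eta^-1 *: (x - eta *: G - y))); last reflexivity.
  split => // z Xz; rewrite dotvZl mulr_ge0_le0 ?invr_ge0 ?(ltW rho0)//.
  by have [_] := step_normal; exact.
rewrite sub0r enormN.
have -> : x - eta *: G - y = - (D + eta *: G) by rewrite /D addrAC opprD opprB.
rewrite /G feasibility_residualE ?gt_eqF//.
apply: le_trans (ler_enormB _ _) _; rewrite addrC; apply: lerD.
  rewrite enormZ ger0_norm ?invr_ge0 ?(ltW rho0)// mulrC ler_wpM2r// invr_ge0.
  exact: ltW.
apply: le_trans (ler_enormB _ _) _; rewrite mulrDl; apply: lerD.
  exact: (nablac_c_lip Hbasic).
by rewrite enormZ ger0_norm// invr_ge0 mulr_ge0 ?ltW.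
Qed.

Lemma step_feasibility_descent : enorm g <= Lf ->
  h y <= h x - ((eta * rho)^-1 - L / 2) * enorm D ^+ 2 + Lf / rho * enorm D.
Proof.
move=> gL; have hh := step_h_le.
have hG := step_dotv_le; rewrite /G dotvDl dotvZl in hG.
have hg : - dotv g D <= Lf * enorm D.
  rewrite -dotvNl; apply: le_trans (dotv_le _ _) _.
  by rewrite enormN ler_wpM2r ?enorm_ge0.
have r0 : 0 < rho^-1 by rewrite invr_gt0.
have i0 : 0 < (eta * rho)^-1 by rewrite invr_gt0 mulr_gt0.
have e1 : (eta * rho)^-1 * eta = rho^-1 by rewrite invfM mulrAC mulVf ?gt_eqF// mul1r.
have e2 : rho^-1 * rho = 1 by rewrite mulVf ?gt_eqF.
have := ler_wpM2l (ltW i0) hG; rewrite mulrA e1 mulrDr mulrA e2 mul1r => h1.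
have := ler_wpM2l (ltW r0) hg => h2.
move: hh h1 h2; set a := dotv g D; set e := dotv (H x) D; lra.
Qed.

End ProjectedStep.

(** * Step sizes and thresholds *)

Section PowersAndLogarithms.
Context {R : realType}.
Implicit Types (j : nat) (nu p t : R).

(** The eighth power of [7 / 8 <= e^(- 1 / 8)] already exceeds [1 / 3]. *)
Lemma expR1_le3 : expR 1 <= 3 :> R.
Proof.
have h : 7 / 8 <= expR (- (1 / 8)) :> R by apply: le_trans (expR_ge1Dx _); lra.
have e : expR (- 1) = expR (- (1 / 8)) ^+ 8 :> R.
  by rewrite -expRM_natl; congr expR; field.
have : (7 / 8) ^+ 8 <= expR (- 1) :> R by rewrite e lerXn2r ?nnegrE ?expR_ge0.
rewrite expRN => h1.
have h2 : 3^-1 <= (expR 1)^-1 :> R by apply: le_trans h1; lra.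
by rewrite -lef_pV2 ?posrE ?expR_gt0.
Qed.

(** Since [theta >= 1], this forces the burn-in threshold to be at least 7. *)
Lemma expR2_gt6 : 6 < expR 2 :> R.
Proof.
have h : 9 / 8 <= expR (1 / 8) :> R by apply: le_trans (expR_ge1Dx _); lra.
have e : expR 2 = expR (1 / 8) ^+ 16 :> R.
  by rewrite -expRM_natl; congr expR; field.
have : (9 / 8) ^+ 16 <= expR 2 :> R by rewrite e lerXn2r ?nnegrE ?expR_ge0.
apply: lt_le_trans; lra.
Qed.

Lemma ler_ln2 (x y : R) : 0 < x -> x <= y -> ln x <= ln y.
Proof. by move=> x0 xy; rewrite ler_ln ?posrE// (lt_le_trans x0). Qed.

Lemma ln3_ge1 : 1 <= ln 3 :> R.
Proof. by rewrite -[leLHS](@expRK R); apply: ler_ln2; [exact: expR_gt0|exact: expR1_le3]. Qed.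

Lemma ln_shift_ge1 j : (1 <= j)%N -> 1 <= ln (j%:R + 2) :> R.
Proof.
move=> j1; apply: le_trans ln3_ge1 _; apply: ler_ln2 => //.
have : 1 <= j%:R :> R by rewrite ler1n. lra.
Qed.

(** Later estimates see [thetahat] only through these two bounds. *)
Lemma nu_exp_bounds (th : R) : 1 <= th -> 1 / 3 <= nu_exp th <= 1 / 2.
Proof.
move=> th1; rewrite /nu_exp ge_min lexx orbT andbT le_min; apply/andP; split; last by lra.
by rewrite ler_pdivlMr; lra.
Qed.

Lemma powR_le_mono (x y nu : R) : 0 <= nu -> 0 <= x -> x <= y -> x `^ nu <= y `^ nu.
Proof. by move=> nu0 x0 xy; rewrite ge0_ler_powR ?nnegrE// (le_trans x0). Qed.

Lemma powR_ge1 (x nu : R) : 1 <= x -> 0 <= nu -> 1 <= x `^ nu.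
Proof. by move=> x1 nu0; rewrite -[leLHS](powRr0 x) ler_powR. Qed.

Lemma powR_sqrt (x : R) : 0 <= x -> (x `^ (1 / 2)) ^+ 2 = x.
Proof. by move=> x0; rewrite mul1r powR12_sqrt// sqr_sqrtr. Qed.

Lemma powR_succ_le j nu : (1 <= j)%N -> 0 <= nu <= 1 / 2 ->
  j.+1%:R `^ nu <= j%:R `^ nu * (1 + (2 * j%:R)^-1).
Proof.
move=> j1 /andP[nu0 nu1]; have j0 : 0 < j%:R :> R by rewrite ltr0n.
have -> : j.+1%:R = j%:R * (1 + j%:R^-1) :> R.
  by rewrite mulrDr mulr1 divff ?gt_eqF// -natr1.
have i0 : 0 < j%:R^-1 :> R by rewrite invr_gt0.
rewrite powRM ?addr_ge0 ?(ltW j0) ?(ltW i0)// ler_wpM2l ?powR_ge0//.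
apply: (@le_trans _ _ ((1 + j%:R^-1) `^ (1 / 2))).
  by apply: ler_powR => //; lra.
rewrite -(ler_pXn2r (n := 2)) ?nnegrE ?powR_ge0//.
rewrite powR_sqrt ?addr_ge0 ?(ltW i0)// invfM; have := sqr_ge0 (j%:R^-1 : R); nra.
Qed.

(** [(1 + 1 / j)^(- p) = exp (- p ln (1 + 1 / j)) >= 1 - p / j]. *)
Lemma powRN_diff_le j p : (1 <= j)%N -> 0 <= p ->
  j%:R `^ (- p) - j.+1%:R `^ (- p) <= p * j%:R `^ (- p) / j%:R.
Proof.
move=> j1 p0; have j0 : 0 < j%:R :> R by rewrite ltr0n.
have i0 : 0 < j%:R^-1 :> R by rewrite invr_gt0.
have -> : j.+1%:R = j%:R * (1 + j%:R^-1) :> R.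
  by rewrite mulrDr mulr1 divff ?gt_eqF// -natr1.
rewrite powRM ?addr_ge0 ?(ltW j0) ?(ltW i0)//.
have h : 1 - p / j%:R <= (1 + j%:R^-1) `^ (- p).
  rewrite /powR gt_eqF ?addr_gt0//; apply: le_trans (expR_ge1Dx _).
  have : ln (1 + j%:R^-1) <= j%:R^-1 :> R by apply: le_ln1Dx; lra.
  by move=> /(ler_wpM2l p0); lra.
have := ler_wpM2l (powR_ge0 j%:R (- p)) h; lra.
Qed.

Lemma harmonic_sum_le N : (1 <= N)%N ->
  \sum_(1 <= j < N.+1) j%:R^-1 <= 1 + ln N%:R :> R.
Proof.
elim: N => // N ih _; have [->|N0] := posnP N.
  by rewrite big_nat1 invr1 ln1 addr0.
rewrite big_nat_recr//=; apply: le_trans (lerD (ih N0) (lexx _)) _.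
rewrite -addrA lerD2l -lerBrDl.
have n0 : 0 < N%:R :> R by rewrite ltr0n.
have s0 : 0 < N.+1%:R :> R by rewrite ltr0n.
rewrite -ln_div ?posrE// -[leLHS]opprK lerNl -lnV ?posrE ?divr_gt0// invf_div.
have -> : N%:R / N.+1%:R = 1 + (- N.+1%:R^-1) :> R.
  by rewrite -[in LHS](addrK 1 N%:R) natr1 mulrBl divff ?gt_eqF// mul1r.
apply: le_ln1Dx; rewrite ltrN2 invf_lt1 ?ltr1n//.
Qed.

End PowersAndLogarithms.

Section StepsizeEstimates.
Context {R : realType}.
Variables (nu : R) (j : nat).
Hypothesis nu_ge : 1 / 3 <= nu.
Hypothesis nu_le : nu <= 1 / 2.
Hypothesis j1 : (1 <= j)%N.

Let a : R := j%:R `^ nu.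
Let l : R := ln (j%:R + 2).

Let J1 : 1 <= j%:R :> R. Proof. by rewrite ler1n. Qed.
Let nu0 : 0 <= nu. Proof. by move: nu_ge; lra. Qed.
Let a1 : 1 <= a. Proof. exact: powR_ge1. Qed.
Let l1 : 1 <= l. Proof. exact: ln_shift_ge1. Qed.
Let facts : [/\ 1 / 3 <= nu, nu <= 1 / 2, 1 <= j%:R :> R, 1 <= a & 1 <= l].
Proof. by split. Qed.

Lemma powR_nu2_le : a ^+ 2 <= j%:R.
Proof.
have [nu3 nu2 J A1 L1] := facts.
rewrite -[leRHS](powRr1 (ler0n _ _)) -powR_mulrn ?powR_ge0// -powRrM.
by apply: ler_powR => //; lra.
Qed.

Lemma powR_nu3_ge : j%:R <= a ^+ 3.
Proof.
have [nu3 nu2 J A1 L1] := facts.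
rewrite -[leLHS](powRr1 (ler0n _ _)) -powR_mulrn ?powR_ge0// -powRrM.
by apply: ler_powR => //; lra.
Qed.

Lemma powR_2nu : j%:R `^ (- (2 * nu)) = (a ^+ 2)^-1.
Proof. by rewrite powRN mulrC powRrM powR_mulrn ?powR_ge0. Qed.

(* The weight of E|g_k - grad f(x_k)|^2 in the Lyapunov function, chosen so that
   alpha_k * potential_weight k = 2 * eta_k. *)
Definition potential_weight (k : nat) : R := k%:R `^ nu / (2 * ln (k%:R + 2)).

Lemma weight_succ_le : potential_weight j.+1 <= a * (1 + (2 * j%:R)^-1) / (2 * l).
Proof.
have [nu3 nu2 J A1 L1] := facts.
have l2 : l <= ln (j.+1%:R + 2).
  by apply: ler_ln2; [lra|rewrite -natr1; lra].
rewrite /potential_weight; apply: ler_pM; rewrite ?powR_ge0 ?invr_ge0 ?mulr_ge0 ?(le_trans _ l2) ?(le_trans _ l1)//.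
  by apply: powR_succ_le => //; apply/andP.
by rewrite lef_pV2 ?posrE ?ler_wpM2l//; lra.
Qed.

Lemma weight_succ_le2 : potential_weight j.+1 <= 3 / 4 * (a / l).
Proof.
have [nu3 nu2 J A1 L1] := facts.
apply: le_trans weight_succ_le _.
have : (2 * j%:R)^-1 <= 1 / 2 :> R.
  rewrite invfM mul1r -[leRHS]mulr1 ler_wpM2l//.
  by rewrite invf_le1 // ltr0n.
move: (_^-1) => t ht; rewrite invfM.
have := ler_wpM2l (_ : 0 <= a * (2^-1 * l^-1)) ht.
have : 0 <= a * (2^-1 * l^-1).
  by rewrite !mulr_ge0// ?invr_ge0; lra.
move=> q0 /(_ q0); lra.
Qed.

Lemma potential_weight_ge0 k : 0 <= potential_weight k.
Proof.
rewrite /potential_weight mulr_ge0 ?powR_ge0// invr_ge0 mulr_ge0//.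
have [->|k0] := posnP k; first by rewrite ln_ge0//; lra.
by apply: le_trans (ln_shift_ge1 k0).
Qed.

(** With [eta_j = (4 * a * l)^-1], damping removes [2 eta_j] from the weight, and growth adds back
    at most [a / (4 * j * l) <= eta_j], because [a ^+ 2 <= j]. A net [eta_j] remains. *)
Lemma weight_recursion :
  (1 - (a ^+ 2)^-1) * potential_weight j.+1 <= potential_weight j - (4 * a * l)^-1.
Proof.
have [nu3 nu2 J A1 L1] := facts.
have h := weight_succ_le; have a0 : 0 < a by lra. have l0 : 0 < l by lra.
have s1 : 0 <= 1 - (a ^+ 2)^-1.
  by rewrite subr_ge0 invf_le1 ?exprn_gt0// exprn_ege1.
have := ler_wpM2l s1 h => {h}; move/le_trans; apply.
rewrite /potential_weight -/a -/l.
have ij : (2 * j%:R)^-1 <= (2 * a ^+ 2)^-1 :> R.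
  by rewrite lef_pV2 ?posrE ?mulr_gt0 ?exprn_gt0 ?ltr0n// ler_wpM2l// powR_nu2_le.
apply: (@le_trans _ _ ((1 - (a ^+ 2)^-1) * (a * (1 + (2 * a ^+ 2)^-1) / (2 * l)))).
  apply: ler_wpM2l => //; apply: ler_wpM2r; first by rewrite invr_ge0; lra.
  by apply: ler_wpM2l; lra.
rewrite -subr_ge0.
have -> : a / (2 * l) - (4 * a * l)^-1 -
  (1 - (a ^+ 2)^-1) * (a * (1 + (2 * a ^+ 2)^-1) / (2 * l)) = (4 * a ^+ 3 * l)^-1.
  by field; rewrite !gt_eqF.
by rewrite invr_ge0 !mulr_ge0 ?exprn_ge0; lra.
Qed.

Lemma weight_noise : potential_weight j.+1 * (2 * (a ^+ 2)^-1 ^+ 2) <= 3 / (2 * ln 3) / j%:R.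
Proof.
have [nu3 nu2 J A1 L1] := facts.
have a0 : 0 < a by lra. have l0 : 0 < l by lra.
have ln3 := @ln3_ge1 R; have j0 : 0 < j%:R :> R by rewrite ltr0n.
have q0 : 0 <= 2 * (a ^+ 2)^-1 ^+ 2 by rewrite mulr_ge0// sqr_ge0.
apply: le_trans (ler_wpM2r q0 weight_succ_le2) _.
have -> : 3 / 4 * (a / l) * (2 * (a ^+ 2)^-1 ^+ 2) = 3 / 2 * (l^-1 * (a ^+ 3)^-1).
  by field; rewrite !gt_eqF.
have -> : 3 / (2 * ln 3) / j%:R = 3 / 2 * ((ln 3)^-1 * j%:R^-1) :> R.
  by rewrite invfM !mulrA.
rewrite ler_wpM2l//.
apply: ler_pM; rewrite ?invr_ge0 ?exprn_ge0//; try lra.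
  rewrite lef_pV2 ?posrE; [by apply: ler_ln2 => //; lra|lra|lra].
by rewrite lef_pV2 ?posrE ?exprn_gt0 ?powR_nu3_ge.
Qed.

(* When j^(1 - nu) exceeds sqrt K, ln K < 4/3 * ln j, and then the term - 2 a l
   already makes the first factor nonpositive; this is where nu >= 1/3 enters. *)
Lemma burnin_term (Lb L K : R) : 0 <= Lb -> 0 <= L -> 1 <= K ->
  2 * L <= ln K -> 6 * Lb ^+ 2 <= ln K ->
  (Lb / 2 + a * L / 2 + potential_weight j.+1 * (2 * Lb ^+ 2) - 2 * a * l)
    * (2 * (4 * a * l)^-1 ^+ 2)
  <= 1 / 16 * (K `^ (1 / 2) * (L + 6 * Lb ^+ 2)) / j%:R.
Proof.
have [nu3 nu2 J A1 L1] := facts.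
move=> Lb0 L0 K1 LK LbK.
have a0 : 0 < a by lra. have l0 : 0 < l by lra. have j0 : 0 < j%:R :> R by rewrite ltr0n.
have K0 : 0 < K by lra.
have al : 1 <= a * l by nra.
set S := L + 6 * Lb ^+ 2; have S0 : 0 <= S by rewrite addr_ge0// mulr_ge0// sqr_ge0.
have w1 : potential_weight j.+1 <= 3 / 4 * a.
  apply: le_trans weight_succ_le2 _; rewrite ler_wpM2l//.
  by rewrite ler_pdivrMr//; nra.
have w2 : potential_weight j.+1 * (2 * Lb ^+ 2) <= 3 / 2 * a * Lb ^+ 2.
  have := ler_wpM2r (_ : 0 <= 2 * Lb ^+ 2) w1; rewrite mulr_ge0 ?sqr_ge0// => /(_ isT); lra.
set Y := _ - 2 * a * l.
have Y1 : Y <= a * S / 2.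
  by rewrite /Y /S; have := sqr_ge0 (Lb - 1); nra.
have c0 : 0 <= 2 * (4 * a * l)^-1 ^+ 2 by rewrite mulr_ge0 ?sqr_ge0.
pose q := j%:R / a.
have q0 : 0 < q by rewrite divr_gt0.
have [qK|qK] := leP q (K `^ (1 / 2)).
  apply: le_trans (ler_wpM2r c0 Y1) _.
  have -> : a * S / 2 * (2 * (4 * a * l)^-1 ^+ 2) = 1 / 16 * (q * S) / j%:R * (l^-1) ^+ 2.
    by rewrite /q; field; rewrite !gt_eqF.
  have h : 1 / 16 * (q * S) / j%:R <= 1 / 16 * (K `^ (1 / 2) * S) / j%:R.
    by rewrite ler_wpM2r ?invr_ge0 ?(ltW j0)// ler_wpM2l// ler_wpM2r// ltW.
  apply: le_trans h; rewrite ler_piMr//.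
    by rewrite !mulr_ge0// ?invr_ge0 ?(ltW q0) ?(ltW j0)//; lra.
  by rewrite expr_le1// ?invf_le1// invr_ge0 ltW.
have lq : ln q = (1 - nu) * ln j%:R.
  by rewrite /q ln_div ?posrE// /a ln_powR mulrBl mul1r.
have lK : ln K < 4 / 3 * l.
  have : ln (K `^ (1 / 2)) < ln q by rewrite ltr_ln ?posrE ?powR_gt0.
  rewrite lq ln_powR => h.
  have lj : ln j%:R <= l by apply: ler_ln2 => //; lra.
  have lj0 : 0 <= ln j%:R :> R by rewrite ln_ge0.
  have : (1 - nu) * ln j%:R <= 2 / 3 * l by nra.
  lra.
have Y0 : Y <= 0.
  rewrite /Y; have : Lb <= l by have := sqr_ge0 (Lb - 1); lra.
  have : a * L <= a * (2 / 3 * l) by rewrite ler_wpM2l ?ltW//; lra.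
  have : a * Lb ^+ 2 <= a * (2 / 9 * l) by rewrite ler_wpM2l ?ltW//; lra.
  have : l <= a * l by nra.
  lra.
apply: (@le_trans _ _ 0); first by rewrite mulr_le0_ge0.
by rewrite !mulr_ge0// ?powR_ge0 ?invr_ge0 ?(ltW j0)//; lra.
Qed.

(** The thresholds bound the three subtracted terms by [a * l / 8], [a * l / 4] and [a * l / 8],
    which would leave [3 / 2]; [4 / 3] suffices. *)
Lemma stable_coefficient (Lb L : R) : 0 <= Lb -> 0 <= L -> 2 <= l ->
  2 * Lb <= a -> 2 * L <= l -> 6 * Lb ^+ 2 <= l ->
  4 / 3 * a * l <= 2 * a * l - (Lb + a * L) / 2 - potential_weight j.+1 * (2 * Lb ^+ 2).
Proof.
have [nu3 nu2 J A1 L1] := facts.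
move=> Lb0 L0 l2 hLb hL hLb2; have a0 : 0 < a by lra. have l0 : 0 < l by lra.
have w2 : potential_weight j.+1 * (2 * Lb ^+ 2) <= 3 / 4 * (a / l) * (l / 3).
  apply: ler_pM => //; rewrite ?potential_weight_ge0 ?mulr_ge0 ?sqr_ge0//; last lra.
  exact: weight_succ_le2.
have e : 3 / 4 * (a / l) * (l / 3) = a / 4 by field; rewrite gt_eqF.
rewrite e in w2; nra.
Qed.

End StepsizeEstimates.

Section Thresholds.
Context {R : realType}.

Definition growth_base (gamma theta : R) : R :=
  (expR 1)^-1 * gamma ^- 2 * 2 `^ (6 - theta) * ln (expR (2 * theta) + 2).

Lemma K1_const_spec (nu L Lb gamma theta : R) :
  0 < nu -> 0 <= Lb -> 1 <= theta ->
  exists K : nat, [/\ K1_const nu L Lb gamma theta = K%:R, (7 <= K)%N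
    & [/\ 2 * Lb <= K%:R `^ nu, 6 * Lb ^+ 2 <= ln K%:R, 2 * L <= ln K%:R,
         expR (2 * theta) <= K%:R & growth_base gamma theta `^ (2 * theta) <= K%:R]].
Proof.
move=> nu0 Lb0 th1.
rewrite /K1_const -/(growth_base gamma theta).
set M := Num.max _ _.
have ceilM : M <= (Num.ceil M)%:~R by exact: ceil_ge.
have lmax (x y : R) : x <= Num.max x y by rewrite le_max lexx.
have rmax (x y : R) : y <= Num.max x y by rewrite le_max lexx orbT.
have M1 : (2 * Lb) `^ (1 / nu) <= M by exact: lmax.
have M2 : expR (6 * 2 `^ (nu / 2) * Lb ^+ 2) <= M.
  by apply: le_trans (rmax _ _); exact: lmax.
have M3 : expR (2 * L) <= M.
  by do 2 apply: le_trans (rmax _ _); exact: lmax.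
have M4 : expR (2 * theta) <= M.
  by do 3 apply: le_trans (rmax _ _); exact: lmax.
have M5 : growth_base gamma theta `^ (2 * theta) <= M.
  by do 3 apply: le_trans (rmax _ _); exact: rmax.
move: M ceilM M1 M2 M3 M4 M5 => M ceilM M1 M2 M3 M4 M5.
have M6 : 6 < M.
  apply: lt_le_trans M4; apply: lt_le_trans expR2_gt6 _; rewrite ler_expR; lra.
have c6 : (6 < Num.ceil M)%R.
  by rewrite -(ltr_int R); apply: lt_le_trans ceilM.
move: ceilM c6; case: (Num.ceil M) => // K; rewrite -pmulrn => MK K6.
have KR : 6 < K%:R :> R by exact: lt_le_trans MK.
exists K; split=> //.
have Kp : (K%:R : R) \is Num.pos by rewrite posrE; lra.
split.
- have : ((2 * Lb) `^ (1 / nu)) `^ nu <= K%:R `^ nu.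
    by apply: powR_le_mono; rewrite ?powR_ge0 ?(le_trans M1) // ltW.
  by rewrite -powRrM divfK ?gt_eqF// powRr1// mulr_ge0.
(* The power of 2 in the exponent is at least 1 and can be discarded. *)
- have := le_trans M2 MK; rewrite -{1}(lnK Kp) ler_expR.
  apply: le_trans; rewrite ler_wpM2r ?sqr_ge0// ler_peMr//.
  by apply: powR_ge1; rewrite ?ler1n// ltW// divr_gt0.
- by have := le_trans M3 MK; rewrite -{1}(lnK Kp) ler_expR.
- exact: le_trans MK.
- exact: le_trans MK.
Qed.

(** Write [k^(1 / theta)] as a square of [k^a] with [a = 1 / (2 theta)]. One factor is at least
    [growth_base]; the other equals [e s^a] with [s = k / e^(2 theta)], and [s^a >= 1 + a ln s]
    absorbs the logarithm. The [e] cancels the inverse of [expR 1] in the constant. *)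
Lemma growth_base_ge (gamma theta : R) k : 0 < gamma -> 1 <= theta ->
  expR (2 * theta) <= k%:R -> growth_base gamma theta `^ (2 * theta) <= k%:R ->
  64 * ln (k%:R + 2) <= gamma ^+ 2 * 2 `^ theta * k%:R `^ (1 / theta).
Proof.
move=> g0 th1 ek Bk.
have k0 : 0 < k%:R :> R by exact: lt_le_trans (expR_gt0 _) ek.
have th0 : 0 < theta by lra.
pose a := (2 * theta)^-1; have a0 : 0 < a by rewrite invr_gt0 mulr_gt0.
pose M := ln (expR (2 * theta) + 2).
have M0 : 2 * theta <= M.
  by rewrite -[leLHS](@expRK R); apply: ler_ln2; [exact: expR_gt0|lra].
have aM : 1 <= a * M by rewrite mulrC -[_ * a]/(_ / _) ler_pdivlMr ?mul1r ?mulr_gt0.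
pose s := k%:R / expR (2 * theta).
have s1 : 1 <= s by rewrite ler_pdivlMr ?expR_gt0// mul1r.
have ls0 : 0 <= ln s by rewrite ln_ge0.
have kE : k%:R = s * expR (2 * theta) by rewrite divfK// gt_eqF ?expR_gt0.
have h1 : ln (k%:R + 2) <= ln s + M.
  rewrite -lnM ?posrE ?addr_gt0 ?expR_gt0//; last lra.
  by apply: ler_ln2; [lra|rewrite kE mulrDr lerD2l; lra].
have ka : k%:R `^ a = s `^ a * expR 1.
  rewrite {1}kE powRM ?expR_ge0//; last lra.
  by rewrite -expRM mulfV// gt_eqF// mulr_gt0.
have sa : 1 + a * ln s <= s `^ a.
  by rewrite /powR gt_eqF; [exact: expR_ge1Dx|lra].
have h2 : ln (k%:R + 2) <= s `^ a * M.
  have M0' : 0 <= M by lra.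
  have := ler_wpM2r M0' sa.
  by have := ler_wpM2r ls0 aM; lra.
have B0 : 0 <= growth_base gamma theta.
  rewrite /growth_base -/M !mulr_ge0 ?invr_ge0 ?expR_ge0 ?exprn_ge0 ?powR_ge0//; lra.
have Bka : growth_base gamma theta <= k%:R `^ a.
  have : (growth_base gamma theta `^ (2 * theta)) `^ a <= k%:R `^ a.
    by apply: powR_le_mono Bk; rewrite ?powR_ge0 ?ltW.
  by rewrite -powRrM mulfV ?powRr1// gt_eqF// mulr_gt0.
have k2a : k%:R `^ (1 / theta) = k%:R `^ a * k%:R `^ a.
  rewrite -powRD; last by apply/implyP => _; rewrite gt_eqF.
  by congr powR; rewrite /a; field; rewrite gt_eqF.
have p2 : 2 `^ (6 - theta) = 64 / 2 `^ theta :> R.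
  rewrite powRB; last by apply/implyP => _.
  by congr (_ / _); rewrite (powR_mulrn 6)//; ring.
have t0 : 0 < 2 `^ theta :> R by rewrite powR_gt0.
have g20 : 0 < gamma ^+ 2 by rewrite exprn_gt0.
have e0 := expR_gt0 (1 : R).
rewrite k2a mulrA; apply: (@le_trans _ _ (gamma ^+ 2 * 2 `^ theta * growth_base gamma theta * k%:R `^ a)).
  have -> : gamma ^+ 2 * 2 `^ theta * growth_base gamma theta * k%:R `^ a = 64 * (s `^ a * M).
    rewrite /growth_base -/M ka p2; field.
    by rewrite !gt_eqF.
  by rewrite ler_wpM2l.
by rewrite ler_wpM2r ?powR_ge0// ler_wpM2l// mulr_ge0 ?ltW.
Qed.

End Thresholds.

(** * Deterministic decay of the constraint violation *)

Section FeasibilityDecay.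
Context {R : realType}.

(* 66 / 25 is a rational just below sqrt 7, the lower bound on D / r0 that k >= 7
   guarantees. *)
Lemma quadratic_decrease (r0 r D l L de dh : R) :
  0 < r0 -> r <= r0 -> 66 / 25 * r0 <= D -> 1 <= l -> 2 * L <= l -> 0 <= de ->
  D <= r + (L + 4 * l) * de -> (4 * l - L / 2) * de ^+ 2 - r * de <= dh ->
  1 / 2 * r0 ^+ 2 < 4 * l * dh.
Proof.
move=> r00 rr0 D3 l1 Ll de0 stat dec.
(* From [L <= l / 2]: [L + 4 l <= 9 / 8 * 4 l] and [4 l - L / 2 >= 15 / 16 * 4 l]. Then
   [328 / 225 = 8 / 9 * (66 / 25 - 1)] and [11 / 30 = 15 / 16 * 328 / 225 - 1], whose product
   exceeds [1 / 2]. *)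
pose u := 4 * l * de.
have Du : D <= r + 9 / 8 * u.
  apply: le_trans stat _; rewrite /u lerD2l.
  by have := ler_wpM2r de0 Ll; lra.
have u1 : 328 / 225 * r0 <= u by lra.
have q1 : 11 / 30 * r0 <= 15 / 16 * u - r by lra.
have h1 : 0 <= 328 / 225 * r0 by lra.
have h2 : 0 <= 11 / 30 * r0 by lra.
have q2 := ler_pM h1 h2 u1 q1.
have q3 : u * (15 / 16 * u - r) <= 4 * l * dh.
  have d2 : 15 / 16 * (4 * l) * de ^+ 2 - r * de <= dh.
    by have := ler_wpM2r (sqr_ge0 de) Ll; lra.
  have l4 : 0 <= 4 * l by lra.
  by have := ler_wpM2l l4 d2; rewrite /u; lra.
have := mulr_gt0 r00 r00; lra.
Qed.

Lemma powR_succ_inv (nu : R) (k : nat) : (7 <= k)%N -> 0 <= nu -> nu <= 1 / 2 ->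
  7 / 8 / (k%:R `^ nu) ^+ 2 <= (k.+1%:R `^ (2 * nu))^-1.
Proof.
move=> k7 nu0 nu2.
have k7R : 7 <= k%:R :> R by rewrite (ler_nat R 7).
have k0 : 0 < k%:R :> R by lra.
have i0 : 0 < k%:R^-1 :> R by rewrite invr_gt0.
have i7 : k%:R^-1 <= 7^-1 :> R by rewrite lef_pV2 ?posrE.
have a0 : 0 < k%:R `^ nu by rewrite powR_gt0.
have sk2 : k.+1%:R `^ (2 * nu) <= 8 / 7 * (k%:R `^ nu) ^+ 2.
  have -> : k.+1%:R = k%:R * (1 + k%:R^-1) :> R.
    by rewrite mulrDr mulr1 divff ?gt_eqF// -natr1.
  have -> : (k%:R `^ nu) ^+ 2 = k%:R `^ (2 * nu).
    by rewrite -powR_mulrn ?powR_ge0// -powRrM mulrC.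
  rewrite powRM ?addr_ge0 ?(ltW k0) ?(ltW i0)// [leRHS]mulrC ler_wpM2l ?powR_ge0//.
  apply: (@le_trans _ _ ((1 + k%:R^-1) `^ 1)).
    by apply: ler_powR; lra.
  by rewrite powRr1; lra.
have -> : 7 / 8 / (k%:R `^ nu) ^+ 2 = (8 / 7 * (k%:R `^ nu) ^+ 2)^-1.
  by field; rewrite gt_eqF.
by rewrite lef_pV2 ?posrE ?powR_gt0// ?mulr_gt0 ?exprn_gt0.
Qed.

(** The failed target is raised to the power [theta], which turns [(k + 1)^(- 2 nu / theta)] into
    [(k + 1)^(- 2 nu)]. Since [C1 >= 1], its power is at least [C1]; the factor [7 / 8] returns from
    [k + 1] to [k]. *)
Lemma error_bound_sqr_ge (nu theta C1 n1 : R) (k : nat) :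
  (7 <= k)%N -> 0 <= nu -> nu <= 1 / 2 -> 1 <= theta -> 1 <= C1 -> 0 <= n1 ->
  C1 * k.+1%:R `^ (- (2 * nu / theta)) < n1 ^+ 2 / 2 ->
  7 / 8 * (C1 * 2 `^ theta / (k%:R `^ nu) ^+ 2) <= (n1 `^ theta) ^+ 2.
Proof.
move=> k7 nu0 nu2 th1 C11 n10 h1.
have th0 : 0 < theta by lra.
have C10 : 0 <= C1 by lra.
set p := 2 * nu / theta in h1.
have sk : k.+1%:R `^ (- p) `^ theta = (k.+1%:R `^ (2 * nu))^-1 :> R.
  by rewrite -powRrM -powRN; congr powR; rewrite /p; field; rewrite gt_eqF.
have n2 : (n1 `^ theta) ^+ 2 = (n1 ^+ 2) `^ theta.
  rewrite -[LHS]powR_mulrn; last exact: powR_ge0.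
  rewrite -[in RHS]powR_mulrn; last exact: n10.
  by rewrite -!powRrM mulrC.
have h2 : (2 * (C1 * k.+1%:R `^ (- p))) `^ theta <= (n1 ^+ 2) `^ theta.
  apply: powR_le_mono; first exact: ltW.
    by rewrite mulr_ge0// mulr_ge0// powR_ge0.
  by rewrite mulrC -ler_pdivlMr// ltW.
rewrite powRM// in h2; last by rewrite mulr_ge0// powR_ge0.
rewrite (powRM _ C10 (powR_ge0 _ _)) sk in h2.
rewrite n2; apply: le_trans h2.
have C1t : C1 <= C1 `^ theta by exact: le1r_powR.
have -> : 7 / 8 * (C1 * 2 `^ theta / (k%:R `^ nu) ^+ 2) =
   2 `^ theta * (C1 * (7 / 8 / (k%:R `^ nu) ^+ 2)) by ring.
rewrite ler_wpM2l ?powR_ge0//; apply: ler_pM => //; last exact: powR_succ_inv.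
Qed.

(** The decrement is of order [k^(- p - 1)] with [p = 2 nu / theta], and
    [k^(- p - 1 + 1 / theta) <= k^(- 2 nu)] because [(1 - 2 nu) (1 - 1 / theta) >= 0]. The growth
    hypothesis trades the spare [k^(1 / theta)] for the logarithm. *)
Lemma target_decrement_le (nu theta gamma C1 : R) (k : nat) :
  (7 <= k)%N -> 0 <= nu -> nu <= 1 / 2 -> 1 <= theta -> 0 < gamma -> 1 <= C1 ->
  64 * ln (k%:R + 2) <= gamma ^+ 2 * 2 `^ theta * k%:R `^ (1 / theta) ->
  4 * ln (k%:R + 2) * (C1 * (k%:R `^ (- (2 * nu / theta)) - k.+1%:R `^ (- (2 * nu / theta))))
  <= 1 / 16 * (C1 * (gamma ^+ 2 * (2 `^ theta / (k%:R `^ nu) ^+ 2))).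
Proof.
move=> k7 nu0 nu2 th1 g0 C11 gr.
have k1 : (1 <= k)%N by exact: leq_trans k7.
have k0 : 0 < k%:R :> R by rewrite ltr0n.
have k1R : 1 <= k%:R :> R by rewrite ler1n.
have l1 := @ln_shift_ge1 R k k1.
have th0 : 0 < theta by lra.
have C10 : 0 <= C1 by lra.
set l := ln _ in gr l1 *; set p := 2 * nu / theta; set a := k%:R `^ nu.
have p0 : 0 <= p by rewrite divr_ge0 ?mulr_ge0 ?(ltW th0).
have p1 : p <= 1 by rewrite /p ler_pdivrMr// mul1r; lra.
have kp : k%:R `^ (- p) / k%:R * k%:R `^ (1 / theta) <= (a ^+ 2)^-1 :> R.
  have -> : k%:R `^ (- p) / k%:R = k%:R `^ (- p - 1) :> R.
    by rewrite powRB ?powRr1 ?(ltW k0)//; apply/implyP => _; rewrite gt_eqF.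
  rewrite -powRD; last by apply/implyP => _; rewrite gt_eqF.
  rewrite /a -powR_mulrn ?powR_ge0// -powRrM -powRN; apply: ler_powR; first exact: k1R.
  have -> : - p - 1 + 1 / theta = - (1 - (1 - 2 * nu) / theta).
    by rewrite /p; field; rewrite gt_eqF.
  have nu1 : 0 <= 1 - 2 * nu by lra.
  have : (1 - 2 * nu) / theta <= 1 - 2 * nu by rewrite ler_pdivrMr// ler_peMr.
  lra.
have x0 : 0 <= k%:R `^ (- p) / k%:R :> R by rewrite divr_ge0 ?powR_ge0 ?(ltW k0).
have dx := powRN_diff_le k1 p0; rewrite -mulrA in dx.
move: (k%:R `^ (- p) / k%:R) kp x0 dx => x kp x0 dx.
have y1 : p * x <= x by rewrite ler_piMl.
have y2 : 64 * l * x <= gamma ^+ 2 * (2 `^ theta / a ^+ 2).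
  apply: le_trans (ler_wpM2r x0 gr) _.
  rewrite -(mulrA (gamma ^+ 2 * _)) -(mulrA (gamma ^+ 2)) ler_wpM2l ?exprn_ge0 ?(ltW g0)//.
  by rewrite ler_wpM2l ?powR_ge0// mulrC.
have y3 := ler_wpM2l C10 y2.
have l4 : 0 <= 4 * l by lra.
apply: le_trans (ler_wpM2l l4 (ler_wpM2l C10 (le_trans dx y1))) _.
by move: y3; lra.
Qed.

(** By contradiction. A violation above the target makes the error-bound residual large; the step
    must then be long, so the violation fell by more than the target did, although it started below
    the target. *)
Lemma feasibility_step (nu theta gamma L Lf C1 n0 n1 de : R) (k : nat) :
  0 <= nu -> nu <= 1 / 2 -> 1 <= theta -> 0 < gamma -> 0 <= Lf -> (7 <= k)%N ->
  1 <= C1 -> 2 `^ (3 - theta) * Lf ^+ 2 * gamma ^- 2 <= C1 ->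
  2 * L <= ln (k%:R + 2) ->
  64 * ln (k%:R + 2) <= gamma ^+ 2 * 2 `^ theta * k%:R `^ (1 / theta) ->
  0 <= n1 -> 0 <= de ->
  n1 ^+ 2 / 2 <= n0 ^+ 2 / 2 - (4 * ln (k%:R + 2) - L / 2) * de ^+ 2 + Lf / k%:R `^ nu * de ->
  gamma * n1 `^ theta <= Lf / k%:R `^ nu + (L + 4 * ln (k%:R + 2)) * de ->
  n0 ^+ 2 / 2 <= C1 * k%:R `^ (- (2 * nu / theta)) ->
  n1 ^+ 2 / 2 <= C1 * k.+1%:R `^ (- (2 * nu / theta)).
Proof.
move=> nu0 nu2 th1 g0 Lf0 k7 C11 C1Lf Ll gr n10 de0 dec stat h0.
rewrite leNgt; apply/negP => h1.
have k1 : (1 <= k)%N by exact: leq_trans k7.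
have target := target_decrement_le k7 nu0 nu2 th1 g0 C11 gr.
have nbound := error_bound_sqr_ge k7 nu0 nu2 th1 C11 n10 h1.
have l1 := @ln_shift_ge1 R k k1.
have a0 : 0 < k%:R `^ nu :> R by rewrite powR_gt0// ltr0n.
set l := ln _ in Ll gr dec stat target l1.
set a := k%:R `^ nu in a0 dec stat target nbound.
have t0 : 0 < 2 `^ theta :> R by rewrite powR_gt0.
have g20 : 0 < gamma ^+ 2 by rewrite exprn_gt0.
have a20 : 0 < a ^+ 2 by rewrite exprn_gt0.
have C1p : 0 < C1 by exact: lt_le_trans C11.
(* [E / 16] bounds the scaled decrement of the target. [r0] is chosen so that [r0 ^+ 2 / 2] is the
   same number, which makes the final inequalities collide; [Lf / a <= r0] is where the last entry
   of [C1_const] comes from. *)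
pose E := C1 * (gamma ^+ 2 * (2 `^ theta / a ^+ 2)).
have E0 : 0 < E by rewrite !mulr_gt0 ?invr_gt0.
pose r0 := Num.sqrt (E / 8).
have r00 : 0 < r0 by rewrite sqrtr_gt0 divr_gt0.
have r0E : r0 ^+ 2 = E / 8 by rewrite sqr_sqrtr// divr_ge0// ltW.
have rr0 : Lf / a <= r0.
  rewrite -(ler_pXn2r (n := 2)) ?nnegrE ?(ltW r00)//; last by rewrite divr_ge0 ?(ltW a0).
  rewrite r0E expr_div_n ler_pdivrMr//.
  have -> : E / 8 * a ^+ 2 = C1 * (gamma ^+ 2 * 2 `^ theta / 8).
    by rewrite /E; field; rewrite gt_eqF.
  have g8 : 0 <= gamma ^+ 2 * 2 `^ theta / 8 by rewrite divr_ge0// (mulr_ge0 (ltW g20) (ltW t0)).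
  apply: le_trans (ler_wpM2r g8 C1Lf).
  rewrite powRB; last by apply/implyP.
  rewrite powR_mulrn// le_eqVlt; apply/orP; left; apply/eqP.
  by field; rewrite !gt_eqF.
have D3 : 66 / 25 * r0 <= gamma * n1 `^ theta.
  have Dg : 0 <= gamma * n1 `^ theta by rewrite mulr_ge0 ?powR_ge0 ?(ltW g0).
  have rr : 0 <= 66 / 25 * r0 by rewrite mulr_ge0 ?(ltW r00).
  rewrite -(ler_pXn2r (n := 2)) ?nnegrE//.
  rewrite [leRHS]exprMn [leLHS]exprMn r0E.
  apply: le_trans (ler_wpM2l (ltW g20) nbound).
  have -> : gamma ^+ 2 * (7 / 8 * (C1 * 2 `^ theta / a ^+ 2)) = 7 / 8 * E by rewrite /E; ring.
  by clear -E0; lra.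
have dh : (4 * l - L / 2) * de ^+ 2 - Lf / a * de <= n0 ^+ 2 / 2 - n1 ^+ 2 / 2.
  by clear -dec; lra.
have := quadratic_decrease r00 rr0 D3 l1 Ll de0 stat dh; rewrite r0E => q.
have q4 : n0 ^+ 2 / 2 - n1 ^+ 2 / 2 <=
    C1 * (k%:R `^ (- (2 * nu / theta)) - k.+1%:R `^ (- (2 * nu / theta))).
  by rewrite mulrBr; apply: lerB => //; exact: ltW.
have l4 : 0 <= 4 * l by clear -l1; lra.
have := le_trans (ler_wpM2l l4 q4) target; rewrite -/E => q5.
by clear -q q5; lra.
Qed.

End FeasibilityDecay.

(** * Iterates as random variables *)

Section MeasurableMaps.
Context {T : pointedType} {R : realType}.

Lemma measurable_fun_sub_sigma (G G' : set (set T)) d' (Y : measurableType d') (h : T -> Y) :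
  G `<=` <<s G' >> ->
  measurable_fun setT (h : g_sigma_algebraType G -> Y) ->
  measurable_fun setT (h : g_sigma_algebraType G' -> Y).
Proof.
move=> GG' mh _ B mB; have := mh measurableT B mB; rewrite !setTI => hB.
apply: (smallest_sub _ GG' hB); exact: smallest_sigma_algebra.
Qed.

End MeasurableMaps.

Section LipschitzMaps.
Context {R : realType} {n : nat} d (T : measurableType d).

Lemma measurable_lipschitz_comp k (F : 'rV[R]_n -> 'rV[R]_k) (C : R) (Y : T -> 'rV[R]_n) :
  (forall u v, enorm (F u - F v) <= C * enorm (u - v)) ->
  (forall i, measurable_fun setT (fun w => Y w 0 i)) ->
  forall i, measurable_fun setT (fun w => F (Y w) 0 i).
Proof.
move=> FC mY i.
apply: (@measurable_fun_caratheodory _ _ _ _ Y (fun y _ => F y 0 i)) => // w.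
apply: (@enorm_lipschitz_continuous1 _ _ C _ setT) => //; first exact: openT.
move=> u v _ _; apply: le_trans (FC u v).
by rewrite -coordB; exact: ler_coord_enorm.
Qed.

End LipschitzMaps.

Section Samples.
Context {R : realType} {d d' : measure_display}.
Context {T : measurableType d} {Xi : measurableType d'}.
Variables (P : probability T R) (mu : probability Xi R) (xi : nat -> {mfun T >-> Xi}).
Hypothesis Hiid : iid_samples P mu xi.

(* A pi-system of cylinder sets generating sigma(xi_1, ..., xi_k). *)
Definition past (k : nat) : set (set T) :=
  [set A | exists B : nat -> set Xi, (forall i, measurable (B i)) /\
     A = \bigcap_(i in [set i | (1 <= i <= k)%N]) xi i @^-1` B i].

Lemma set_iota1 k : [set` iota 1 k] = [set i | (1 <= i <= k)%N].
Proof. by apply/seteqP; split => i /=; rewrite mem_iota add1n ltnS. Qed.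

Lemma measurable_sample_preimage i (B : set Xi) : measurable B -> measurable (xi i @^-1` B).
Proof. by move=> mB; rewrite -[_ @^-1` _]setTI; exact: measurable_funP. Qed.

Lemma past_measurable k : past k `<=` measurable.
Proof.
move=> A [B [mB ->]]; apply: fin_bigcap_measurable; first by rewrite -set_iota1; exact: finite_seq.
by move=> i _; exact: measurable_sample_preimage.
Qed.

Lemma pastT k : past k setT.
Proof.
exists (fun=> setT); split; first by move=> _; exact: measurableT.
by apply/seteqP; split.
Qed.

Lemma pastI k : setI_closed (past k).
Proof.
move=> A A' [B [mB ->]] [B' [mB' ->]].
exists (fun i => B i `&` B' i); split; first by move=> i; exact: measurableI.
apply/seteqP; split => w.
  by move=> [h h'] i ik; split; [exact: h|exact: h'].
by move=> h; split => i ik; have [] := h i ik.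
Qed.

Lemma past_indep k A (B : set Xi) : past k A -> measurable B ->
  P (A `&` xi k.+1 @^-1` B) = (P A * mu B)%E.
Proof.
move=> [C [mC ->]] mB; rewrite -set_iota1.
pose C' i := if i == k.+1 then B else C i.
have mC' i : measurable (C' i) by rewrite /C'; case: eqP.
have kn : k.+1 \notin iota 1 k by rewrite mem_iota add1n ltnn andbF.
have CE i : i \in iota 1 k -> C' i = C i.
  by rewrite /C' => ik; case: eqP => // e; move: kn; rewrite -e ik.
have iota1 : all (leq 1) (iota 1 k) by apply/allP => i; rewrite mem_iota => /andP[].
have h := samples_independent Hiid _ _ mC.
rewrite (h (iota 1 k) (iota_uniq _ _) iota1).
have := samples_independent Hiid (J := k.+1 :: iota 1 k) _ _ mC'.
rewrite /= kn iota_uniq iota1 => /(_ isT isT).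
rewrite big_cons.
have -> : \bigcap_(i in [set` k.+1 :: iota 1 k]) xi i @^-1` C' i =
    (\bigcap_(i in [set` iota 1 k]) xi i @^-1` C i) `&` xi k.+1 @^-1` B.
  apply/seteqP; split => w.
    move=> hw; split; last by have := hw k.+1; rewrite /C' /= eqxx in_cons eqxx; exact.
    move=> i ik; rewrite -CE//; apply: hw; rewrite /= in_cons ik orbT//.
  move=> [hw hB] i; rewrite /= in_cons => /orP[/eqP ->|ik]; first by rewrite /C' eqxx.
  by rewrite CE//; exact: hw.
move=> ->; rewrite {1}/C' eqxx muleC; congr (_ * _)%E.
  by rewrite big_seq [RHS]big_seq; apply: eq_bigr => i ik; rewrite CE.
by rewrite -(samples_law Hiid (k := k.+1) isT mB).
Qed.

Lemma measurable_sample k i : (1 <= i <= k)%N ->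
  measurable_fun setT (xi i : g_sigma_algebraType (past k) -> Xi).
Proof.
move=> ik _ B mB; rewrite setTI; apply: sub_sigma_algebra.
exists (fun j => if j == i then B else setT); split.
  by move=> j; case: eqP => // _; exact: measurableT.
apply/seteqP; split => w.
  by move=> hw j _; case: eqP => //= ->.
by move=> /(_ i ik) /=; rewrite eqxx.
Qed.

Lemma past_succ k : past k `<=` <<s past k.+1 >>.
Proof.
move=> A [B [mB ->]]; apply: sub_sigma_algebra.
exists (fun j => if j == k.+1 then setT else B j); split.
  by move=> j; case: eqP => // _; exact: measurableT.
apply/seteqP; split => w hw i /= /andP[i1 ik].
  by case: eqP => // /eqP ik1; apply: hw => /=; rewrite i1 -ltnS ltn_neqAle ik1.
have /= := hw i; rewrite i1 (leqW ik) => /(_ isT).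
by rewrite ltn_eqF.
Qed.

Lemma past_sub_sigma_samples k A : <<s past k >> A -> sigma_samples xi A.
Proof.
apply: smallest_sub; first exact: smallest_sigma_algebra.
move=> _ [B [mB ->]].
pose gens := [set A | exists k B, [/\ (1 <= k)%N, measurable B & A = xi k @^-1` B]].
apply: (@fin_bigcap_measurable _ (g_sigma_algebraType gens)).
  by rewrite -set_iota1; exact: finite_seq.
move=> i /= /andP[i1 _]; apply: sub_sigma_algebra.
by exists i, (B i).
Qed.

End Samples.

Section Iterates.
Context {R : realType} {n m : nat} {dXi dT : measure_display}.
Context {Xi : measurableType dXi} {T : measurableType dT}.
Variables (X : set 'rV[R]_n) (mu : probability Xi R) (P : probability T R).
Variables (ft : 'rV[R]_n -> Xi -> R) (c : 'rV[R]_n -> 'rV[R]_m).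
Variables (Lf sigma Lc Lgc Cc gamma theta Lbar : R).
Hypothesis Hset : basic_setting X ft.
Hypothesis Hbasic : basic_assumptions X mu ft c Lf sigma Lc Lgc Cc gamma theta.
Hypothesis Havg : average_smoothness X mu ft Lbar.
Variables (alpha rho eta : nat -> R) (x1 : 'rV[R]_n) (xi : nat -> {mfun T >-> Xi}).
Variables (x g : nat -> T -> 'rV[R]_n).
Hypothesis Hiid : iid_samples P mu xi.
Hypothesis Xx1 : X x1.
Hypothesis Htrm : truncated_recursive_momentum X ft c Lf alpha rho eta x1 xi x g.

Local Notation gradf := (grad (objective mu ft)).

Lemma iterate_in k w : (1 <= k)%N -> X (x k w).
Proof.
case: k => // -[_|k _]; first by rewrite (trm_x1 Htrm).
by rewrite (trm_x Htrm)//; exact: projX_in Hset _.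
Qed.

Lemma momentum_bound k w : (1 <= k)%N -> enorm (g k w) <= Lf.
Proof.
case: k => // -[_|k _].
  by rewrite (trm_g1 Htrm); exact: (truncation_in Hbasic).
by rewrite (trm_g Htrm)//; exact: (truncation_in Hbasic).
Qed.

(** The stochastic gradient is known to be measurable in the sample only at points of [X]. Inserting
    [proj X] extends it to the whole space, keeps it continuous in the point, and changes nothing
    along [Y]. *)
Lemma measurable_sgrad_comp d (S : measurableType d) (Y : S -> 'rV[R]_n) (z : S -> Xi) :
  (forall w, X (Y w)) -> (forall i, measurable_fun setT (fun w => Y w 0 i)) ->
  measurable_fun setT z ->
  forall i, measurable_fun setT (fun w => grad (ft^~ (z w)) (Y w) 0 i).
Proof.
move=> XY mY mz i.
have -> : (fun w => grad (ft^~ (z w)) (Y w) 0 i) =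
    (fun w => grad (ft^~ (z w)) (proj X (Y w)) 0 i).
  by apply/funext => w; rewrite (projX_id Hset).
apply: (@measurable_fun_caratheodory _ _ _ _ Y
  (fun y w => grad (ft^~ (z w)) (proj X y) 0 i)) => //.
  move=> y; apply: (measurableT_comp (f := fun s => grad (ft^~ s) (proj X y) 0 i)) => //.
  exact: measurable_sgrad Hset Hbasic _ _ (projX_in Hset _).
move=> w.
have c1 : {for Y w, continuous (proj X)}.
  apply: (@enorm_lipschitz_continuous _ _ _ 1 _ setT) => //; first exact: openT.
  by move=> u v _ _; rewrite mul1r; exact: projX_nonexpansive Hset u v.
have c2 : {for proj X (Y w), continuous (grad (ft^~ (z w)))} by exact: (ft_C1 Hset).
have c3 : {for grad (ft^~ (z w)) (proj X (Y w)), continuous (fun v : 'rV[R]_n => v 0 i)}.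
  exact: coord_continuous.
exact: cvg_comp _ _ (cvg_comp _ _ c1 c2) c3.
Qed.

Lemma measurable_recursion d (S : measurableType d) (u v y : S -> 'rV[R]_n) (z : S -> Xi) al :
  (forall w, X (u w)) -> (forall w, X (v w)) ->
  (forall i, measurable_fun setT (fun w => u w 0 i)) ->
  (forall i, measurable_fun setT (fun w => v w 0 i)) ->
  (forall i, measurable_fun setT (fun w => y w 0 i)) ->
  measurable_fun setT z ->
  forall i, measurable_fun setT (fun w => recursion_target ft (u w) (v w) (y w) al (z w) 0 i).
Proof.
move=> Xu Xv mu_ mv my mz i.
have -> : (fun w => recursion_target ft (u w) (v w) (y w) al (z w) 0 i) = (fun w =>
    grad (ft^~ (z w)) (u w) 0 i + (1 - al) * (y w 0 i - grad (ft^~ (z w)) (v w) 0 i)).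
  by apply/funext => w; rewrite /recursion_target !(coordB, coordD, coordZ).
apply: measurable_funD; first exact: measurable_sgrad_comp.
apply: measurable_funM; first exact: measurable_cst.
by apply: measurable_funB => //; exact: measurable_sgrad_comp.
Qed.

Lemma measurable_on_X d (S : measurableType d) k (F : 'rV[R]_n -> 'rV[R]_k) C
    (Y : S -> 'rV[R]_n) : 0 <= C ->
  (forall u v, X u -> X v -> enorm (F u - F v) <= C * enorm (u - v)) ->
  (forall w, X (Y w)) -> (forall i, measurable_fun setT (fun w => Y w 0 i)) ->
  forall i, measurable_fun setT (fun w => F (Y w) 0 i).
Proof.
move=> C0 FC XY mY i.
have -> : (fun w => F (Y w) 0 i) = (fun w => (F \o proj X) (Y w) 0 i).
  by apply/funext => w /=; rewrite (projX_id Hset).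
apply: (@measurable_lipschitz_comp _ _ _ _ _ _ C) => // u v /=.
apply: le_trans (FC _ _ (projX_in Hset u) (projX_in Hset v)) _.
by rewrite ler_wpM2l//; exact: projX_nonexpansive Hset u v.
Qed.

Lemma measurable_proj d (S : measurableType d) (A : set 'rV[R]_n) (Y : S -> 'rV[R]_n) :
  A !=set0 -> closed A ->
  (forall (u v : 'rV[R]_n) t, 0 <= t -> t <= 1 -> A u -> A v -> A (u + t *: (v - u))) ->
  (forall i, measurable_fun setT (fun w => Y w 0 i)) ->
  forall i, measurable_fun setT (fun w => proj A (Y w) 0 i).
Proof.
move=> A0 Acl Acv mY; apply: (@measurable_lipschitz_comp _ _ _ _ _ _ 1) => // u v.
by rewrite mul1r; exact: proj_nonexpansive.
Qed.

Local Notation pastS k := (g_sigma_algebraType (past xi k)).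

(** The next point uses no new sample, so it stays measurable for the past of [k]; this allows
    [xi k.+1] to be frozen while [x k.+1] is fixed. *)
Lemma measurable_step k :
  (1 <= k)%N ->
  (forall i, measurable_fun setT ((fun w => x k w 0 i) : pastS k -> R)) ->
  (forall i, measurable_fun setT ((fun w => g k w 0 i) : pastS k -> R)) ->
  forall i, measurable_fun setT ((fun w => x k.+1 w 0 i) : pastS k -> R).
Proof.
move=> k1 mx mg i.
have -> : (fun w => x k.+1 w 0 i) =
   (fun w => proj X (x k w - eta k *: (g k w + rho k *: nablac_c c (x k w))) 0 i).
  by apply/funext => w; rewrite (trm_x Htrm).
apply: (@measurable_proj _ (pastS k) X).
- exact: X_nonempty Hset.
- exact: X_closed Hset.
- exact: feasible_convex Hset.
move=> {}i.
have -> : (fun w => (x k w - eta k *: (g k w + rho k *: nablac_c c (x k w))) 0 i) =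
   (fun w => x k w 0 i - eta k * (g k w 0 i + rho k * nablac_c c (x k w) 0 i)).
  by apply/funext => w; rewrite !(coordB, coordD, coordZ, coordN).
apply: measurable_funB; first exact: mx.
apply: measurable_funM; first exact: measurable_cst.
apply: measurable_funD; first exact: mg.
apply: measurable_funM; first exact: measurable_cst.
apply: (@measurable_on_X _ (pastS k) _ _ _ _ (L_ge0 Hset Hbasic)) => //.
  exact: nablac_c_lip Hbasic.
by move=> w; exact: iterate_in.
Qed.

Lemma measurable_iterates k : (1 <= k)%N ->
  (forall i, measurable_fun setT ((fun w => x k w 0 i) : pastS k -> R)) /\
  (forall i, measurable_fun setT ((fun w => g k w 0 i) : pastS k -> R)).
Proof.
elim: k => // -[_ _|k ih _].
  split=> i.
    have -> : (fun w => x 1%N w 0 i) = cst (x1 0 i).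
      by apply/funext => w; rewrite (trm_x1 Htrm).
    exact: measurable_cst.
  have -> : (fun w => g 1%N w 0 i) =
      (fun w => proj (eball Lf) (grad (ft^~ (xi 1%N w)) x1) 0 i).
    by apply/funext => w; rewrite (trm_g1 Htrm).
  apply: (@measurable_proj _ (pastS 1) (eball Lf)).
  - exact: eball_nonempty (Lf_ge0 Hbasic).
  - exact: closed_eball.
  - exact: convex_eball.
  move=> {}i; apply: (@measurable_sgrad_comp _ (pastS 1) (fun=> x1)) => //.
  exact: measurable_sample.
have [mx mg] := ih isT.
have up (h : T -> R) : measurable_fun setT (h : pastS k.+1 -> R) ->
    measurable_fun setT (h : pastS k.+2 -> R).
  by apply: measurable_fun_sub_sigma; exact: past_succ.
have mx' := measurable_step (ltn0Sn k) mx mg.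
split=> i; first exact: (up _ (mx' i)).
have -> : (fun w => g k.+2 w 0 i) = (fun w => proj (eball Lf)
    (recursion_target ft (x k.+2 w) (x k.+1 w) (g k.+1 w) (alpha k.+1) (xi k.+2 w)) 0 i).
  by apply/funext => w; rewrite (trm_g Htrm).
apply: (@measurable_proj _ (pastS k.+2) (eball Lf)).
- exact: eball_nonempty (Lf_ge0 Hbasic).
- exact: closed_eball.
- exact: convex_eball.
move=> {}i; apply: (@measurable_recursion _ (pastS k.+2)).
- by move=> w; exact: iterate_in.
- by move=> w; exact: iterate_in.
- by move=> {}i; exact: (up _ (mx' i)).
- by move=> {}i; exact: (up _ (mx i)).
- by move=> {}i; exact: (up _ (mg i)).
- by apply: measurable_sample; rewrite /= leqnn.
Qed.

End Iterates.

(** * Averaging over the independent uniform index *)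

Section IndependentIndex.
Context {R : realType} {d d' : measure_display}.
Context {T : measurableType d} {Xi : measurableType d'}.
Variables (P : probability T R) (mu : probability Xi R) (xi : nat -> {mfun T >-> Xi}).

Lemma measurable_past j (h : T -> R) :
  measurable_fun setT (h : g_sigma_algebraType (past xi j) -> R) -> measurable_fun setT h.
Proof.
move=> mh; apply: (measurableT_comp mh).
exact: measurable_to_sigma (@past_measurable _ _ _ _ xi j).
Qed.

(* Freezing the sigma-algebra generated by the single event [D] instead of the
   past, so that the integrand is the map into the past. *)
Lemma integral_indep_event j (D : set T) (h : T -> R) (e : R) :
  measurable D ->
  (forall A, sigma_samples xi A -> P (D `&` A) = (P D * P A)%E) ->
  measurable_fun setT (h : g_sigma_algebraType (past xi j) -> R) ->
  (forall w, 0 <= h w) -> has_expectation P h e ->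
  (\int[P]_w (\1_D w * h w)%:E = P D * e%:E)%E.
Proof.
move=> mD indD mh h0 [ih he].
pose G : set (set T) := [set A | A = D \/ A = setT].
pose TP : measurableType _ := g_sigma_algebraType (past xi j).
have mid : measurable_fun setT (id : T -> TP).
  exact: measurable_to_sigma (@past_measurable _ _ _ _ xi j).
pose Y : {mfun T >-> TP} := HB.pack (id : T -> TP) (isMeasurableFun.Build _ _ _ _ _ mid).
have Gm : G `<=` measurable by move=> A [->|->]; [exact: mD|exact: measurableT].
have GT : G setT by right.
have GI : setI_closed G.
  by move=> A B [->|->] [->|->]; [left; rewrite setIid|left; rewrite setIT
    |left; rewrite setTI|right; rewrite setIT].
have indep A (B : set TP) : G A -> measurable B ->
    P (A `&` Y @^-1` B) = (P A * distribution P Y B)%E.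
  move=> [->|->] mB.
    by rewrite indD//; exact: past_sub_sigma_samples mB.
  by rewrite setTI probability_setT mul1e.
pose phi (z : g_sigma_algebraType G * TP) : \bar R := (\1_D (z.1 : T) * h (z.2 : T))%:E.
have mphi : measurable_fun setT phi.
  apply/measurable_EFinP; apply: measurable_funM.
    apply: (measurableT_comp (f := (\1_D : g_sigma_algebraType G -> R))) => //.
    by apply: measurable_indic; apply: sub_sigma_algebra; left.
  exact: (measurableT_comp (f := (h : TP -> R))).
have phi0 z : (0 <= phi z)%E by rewrite lee_fin mulr_ge0.
have := freezing Gm GT GI indep mphi phi0; rewrite /phi /= => ->.
have inner w : (\int[distribution P Y]_s (\1_D (w : T) * h s)%:E = (\1_D w * e)%:E)%E.
  rewrite ge0_integral_distribution//; last first.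
  - by move=> y; rewrite lee_fin mulr_ge0.
  - apply/measurable_EFinP; apply: measurable_funM => //; exact: measurable_cst.
  have := (has_expectationZ (\1_D w) (conj ih he)).2; exact.
under eq_integral => w _ do rewrite inner mulrC EFinM.
rewrite ge0_integralZl//.
- by rewrite integral_indic// setIT muleC.
- exact/measurable_EFinP/measurable_indic.
- by rewrite lee_fin; exact: has_expectation_ge0 (conj ih he) h0.
Qed.

(** The integral splits over the events where the index equals [j], each independent of [h j]
    because [h j] depends on samples alone. *)
Lemma integral_uniform_index k (i : {mfun T >-> nat}) (h : nat -> T -> R) (e : nat -> R) :
  uniform_index P xi k i ->
  (forall j, (uphalf k < j <= k)%N ->
     measurable_fun setT (h j : g_sigma_algebraType (past xi j) -> R)) ->
  (forall j w, (uphalf k < j <= k)%N -> 0 <= h j w) ->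
  (forall j, (uphalf k < j <= k)%N -> has_expectation P (h j) (e j)) ->
  (\int[P]_w (h (i w) w)%:E
    = ((k - uphalf k)%:R^-1 * \sum_((uphalf k).+1 <= j < k.+1) e j)%:E)%E.
Proof.
move=> Hi mh h0 he.
pose D j := i @^-1` [set j].
have mD j : measurable (D j) by rewrite /D -[_ @^-1` _]setTI; exact: measurable_funP.
(* Nothing is known about [h j] outside the index range, hence the value zero there. *)
pose f j w := if (uphalf k < j <= k)%N then \1_(D j) w * h j w else 0.
have f0 j w : 0 <= f j w.
  by rewrite /f; case: ifP => // jk; rewrite mulr_ge0// h0.
have mf j : measurable_fun setT (f j).
  rewrite /f; have [jk|/negPf jk] := boolP (uphalf k < j <= k)%N; last exact: measurable_cst.
  by apply: measurable_funM; [exact: measurable_indic|exact: measurable_past (mh _ jk)].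
transitivity (\int[P]_w \sum_((uphalf k).+1 <= j < k.+1) (f j w)%:E)%E.
  apply: eq_integral => w _; rewrite sumEFin; congr (_%:E).
  have iw := index_range Hi w.
  rewrite (bigD1_seq (i w)) ?iota_uniq ?mem_index_iota//= /f iw.
  rewrite indicE mem_set// mul1r big1_seq ?addr0// => j /andP[ji _].
  by case: ifP => // _; rewrite indicE memNset ?mul0r// => /esym/eqP; rewrite (negPf ji).
rewrite ge0_integral_sum//; last 2 first.
- by move=> j; exact/measurable_EFinP.
- by move=> j w _; rewrite lee_fin.
rewrite mulr_sumr -sumEFin big_seq [RHS]big_seq; apply: eq_bigr => j.
rewrite mem_index_iota ltnS => jk.
under eq_integral => w _ do rewrite /f jk.
have -> : (\int[P]_w (\1_(D j) w * h j w)%:E = P (D j) * (e j)%:E)%E.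
  apply: (@integral_indep_event j) => //.
  - exact: (index_independent Hi).
  - exact: mh.
  - by move=> w; exact: h0.
  - exact: he.
by rewrite /D (index_uniform Hi).
Qed.

End IndependentIndex.

Section MomentumError.
Context {R : realType} {n m : nat} {dXi dT : measure_display}.
Context {Xi : measurableType dXi} {T : measurableType dT}.
Variables (X : set 'rV[R]_n) (mu : probability Xi R) (P : probability T R).
Variables (ft : 'rV[R]_n -> Xi -> R) (c : 'rV[R]_n -> 'rV[R]_m).
Variables (Lf sigma Lc Lgc Cc gamma theta Lbar : R).
Hypothesis Hset : basic_setting X ft.
Hypothesis Hbasic : basic_assumptions X mu ft c Lf sigma Lc Lgc Cc gamma theta.
Hypothesis Havg : average_smoothness X mu ft Lbar.
Variables (alpha rho eta : nat -> R) (x1 : 'rV[R]_n) (xi : nat -> {mfun T >-> Xi}).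
Variables (x g : nat -> T -> 'rV[R]_n).
Hypothesis Hiid : iid_samples P mu xi.
Hypothesis Xx1 : X x1.
Hypothesis Htrm : truncated_recursive_momentum X ft c Lf alpha rho eta x1 xi x g.
Hypothesis eta_gt0 : forall k, (1 <= k)%N -> 0 < eta k.

Local Notation gradf := (grad (objective mu ft)).
Local Notation pastS k := (g_sigma_algebraType (past xi k)).

Definition sqr_error k w : R := enorm (g k w - gradf (x k w)) ^+ 2.
Definition sqr_move k w : R := enorm (x k.+1 w - x k w) ^+ 2.

Let inX := iterate_in Hset Xx1 Htrm.
Let gL := momentum_bound Hbasic Htrm.

Lemma measurable_gradf_comp d (S : measurableType d) (Y : S -> 'rV[R]_n) :
  (forall w, X (Y w)) -> (forall i, measurable_fun setT (fun w => Y w 0 i)) ->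
  forall i, measurable_fun setT (fun w => gradf (Y w) 0 i).
Proof.
move=> XY mY; apply: (measurable_on_X Hset (C := Lbar)) => //.
  exact: Havg.1.
exact: gradf_lip Hset Hbasic Havg.
Qed.

Lemma measurable_sqr_error k : (1 <= k)%N ->
  measurable_fun setT (sqr_error k : pastS k -> R).
Proof.
move=> k1; have [mx mg] := measurable_iterates Hset Hbasic Xx1 Htrm k1.
apply: (@measurable_sqr_enorm _ (pastS k)) => i.
under eq_fun => w do rewrite coordB.
apply: measurable_funB; first exact: mg.
by apply: (@measurable_gradf_comp _ (pastS k)) => // w; exact: inX.
Qed.

Lemma measurable_sqr_move k : (1 <= k)%N ->
  measurable_fun setT (sqr_move k : pastS k -> R).
Proof.
move=> k1; have [mx mg] := measurable_iterates Hset Hbasic Xx1 Htrm k1.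
apply: (@measurable_sqr_enorm _ (pastS k)) => i.
under eq_fun => w do rewrite coordB.
apply: measurable_funB; last exact: mx.
exact: (measurable_step Hset Hbasic Xx1 Htrm).
Qed.

Lemma sqr_move_le k w : (1 <= k)%N ->
  sqr_move k w <= 2 * eta k ^+ 2 * (Lf ^+ 2 + rho k ^+ 2 * (Cc ^+ 2 * Lc ^+ 2)).
Proof.
move=> k1; rewrite /sqr_move (trm_x Htrm)//.
exact: (step_length_sqr Hset Hbasic (rho k) (inX w k1) (eta_gt0 k1) (gL w k1)).
Qed.

Lemma has_expectation_sqr_error k : (1 <= k)%N ->
  has_expectation P (sqr_error k) (\int[P]_w sqr_error k w).
Proof.
move=> k1; apply: (@has_expectation_bounded _ _ _ _ _ (4 * Lf ^+ 2)).
  exact: measurable_past (measurable_sqr_error k1).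
move=> w; rewrite ger0_norm ?sqr_ge0//.
have -> : 4 * Lf ^+ 2 = (Lf + Lf) ^+ 2 by ring.
have Lf0 := Lf_ge0 Hbasic.
rewrite ler_pXn2r ?nnegrE ?enorm_ge0 ?addr_ge0//.
apply: le_trans (ler_enormB _ _) _; apply: lerD; first exact: gL.
exact: (gradf_bound Hbasic (inX w k1)).
Qed.

Lemma has_expectation_sqr_move k : (1 <= k)%N ->
  has_expectation P (sqr_move k) (\int[P]_w sqr_move k w).
Proof.
move=> k1; apply: has_expectation_bounded.
  exact: measurable_past (measurable_sqr_move k1).
by move=> w; rewrite ger0_norm ?sqr_ge0//; exact: sqr_move_le.
Qed.

Lemma momentum_error_recursion k : (1 <= k)%N ->
  \int[P]_w sqr_error k.+1 w <=
  (1 - alpha k) ^+ 2 * (\int[P]_w sqr_error k w) + 2 * alpha k ^+ 2 * sigma ^+ 2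
  + 2 * (1 - alpha k) ^+ 2 * (Lbar ^+ 2 * \int[P]_w sqr_move k w).
Proof.
move=> k1; have [mx mg] := measurable_iterates Hset Hbasic Xx1 Htrm k1.
have mx' := measurable_step Hset Hbasic Xx1 Htrm k1 mx mg.
have XK w : X (x k w) by exact: inX.
have XK' w : X (x k.+1 w) by exact: inX.
pose phi (z : pastS k * Xi) : \bar R := (enorm (recursion_target ft (x k.+1 z.1) (x k z.1)
   (g k z.1) (alpha k) z.2 - gradf (x k.+1 z.1)) ^+ 2)%:E.
have mfst : measurable_fun setT (fst : pastS k * Xi -> pastS k) by exact: measurable_fst.
have mphi : measurable_fun setT phi.
  apply/measurable_EFinP; apply: measurable_sqr_enorm => i.
  under eq_fun => z do rewrite coordB.
  apply: measurable_funB.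
    apply: (measurable_recursion Hset Hbasic (u := fun z : pastS k * Xi => x k.+1 z.1)
      (v := fun z : pastS k * Xi => x k z.1) (y := fun z : pastS k * Xi => g k z.1)
      (z := snd)) => //.
    - by move=> {}i; exact: (measurableT_comp (mx' i) mfst).
    - by move=> {}i; exact: (measurableT_comp (mx i) mfst).
    - by move=> {}i; exact: (measurableT_comp (mg i) mfst).
  apply: (measurable_gradf_comp (Y := fun z : pastS k * Xi => x k.+1 z.1)) => //.
  by move=> {}i; exact: (measurableT_comp (mx' i) mfst).
have phi0 z : (0 <= phi z)%E by rewrite lee_fin sqr_ge0.
have indep A B : past xi k A -> measurable B ->
   P (A `&` xi k.+1 @^-1` B) = (P A * mu B)%E by exact: past_indep Hiid _ _ _.
have frz := freezing (@past_measurable _ _ _ _ xi k) (@pastT _ _ _ _ xi k)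
  (@pastI _ _ _ _ xi k) indep mphi phi0.
have hB := has_expectationD (has_expectationD
    (has_expectationZ ((1 - alpha k) ^+ 2) (has_expectation_sqr_error k1))
    (has_expectation_cst P (2 * alpha k ^+ 2 * sigma ^+ 2)))
  (has_expectationZ (2 * (1 - alpha k) ^+ 2)
    (has_expectationZ (Lbar ^+ 2) (has_expectation_sqr_move k1))).
rewrite -lee_fin -(has_expectation_sqr_error (ltn0Sn k)).2 -hB.2.
(* Truncation is removed before freezing, at the price of an inequality only. *)
apply: (@le_trans _ _ (\int[P]_w phi (w, xi k.+1 w))%E).
  apply: le_integral_nomeas => w; rewrite lee_fin ?sqr_ge0// /sqr_error (trm_g Htrm)//.
  exact: truncation_error Hbasic _ _ _.
rewrite frz; apply: le_integral_nomeas => w.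
  by apply: integral_ge0 => s _.
rewrite /phi /=; apply: le_trans (recursion_error Hset Hbasic Havg _ _ (XK' w) (XK w)) _.
by rewrite lee_fin.
Qed.

End MomentumError.

(** * Summing the energy inequality *)

Section EnergyBound.
Context {R : realType}.
Variable nu : R.
Hypothesis nu_ge : 1 / 3 <= nu.
Hypothesis nu_le : nu <= 1 / 2.

Local Notation rho j := (j%:R `^ nu).
Local Notation eta j := (j%:R `^ (- nu) / (4 * ln (j%:R + 2))).
Local Notation alpha j := (j%:R `^ (- (2 * nu))).
Local Notation l j := (ln (j%:R + 2)).

Let nu_ge0 : 0 <= nu. Proof. by move: nu_ge; lra. Qed.

Lemma rho_ge1 j : (1 <= j)%N -> 1 <= rho j.
Proof. by move=> j1; apply: powR_ge1; rewrite ?ler1n. Qed.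

Lemma etaE j : eta j = (4 * rho j * l j)^-1.
Proof. by rewrite powRN -invfM mulrCA mulrA. Qed.

Lemma eta_gt0 j : (1 <= j)%N -> 0 < eta j.
Proof.
move=> j1; have r1 := rho_ge1 j1; have l1 := @ln_shift_ge1 R j j1.
by rewrite etaE invr_gt0 !mulr_gt0//; [exact: lt_le_trans r1|exact: lt_le_trans l1].
Qed.

Lemma harmonic_tail_le M N : (1 <= N)%N -> (1 <= M)%N -> \sum_(M <= j < N) j%:R^-1 <= 1 + ln N%:R :> R.
Proof.
move=> N1 M1; apply: le_trans (harmonic_sum_le N1).
have [MN|NM] := leqP M N; last first.
  by rewrite big_geq ?(ltnW NM)// sumr_ge0// => j _; rewrite invr_ge0.
rewrite (@big_cat_nat _ _ _ M 1 N.+1)//=; last exact: leqW.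
rewrite (@big_cat_nat _ _ _ N M N.+1)//= addrCA lerDl addr_ge0// sumr_ge0// => j _;
  by rewrite invr_ge0.
Qed.

(** From here on the section concerns real sequences: [e] and [de] stand for the expected squared
    error and squared move, [S] and [M2] for [Lf ^+ 2] and [Cc ^+ 2 * Lc ^+ 2], and [Q] for the rest
    of the descent bound. *)
Variables (Lb L sigma S M2 Q : R) (e de : nat -> R) (K N : nat).
Hypothesis Lb0 : 0 <= Lb.
Hypothesis L0 : 0 <= L.
Hypothesis S0 : 0 <= S.
Hypothesis M20 : 0 <= M2.
Hypothesis K1 : (1 <= K)%N.
Hypothesis KN : (K <= N)%N.
Hypothesis lnK : 2 <= ln (K%:R : R).
Hypothesis KLb : 2 * Lb <= K%:R `^ nu.
Hypothesis KLb2 : 6 * Lb ^+ 2 <= ln K%:R.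
Hypothesis KL : 2 * L <= ln K%:R.
Hypothesis e0 : forall j, 0 <= e j.
Hypothesis de0 : forall j, 0 <= de j.
Hypothesis recursion : forall j, (1 <= j)%N ->
  e j.+1 <= (1 - alpha j) ^+ 2 * e j + 2 * alpha j ^+ 2 * sigma ^+ 2
            + 2 * (1 - alpha j) ^+ 2 * (Lb ^+ 2 * de j).
Hypothesis move_le : forall j, (1 <= j)%N -> de j <= 2 * eta j ^+ 2 * (S + rho j ^+ 2 * M2).
Hypothesis descent :
  \sum_(1 <= j < N) ((2 * eta j)^-1 - (Lb + rho j * L) / 2) * de j
  <= Q + \sum_(1 <= j < N) eta j / 2 * e j.

Local Notation w := (potential_weight nu).

Let c3 : R := 3 / (2 * ln 3).

Lemma weighted_error_step j : (1 <= j)%N ->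
  w j.+1 * e j.+1 + eta j * e j <=
  w j * e j + (c3 * sigma ^+ 2 * j%:R^-1 + w j.+1 * (2 * Lb ^+ 2) * de j).
Proof.
move=> j1; have hr := ler_wpM2l (potential_weight_ge0 nu j.+1) (recursion j1).
have h1 := weight_recursion nu_ge nu_le j1.
have h2 := weight_noise nu_ge nu_le j1.
rewrite powR_2nu in hr; rewrite etaE.
have a1 := rho_ge1 j1; have w0 := potential_weight_ge0 nu j.+1.
move: (rho j) a1 h1 h2 hr => a a1 h1 h2 hr.
have al1 : (a ^+ 2)^-1 <= 1 by rewrite invf_le1 ?exprn_ege1// exprn_gt0//; lra.
have al0 : 0 <= (a ^+ 2)^-1 by rewrite invr_ge0 exprn_ge0//; lra.
move: ((a ^+ 2)^-1) al1 al0 h1 h2 hr => al al1 al0 h1 h2 hr.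
have sq : (1 - al) ^+ 2 <= 1 - al by nra.
have sq1 : (1 - al) ^+ 2 <= 1 by nra.
have t1 : w j.+1 * ((1 - al) ^+ 2 * e j) <= (w j - (4 * a * l j)^-1) * e j.
  apply: (@le_trans _ _ ((1 - al) * w j.+1 * e j)); last by rewrite ler_wpM2r.
  by rewrite mulrA ler_wpM2r// mulrC ler_wpM2r.
have t2 : w j.+1 * (2 * al ^+ 2 * sigma ^+ 2) <= c3 * sigma ^+ 2 * j%:R^-1.
  by have := ler_wpM2r (sqr_ge0 sigma) h2; rewrite /c3; lra.
have t3 : w j.+1 * (2 * (1 - al) ^+ 2 * (Lb ^+ 2 * de j)) <= w j.+1 * (2 * Lb ^+ 2) * de j.
  have q : 0 <= Lb ^+ 2 * de j by rewrite mulr_ge0 ?sqr_ge0.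
  by have := ler_wpM2l w0 (ler_wpM2r q sq1); lra.
by move: hr t1 t2 t3; lra.
Qed.

Lemma weighted_error_sum :
  \sum_(1 <= j < N) eta j * e j <= w 1 * e 1%N +
  \sum_(1 <= j < N) (c3 * sigma ^+ 2 * j%:R^-1 + w j.+1 * (2 * Lb ^+ 2) * de j).
Proof.
have : w N * e N + \sum_(1 <= j < N) eta j * e j <= w 1 * e 1%N +
  \sum_(1 <= j < N) (c3 * sigma ^+ 2 * j%:R^-1 + w j.+1 * (2 * Lb ^+ 2) * de j).
  have : (1 <= N)%N by exact: leq_trans KN.
  elim: (N) => // M ih _; have [->|M0] := posnP M; first by rewrite !big_geq.
  rewrite !big_nat_recr//=; have := ih M0; have := weighted_error_step M0.
  move: (\sum_(_ <= _ < _) _) (\sum_(_ <= _ < _) _) => A B; lra.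
apply: le_trans; rewrite lerDr mulr_ge0//; exact: potential_weight_ge0.
Qed.

(** [b / j] bounds the loss at a step [j < K]: the estimate of [burnin_term] times the move bound,
    with [rho_j^2] replaced by [K]. *)
Let b : R := 1 / 16 * (K%:R `^ (1 / 2) * (L + 6 * Lb ^+ 2)) * (S + M2 * K%:R).

Let KR1 : 1 <= K%:R :> R. Proof. by rewrite ler1n. Qed.

Lemma energy_term_burnin j : (1 <= j)%N -> (j < K)%N ->
  0 <= eta j / 2 * e j + ((2 * eta j)^-1 - (Lb + rho j * L) / 2 - w j.+1 * (2 * Lb ^+ 2)) * de j
       + b * j%:R^-1.
Proof.
move=> j1 jK.
have et0 := eta_gt0 j1; have r1 := rho_ge1 j1; have l1 := @ln_shift_ge1 R j j1.
have hb := burnin_term nu_ge nu_le j1 Lb0 L0 KR1 KL KLb2.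
have hm := move_le j1.
have i2 : (2 * eta j)^-1 = 2 * rho j * l j.
  by rewrite etaE invfM invrK; lra.
have r2K : rho j ^+ 2 <= K%:R.
  apply: le_trans (powR_nu2_le nu_ge nu_le j1) _.
  by rewrite ler_nat ltnW.
set a := rho j in r1 hb hm i2 r2K *.
have t0 : 0 <= eta j / 2 * e j by rewrite mulr_ge0// divr_ge0// ltW.
rewrite i2; rewrite -etaE in hb.
have b0 : 0 <= b * j%:R^-1.
  by rewrite /b !mulr_ge0 ?powR_ge0 ?addr_ge0 ?mulr_ge0 ?sqr_ge0 ?invr_ge0.
pose Y := Lb / 2 + a * L / 2 + w j.+1 * (2 * Lb ^+ 2) - 2 * a * l j.
have -> : 2 * a * l j - (Lb + a * L) / 2 - w j.+1 * (2 * Lb ^+ 2) = - Y by rewrite /Y; field.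
rewrite -/Y in hb.
suff : Y * de j <= b * j%:R^-1 by lra.
(* [- Y] is the coefficient of [de j]; only a positive [Y] costs anything, and then the crude move
   bound is affordable. *)
have [Y0|Y0] := leP Y 0; first by apply: le_trans b0; rewrite mulr_le0_ge0.
apply: le_trans (ler_wpM2l (ltW Y0) hm) _.
have S1 : S + a ^+ 2 * M2 <= S + M2 * K%:R by rewrite lerD2l mulrC ler_wpM2l.
have S2 : 0 <= S + a ^+ 2 * M2 by rewrite addr_ge0// mulr_ge0// sqr_ge0.
have X0 : 0 <= Y * (2 * eta j ^+ 2) by rewrite mulr_ge0 ?(ltW Y0)// mulr_ge0// sqr_ge0.
rewrite mulrA; apply: le_trans (ler_pM X0 S2 hb S1) _.
by rewrite /b -!mulrA (mulrC (S + _)) !mulrA.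
Qed.

Lemma energy_term_stable j : (K <= j)%N ->
  eta j / 2 * e j + 4 / 3 * (rho j * l j) * de j <=
  eta j / 2 * e j + ((2 * eta j)^-1 - (Lb + rho j * L) / 2 - w j.+1 * (2 * Lb ^+ 2)) * de j.
Proof.
move=> Kj; have j1 : (1 <= j)%N by exact: leq_trans Kj.
have KjR : K%:R <= j%:R :> R by rewrite ler_nat.
have lnKl : (ln K%:R : R) <= l j.
  by apply: (@ler_ln2 R K%:R (j%:R + 2)); [rewrite ltr0n|rewrite (le_trans KjR)// lerDl].
have aK : K%:R `^ nu <= rho j by apply: powR_le_mono.
have i2 : (2 * eta j)^-1 = 2 * rho j * l j.
  by rewrite etaE invfM invrK; lra.
have := stable_coefficient nu_ge nu_le j1 Lb0 L0 (le_trans lnK lnKl)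
  (le_trans KLb aK) (le_trans KL lnKl) (le_trans KLb2 lnKl).
by rewrite i2 lerD2l => h; apply: ler_wpM2r => //; rewrite (mulrA (4 / 3)).
Qed.

(** Adding [descent] to [weighted_error_sum] spends half of each [eta_j e_j] on the descent cost;
    [F] keeps the other half. Burn-in terms of [F] are bounded below, later ones are bounded below
    by the energy. *)
Lemma energy_bound :
  \sum_(K <= j < N) (eta j / 2 * e j + 4 / 3 * (rho j * l j) * de j) <=
  Q + e 1%N / (2 * ln 3) + c3 * sigma ^+ 2 * (1 + ln N%:R) + b * (1 + ln K%:R).
Proof.
have N1 : (1 <= N)%N by exact: leq_trans KN.
have w1 : w 1 = (2 * ln 3)^-1.
  by rewrite /potential_weight powR1 mul1r; congr (_ * ln _)^-1; lra.
pose F j := eta j / 2 * e j +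
  ((2 * eta j)^-1 - (Lb + rho j * L) / 2 - w j.+1 * (2 * Lb ^+ 2)) * de j.
have ln30 : 0 < ln 3 :> R by exact: lt_le_trans ln3_ge1.
have c30 : 0 <= c3 * sigma ^+ 2.
  by rewrite /c3 mulr_ge0 ?sqr_ge0// divr_ge0// mulr_ge0// ltW.
have b0 : 0 <= b.
  by rewrite /b !mulr_ge0 ?powR_ge0 ?addr_ge0 ?mulr_ge0 ?sqr_ge0.
have FS : \sum_(1 <= j < N) F j <= Q + e 1%N / (2 * ln 3) + c3 * sigma ^+ 2 * (1 + ln N%:R).
  have h1 := weighted_error_sum; have h2 := descent.
  have h3 := ler_wpM2l c30 (harmonic_tail_le N1 (leqnn 1)).
  have -> : \sum_(1 <= j < N) F j =
     \sum_(1 <= j < N) ((2 * eta j)^-1 - (Lb + rho j * L) / 2) * de j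
     + \sum_(1 <= j < N) eta j / 2 * e j
     - \sum_(1 <= j < N) w j.+1 * (2 * Lb ^+ 2) * de j.
    by rewrite -big_split/= -sumrB; apply: eq_bigr => j _; rewrite /F; ring.
  rewrite big_split/= -mulr_sumr w1 in h1.
  have hh : \sum_(1 <= j < N) eta j * e j = 2 * \sum_(1 <= j < N) eta j / 2 * e j.
    by rewrite mulr_sumr; apply: eq_bigr => j _; rewrite mulrA [2 * _]mulrC divfK ?pnatr_eq0.
  rewrite hh in h1.
  move: h1 h2 h3; rewrite (mulrC (e 1%N)).
  move: (\sum_(1 <= j < N) _ * de j) (\sum_(1 <= j < N) _ * de j)
    (\sum_(1 <= j < N) _ * e j) (\sum_(1 <= j < N) j%:R^-1) => A1 A2 A3 A4 h1 h2 h3.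
  lra.
have FK : - (b * (1 + ln K%:R)) <= \sum_(1 <= j < K) F j.
  have hK : 0 <= \sum_(1 <= j < K) (F j + b * j%:R^-1).
    by rewrite big_seq sumr_ge0// => j; rewrite mem_index_iota => /andP[j1 jK];
      exact: energy_term_burnin.
  rewrite big_split/= -mulr_sumr in hK.
  have := ler_wpM2l b0 (harmonic_tail_le K1 (leqnn 1)); move: hK.
  move: (\sum_(1 <= j < K) F j) (\sum_(1 <= j < K) j%:R^-1) => A B; lra.
have FN : \sum_(K <= j < N) (eta j / 2 * e j + 4 / 3 * (rho j * l j) * de j)
    <= \sum_(K <= j < N) F j.
  rewrite big_seq [leRHS]big_seq; apply: ler_sum => j; rewrite mem_index_iota => /andP[Kj _].
  exact: energy_term_stable.
apply: le_trans FN _; move: FS; rewrite (@big_cat_nat _ _ _ K 1 N)//= => FS.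
rewrite -lerBlDr; apply: le_trans FS; rewrite [leRHS]addrC lerD2l; exact: FK.
Qed.

End EnergyBound.

(** * Convergence *)

Section Convergence.
Context {R : realType} {n m : nat} {dXi dT : measure_display}.
Context {Xi : measurableType dXi} {T : measurableType dT}.
Variables (X : set 'rV[R]_n) (mu : probability Xi R) (P : probability T R).
Variables (ft : 'rV[R]_n -> Xi -> R) (c : 'rV[R]_n -> 'rV[R]_m).
Variables (Lf sigma Lc Lgc Cc gamma theta Lbar nu : R).
Hypothesis Hset : basic_setting X ft.
Hypothesis Hbasic : basic_assumptions X mu ft c Lf sigma Lc Lgc Cc gamma theta.
Hypothesis Havg : average_smoothness X mu ft Lbar.
Hypothesis nu_ge : 1 / 3 <= nu.
Hypothesis nu_le : nu <= 1 / 2.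

Local Notation f := (objective mu ft).
Local Notation gradf := (grad (objective mu ft)).
Local Notation L := (smooth_const Lc Cc Lgc).
Local Notation h := (fun z => enorm (c z) ^+ 2 / 2).
Local Notation rho k := (k%:R `^ nu).
Local Notation eta k := (k%:R `^ (- nu) / (4 * ln (k%:R + 2))).
Local Notation alpha k := (k%:R `^ (- (2 * nu))).
Local Notation l k := (ln (k%:R + 2)).
Local Notation p := (2 * nu / theta).

Variables (x1 : 'rV[R]_n) (xi : nat -> {mfun T >-> Xi}) (x g : nat -> T -> 'rV[R]_n).
Hypothesis Hiid : iid_samples P mu xi.
Hypothesis Xx1 : X x1.
Hypothesis Htrm : truncated_recursive_momentum X ft c Lf (fun k => alpha k) (fun k => rho k) (fun k => eta k) x1 xi x g.

Variables (K : nat) (C1 : R).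
Hypothesis K7 : (7 <= K)%N.
Hypothesis KLb : 2 * Lbar <= K%:R `^ nu.
Hypothesis KLb2 : 6 * Lbar ^+ 2 <= ln K%:R.
Hypothesis KL : 2 * L <= ln K%:R.
Hypothesis Ktheta : expR (2 * theta) <= K%:R.
Hypothesis Kgrowth : growth_base gamma theta `^ (2 * theta) <= K%:R.
Hypothesis C1_ge1 : 1 <= C1.
Hypothesis C1_ge_base : K%:R `^ p * Cc ^+ 2 / 2 <= C1.
Hypothesis C1_ge_step : 2 `^ (3 - theta) * Lf ^+ 2 * gamma ^- 2 <= C1.

Let th1 : 1 <= theta. Proof. exact: theta_ge1 Hbasic. Qed.
Let nu0 : 0 <= nu. Proof. by move: nu_ge; lra. Qed.
Let inX := iterate_in Hset Xx1 Htrm.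
Let gL := momentum_bound Hbasic Htrm.
Let rho_gt0 k : (1 <= k)%N -> 0 < rho k :> R.
Proof. by move=> k1; exact: lt_le_trans (rho_ge1 nu_ge k1). Qed.
Let eta_pos k : (1 <= k)%N -> 0 < eta k :> R.
Proof. by move=> k1; exact: eta_gt0. Qed.

Let eta_rho k : (1 <= k)%N -> (eta k * rho k)^-1 = 4 * l k :> R.
Proof.
move=> k1; rewrite etaE -(mulrA 4) mulrCA [X in X * rho k]invfM mulrAC mulVf ?mul1r ?invrK//.
by rewrite gt_eqF// rho_gt0.
Qed.

Let ln_le_l k : (K <= k)%N -> ln K%:R <= l k :> R.
Proof.
move=> Kk; have KkR : K%:R <= k%:R :> R by rewrite ler_nat.
apply: (@ler_ln2 R K%:R (k%:R + 2)); first by rewrite ltr0n; exact: leq_trans K7.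
by rewrite (le_trans KkR)// lerDl.
Qed.

Lemma feasibility_decay k w : (K <= k)%N ->
  enorm (c (x k w)) ^+ 2 / 2 <= C1 * k%:R `^ (- p).
Proof.
elim: k => [|k ih] Kk.
  by have := leq_trans K7 Kk.
have [Kk1|kK] := leqP K k; last first.
  have K1 : (1 <= K)%N by exact: leq_trans K7.
  (* The induction really starts at [K], where the second entry of [C1_const] reduces the claim to
     the bound [Cc]. *)
  have -> : k.+1 = K by apply/eqP; rewrite eqn_leq kK Kk.
  have Kp : 0 < K%:R `^ p by rewrite powR_gt0// ltr0n.
  rewrite powRN ler_pdivlMr// [leLHS]mulrC; apply: le_trans C1_ge_base.
  rewrite -(mulrA _ (Cc ^+ 2)) ler_wpM2l ?(ltW Kp)// ler_wpM2r// ler_pXn2r ?nnegrE ?enorm_ge0//.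
    exact: c_bounded Hbasic _ (inX w K1).
  exact: Cc_ge0 Hset Hbasic.
have k1 : (1 <= k)%N by exact: leq_trans (leq_trans _ K7) Kk1.
have k7 : (7 <= k)%N by exact: leq_trans Kk1.
have KkR : K%:R <= k%:R :> R by rewrite ler_nat.
have stat := step_feasibility_stationarity Hset Hbasic (inX w k1) (rho_gt0 k1) (eta_pos k1) (gL w k1).
have dec := step_feasibility_descent Hset Hbasic (inX w k1) (rho_gt0 k1) (eta_pos k1) (gL w k1).
rewrite -(trm_x Htrm)// in stat dec; rewrite eta_rho// in stat dec.
have eb := c_error_bound Hbasic (inX w (ltn0Sn k)).
apply: (feasibility_step nu0 nu_le th1 (gamma_gt0 Hbasic) (Lf_ge0 Hbasic) k7 C1_ge1 C1_ge_step
  _ _ (enorm_ge0 _) (enorm_ge0 _) dec (le_trans eb stat) (ih Kk1)).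
- exact: le_trans KL (ln_le_l Kk1).
- exact: growth_base_ge (gamma_gt0 Hbasic) th1 (le_trans Ktheta KkR) (le_trans Kgrowth KkR).
Qed.

(** Raising the penalty between steps leaves the increments of [rho] times the new violation. The
    sum starts from [Qpen 1] because [rho_1 = 1]. *)
Lemma penalty_descent_sum N w : (1 <= N)%N ->
  f (x N w) + rho N * (enorm (c (x N w)) ^+ 2 / 2)
  + \sum_(1 <= j < N) ((2 * eta j)^-1 - (Lbar + rho j * L) / 2) * sqr_move x j w
  <= Qpen mu ft c 1 x1
  + \sum_(1 <= j < N) eta j / 2 * sqr_error mu ft x g j w
  + \sum_(1 <= j < N) (rho j.+1 - rho j) * (enorm (c (x j.+1 w)) ^+ 2 / 2).
Proof.
elim: N => // N ih _; have [->|N0] := posnP N.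
  by rewrite !big_geq// (trm_x1 Htrm) powR1 /Qpen !addr0 mul1r [1 / 2 * _]mulrC mulrA mulr1.
have st := step_penalty_descent Hset Hbasic Havg (g N w) (inX w N0) (rho_gt0 N0) (eta_pos N0).
rewrite -(trm_x Htrm)// in st.
rewrite !big_nat_recr//=; move: (ih N0) st.
rewrite -/(sqr_move x N w) -/(sqr_error mu ft x g N w).
set A := \sum_(1 <= j < N) _ * sqr_move x j w.
set B := \sum_(1 <= j < N) _ * sqr_error mu ft x g j w.
set D := \sum_(1 <= j < N) _ * (_ / 2).
move: (f _) (f _) (enorm _ ^+ 2) (enorm _ ^+ 2) (Qpen _ _ _ _ _) => f1 f2 c1 c2 Q.
move: (sqr_move _ _ _) (sqr_error _ _ _ _ _ _) (rho N) (rho N.+1) (_^-1) A B D.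
move=> mv er r r' ie A B D; lra.
Qed.

(** Before [K] the violation is bounded by [Cc] and the increments telescope. Afterwards the
    increment is at most [rho_j / (2 j)] and the violation decays, so each term is at most
    [C1 j^(nu - p) / (2 j)]. *)
Lemma penalty_increment_sum N w : (K <= N)%N ->
  \sum_(1 <= j < N) (rho j.+1 - rho j) * (enorm (c (x j.+1 w)) ^+ 2 / 2) <=
  1 / 2 * Cc ^+ 2 * (rho K - 1)
  + 1 / 2 * C1 * Num.max 1 (N%:R `^ (nu - p)) * (1 + ln N%:R).
Proof.
move=> KN; have K1 : (1 <= K)%N by exact: leq_trans K7.
have N1 : (1 <= N)%N by exact: leq_trans KN.
have Cc0 := Cc_ge0 Hset Hbasic.
have rho_mono j : rho j <= rho j.+1 by apply: powR_le_mono; rewrite ?ler_nat.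
rewrite (@big_cat_nat _ _ _ K 1 N)//=; apply: lerD.
  apply: (@le_trans _ _ (\sum_(1 <= j < K) (rho j.+1 - rho j) * (Cc ^+ 2 / 2))).
    rewrite big_seq [leRHS]big_seq; apply: ler_sum => j; rewrite mem_index_iota => /andP[j1 _].
    rewrite ler_wpM2l ?subr_ge0// ler_wpM2r// ler_pXn2r ?nnegrE ?enorm_ge0//.
    exact: c_bounded Hbasic _ (inX w (ltn0Sn j)).
  rewrite -mulr_suml telescope_sumr// powR1 le_eqVlt; apply/orP; left; apply/eqP.
  by field.
have th0 : 0 < theta by exact: lt_le_trans th1.
have p0 : 0 <= p by rewrite divr_ge0 ?mulr_ge0 ?(ltW th0).
have C10 : 0 <= C1 by exact: le_trans C1_ge1.
set M := Num.max _ _.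
have M0 : 0 <= M by rewrite le_max ler01.
apply: (@le_trans _ _ (\sum_(K <= j < N) 1 / 2 * C1 * M * j%:R^-1)).
  rewrite big_seq [leRHS]big_seq; apply: ler_sum => j; rewrite mem_index_iota => /andP[Kj jN].
  have j1 : (1 <= j)%N by exact: leq_trans Kj.
  have j0 : 0 < j%:R :> R by rewrite ltr0n.
  have d1 : rho j.+1 - rho j <= rho j * (2 * j%:R)^-1.
    have nub : 0 <= nu <= 1 / 2 by rewrite nu0.
    by have := powR_succ_le j1 nub; rewrite mulrDr mulr1 lerBlDl.
  have d2 : enorm (c (x j.+1 w)) ^+ 2 / 2 <= C1 * j%:R `^ (- p).
    apply: le_trans (feasibility_decay w (leqW Kj)) _; rewrite ler_wpM2l//.
    by rewrite !powRN lef_pV2 ?posrE ?powR_gt0 ?ltr0n//; apply: powR_le_mono; rewrite ?ler_nat.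
  have d3 : rho j * j%:R `^ (- p) <= M.
    rewrite -powRD; last by apply/implyP => _; rewrite gt_eqF.
    have [q0|q0] := leP (nu - p) 0.
      apply: (@le_trans _ _ 1); last by rewrite le_max lexx.
      by rewrite -[leRHS](powRr0 (j%:R : R)); apply: ler_powR; rewrite ?ler1n.
    apply: (@le_trans _ _ (N%:R `^ (nu - p))); last by rewrite le_max lexx orbT.
    by apply: powR_le_mono; rewrite ?(ltW q0)// ler_nat ltnW.
  have r0 : 0 <= rho j.+1 - rho j by rewrite subr_ge0.
  have c0 : 0 <= enorm (c (x j.+1 w)) ^+ 2 / 2 by rewrite divr_ge0 ?sqr_ge0.
  apply: le_trans (ler_pM r0 c0 d1 d2) _.
  have -> : rho j * (2 * j%:R)^-1 * (C1 * j%:R `^ (- p)) =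
     1 / 2 * C1 * (rho j * j%:R `^ (- p)) * j%:R^-1.
    by field; rewrite gt_eqF.
  by rewrite ler_wpM2r ?invr_ge0 ?(ltW j0)// ler_wpM2l// mulr_ge0.
rewrite -mulr_sumr ler_wpM2l//; last exact: harmonic_tail_le N1 K1.
by rewrite !mulr_ge0.
Qed.

Local Notation E j := (\int[P]_w sqr_error mu ft x g j w).
Local Notation D j := (\int[P]_w sqr_move x j w).

Lemma expected_energy_bound N (Qs : R) : (K <= N)%N ->
  (forall y, X y -> Qs <= Qpen mu ft c 1 y) ->
  \sum_(K <= j < N) (eta j / 2 * E j + 4 / 3 * (rho j * l j) * D j) <=
  Qpen mu ft c 1 x1 - Qs + E 1%N / (2 * ln 3)
  + 1 / 2 * C1 * Num.max 1 (N%:R `^ (nu - p)) * (1 + ln N%:R)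
  + 1 / 2 * Cc ^+ 2 * (rho K - 1)
  + 3 / (2 * ln 3) * sigma ^+ 2 * (1 + ln N%:R)
  + 1 / 16 * (K%:R `^ (1 / 2) * (L + 6 * Lbar ^+ 2)) * (Lf ^+ 2 + Cc ^+ 2 * Lc ^+ 2 * K%:R)
    * (1 + ln K%:R).
Proof.
move=> KN Qmin; have K1 : (1 <= K)%N by exact: leq_trans K7.
have N1 : (1 <= N)%N by exact: leq_trans KN.
have L0 := L_ge0 Hset Hbasic.
have Lb0 := Havg.1.
have eta0 k : (1 <= k)%N -> 0 < eta k :> R by exact: eta_pos.
have KR0 : 0 < K%:R :> R by rewrite ltr0n.
have lnK : 2 <= ln (K%:R : R).
  rewrite -[leLHS](@expRK R); apply: ler_ln2; first exact: expR_gt0.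
  by apply: le_trans Ktheta; rewrite ler_expR; move: th1; lra.
set HB := 1 / 2 * C1 * Num.max 1 _ * (1 + ln N%:R).
set HK := 1 / 2 * Cc ^+ 2 * _.
have desc : \sum_(1 <= j < N) ((2 * eta j)^-1 - (Lbar + rho j * L) / 2) * D j
  <= (Qpen mu ft c 1 x1 - Qs + HB + HK) + \sum_(1 <= j < N) eta j / 2 * E j.
  have s1 : has_expectation P
      (fun w => \sum_(1 <= j < N) ((2 * eta j)^-1 - (Lbar + rho j * L) / 2) * sqr_move x j w)
      (\sum_(1 <= j < N) ((2 * eta j)^-1 - (Lbar + rho j * L) / 2) * D j).
    apply: has_expectation_sum => j; rewrite mem_index_iota => /andP[j1 _].
    exact: has_expectationZ (has_expectation_sqr_move P Hset Hbasic Xx1 Htrm eta0 j1).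
  have s2 : has_expectation P
      (fun w => \sum_(1 <= j < N) eta j / 2 * sqr_error mu ft x g j w)
      (\sum_(1 <= j < N) eta j / 2 * E j).
    apply: has_expectation_sum => j; rewrite mem_index_iota => /andP[j1 _].
    exact: has_expectationZ (has_expectation_sqr_error P Hset Hbasic Havg Xx1 Htrm j1).
  apply: has_expectation_le s1
    (has_expectationD (has_expectation_cst P (Qpen mu ft c 1 x1 - Qs + HB + HK)) s2) _.
  move=> w /=.
  have q1 := penalty_descent_sum w N1; have q2 := penalty_increment_sum w KN.
  have q3 := Qmin _ (inX w N1); rewrite /Qpen in q3.
  have r1 := rho_ge1 nu_ge N1.
  (* Since [rho N >= 1], the terminal penalised value dominates [Qpen 1], hence the lower bound
     [Qs]. *)
  have q4 : 1 / 2 * enorm (c (x N w)) ^+ 2 <= rho N * (enorm (c (x N w)) ^+ 2 / 2).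
    by have := ler_wpM2r (sqr_ge0 (enorm (c (x N w)))) r1; lra.
  rewrite -/HB -/HK in q2; set A2 := rho N * _ in q1 q4; move: A2 q1 q2 q3 q4 => A2.
  move: (\sum_(1 <= j < N) _ * sqr_move x j w) (\sum_(1 <= j < N) _ * sqr_error mu ft x g j w).
  move: (\sum_(1 <= j < N) _ * (_ / 2)) (enorm _ ^+ 2) => A1 A3 A4 A5.
  lra.
have E0 j : 0 <= E j by apply: Rintegral_ge0 => w _; exact: sqr_ge0.
have D0 j : 0 <= D j by apply: Rintegral_ge0 => w _; exact: sqr_ge0.
have rec j : (1 <= j)%N -> E j.+1 <= (1 - alpha j) ^+ 2 * E j + 2 * alpha j ^+ 2 * sigma ^+ 2
            + 2 * (1 - alpha j) ^+ 2 * (Lbar ^+ 2 * D j).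
  by move=> j1; exact: (momentum_error_recursion Hset Hbasic Havg Hiid Xx1 Htrm eta0 j1).
have mv j : (1 <= j)%N -> D j <= 2 * eta j ^+ 2 * (Lf ^+ 2 + rho j ^+ 2 * (Cc ^+ 2 * Lc ^+ 2)).
  move=> j1; apply: (has_expectation_le
    (has_expectation_sqr_move P Hset Hbasic Xx1 Htrm eta0 j1) (has_expectation_cst P _)) => w.
  exact: (sqr_move_le Hset Hbasic Xx1 Htrm eta0 w j1).
have Mc0 : 0 <= Cc ^+ 2 * Lc ^+ 2 by rewrite mulr_ge0 ?sqr_ge0.
have := energy_bound nu_ge nu_le Lb0 L0 (sqr_ge0 Lf) Mc0 K1 KN lnK KLb KLb2 KL E0 D0 rec mv desc.
move=> /le_trans; apply; rewrite le_eqVlt; apply/orP; left; apply/eqP.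
by rewrite -/HB -/HK; ring.
Qed.

Definition step_energy (j : nat) (w : T) : R :=
  eta j / 2 * sqr_error mu ft x g j w + 4 / 3 * (rho j * l j) * sqr_move x j w.

Lemma step_energy_ge0 j w : (1 <= j)%N -> 0 <= step_energy j w.
Proof.
move=> j1; have l1 := @ln_shift_ge1 R j j1; have l0 : 0 <= l j :> R by exact: le_trans ler01 l1.
by rewrite /step_energy addr_ge0// mulr_ge0 ?sqr_ge0// ?divr_ge0 ?mulr_ge0 ?powR_ge0.
Qed.

Lemma has_expectation_step_energy j : (1 <= j)%N ->
  has_expectation P (step_energy j) (eta j / 2 * E j + 4 / 3 * (rho j * l j) * D j).
Proof.
move=> j1; have eta0 k : (1 <= k)%N -> 0 < eta k :> R by exact: eta_pos.
apply: has_expectationD; apply: has_expectationZ.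
  exact: (has_expectation_sqr_error P Hset Hbasic Havg Xx1 Htrm j1).
exact: (has_expectation_sqr_move P Hset Hbasic Xx1 Htrm eta0 j1).
Qed.

(** Stated for the past of [j.+1] because the random index takes the value [j.+1] when the energy of
    step [j] is evaluated. *)
Lemma measurable_step_energy j : (1 <= j)%N ->
  measurable_fun setT (step_energy j : g_sigma_algebraType (past xi j.+1) -> R).
Proof.
move=> j1; apply: measurable_fun_sub_sigma (@past_succ _ _ _ _ xi j) _.
apply: measurable_funD; (apply: measurable_funM; first exact: measurable_cst).
  exact: (measurable_sqr_error Hset Hbasic Havg Xx1 Htrm).
exact: (measurable_sqr_move Hset Hbasic Xx1 Htrm).
Qed.

Lemma stationarity_le_energy j w : (K <= j)%N ->
  edist 0 [set (gradf (x j.+1 w) + rho j *: nablac_c c (x j.+1 w) + v)%R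
           | v in normal_cone X (x j.+1 w)] ^+ 2
  <= 48 * (rho j * l j) * step_energy j w.
Proof.
move=> Kj; have K1 : (1 <= K)%N by exact: leq_trans K7.
have j1 : (1 <= j)%N by exact: leq_trans Kj.
have st := step_stationarity Hset Hbasic Havg (g j w) (inX w j1) (rho_gt0 j1) (eta_pos j1).
rewrite -(trm_x Htrm)// in st.
have lnK : 2 <= ln (K%:R : R).
  rewrite -[leLHS](@expRK R); apply: ler_ln2; first exact: expR_gt0.
  by apply: le_trans Ktheta; rewrite ler_expR; move: th1; lra.
have ll := ln_le_l Kj; have r1 := rho_ge1 nu_ge j1.
have l2 : 2 <= l j :> R by exact: le_trans lnK ll.
have l1 : 1 <= l j :> R by apply: le_trans l2; rewrite ler1n.
have Lr : 2 * Lbar <= rho j.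
  by apply: le_trans KLb _; apply: powR_le_mono; rewrite ?ler_nat.
have Ll : 2 * L <= l j by exact: le_trans KL ll.
have ie : (eta j)^-1 = 4 * (rho j * l j) by rewrite etaE invrK mulrA.
rewrite ie in st.
have e0 : 0 <= edist 0 [set (gradf (x j.+1 w) + rho j *: nablac_c c (x j.+1 w) + v)%R
           | v in normal_cone X (x j.+1 w)].
  apply: edist_ge0; exists (gradf (x j.+1 w) + rho j *: nablac_c c (x j.+1 w) + 0), 0 => //.
  split; first exact: inX.
  by move=> y _; rewrite -(scale0r (0 : 'rV[R]_n)) dotvZl mul0r.
rewrite /step_energy etaE /sqr_error /sqr_move.
move: (edist _ _) e0 st => dd e0 st.
have n1 := enorm_ge0 (g j w - gradf (x j w)); have n2 := enorm_ge0 (x j.+1 w - x j w).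
move: (enorm (g j w - _)) (enorm (x j.+1 w - _)) n1 n2 st => a b a0 b0 st.
rewrite -(mulrA 4).
have rl1 : 1 <= rho j * l j by rewrite mulr_ege1.
(* [19 / 4 = 1 / 4 + 1 / 2 + 4], from [Lbar <= rho / 2], [L <= l / 2] and [l >= 2]. *)
have cb : Lbar + rho j * L + 4 * (rho j * l j) <= 19 / 4 * (rho j * l j).
  have := ler_wpM2l (le_trans ler01 r1) Ll.
  by have := ler_wpM2l (le_trans ler01 r1) l2; lra.
move: (rho j * l j) rl1 cb st => q q1 cb st.
have st2 : dd <= a + 19 / 4 * q * b.
  by apply: le_trans st _; rewrite lerD2l ler_wpM2r.
have q0 : 0 < q by exact: lt_le_trans q1.
have -> : 48 * q * ((4 * q)^-1 / 2 * a ^+ 2 + 4 / 3 * q * b ^+ 2) =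
    6 * a ^+ 2 + 64 * (q * b) ^+ 2 by field; rewrite gt_eqF.
have qb0 : 0 <= q * b by rewrite mulr_ge0// ltW.
have st3 : dd ^+ 2 <= (a + 19 / 4 * q * b) ^+ 2.
  by rewrite ler_pXn2r ?nnegrE// addr_ge0// -mulrA mulr_ge0.
apply: le_trans st3 _; rewrite -mulrA; move: (q * b) qb0 => t t0.
by have := sqr_ge0 (a - 19 / 4 * t); have := sqr_ge0 a; have := sqr_ge0 t; lra.
Qed.

(** Index [j] is charged to step [j.-1], and the prefactor is taken at the last step, [k.-1], where
    the logarithm is [ln (k + 1)]. At least [(k - 1) / 2] indices are averaged, so [96 = 2 * 48]. *)
Lemma expected_stationarity k (i : {mfun T >-> nat}) (B : R) :
  uniform_index P xi k i ->
  (K <= uphalf k)%N -> (2 <= k)%N -> (k.-1 <= 2 * (k - uphalf k))%N ->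
  \sum_(K <= j < k) (eta j / 2 * E j + 4 / 3 * (rho j * l j) * D j) <= B ->
  (\int[P]_w (edist 0 [set (gradf (x (i w) w) + rho (i w).-1 *: nablac_c c (x (i w) w) + v)%R
           | v in normal_cone X (x (i w) w)] ^+ 2)%:E
  <= (96 * ln (k%:R + 1) / (k%:R - 1) `^ (1 - nu) * B)%:E)%E.
Proof.
move=> Hi Kh k2 kN hB.
have K1 : (1 <= K)%N by exact: leq_trans K7.
have k1R : k%:R - 1 = k.-1%:R :> R.
  by rewrite -[in LHS](prednK (ltnW k2)) -natr1 addrK.
have kp : 0 < k.-1%:R :> R by rewrite ltr0n -ltnS prednK// ltnW.
have kE : k%:R + 1 = k.-1%:R + 2 :> R by rewrite -k1R; ring.
pose CN := 48 * (rho k.-1 * l k.-1).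
have l0 : 0 <= l k.-1 :> R.
  by apply: le_trans ler01 (ln_shift_ge1 _); rewrite -ltnS prednK// ltnW.
have CN0 : 0 <= CN by rewrite !mulr_ge0 ?powR_ge0.
pose en j := eta j / 2 * E j + 4 / 3 * (rho j * l j) * D j.
have en0 j : (1 <= j)%N -> 0 <= en j.
  move=> j1; apply: has_expectation_ge0 (has_expectation_step_energy j1) _ => w.
  exact: step_energy_ge0.
have pred1 j : (uphalf k < j <= k)%N -> (K <= j.-1 < k)%N /\ j.-1.+1 = j.
  move=> /andP[a b]; have j0 : (0 < j)%N by exact: leq_ltn_trans a.
  by rewrite prednK// b andbT -ltnS prednK// (leq_ltn_trans Kh a).
have pred2 j : (uphalf k < j <= k)%N -> (1 <= j.-1)%N.
  by move=> /pred1 [/andP[a _] _]; exact: leq_trans a.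
apply: (@le_trans _ _ (\int[P]_w (CN * step_energy (i w).-1 w)%:E)%E).
  apply: le_integral_nomeas => w; rewrite lee_fin ?sqr_ge0//.
  have iw := index_range Hi w; have [/andP[Ki ik] iE] := pred1 _ iw.
  have i1 := pred2 _ iw.
  have := stationarity_le_energy w Ki; rewrite iE => /le_trans; apply.
  rewrite ler_wpM2r ?step_energy_ge0// /CN ler_wpM2l//.
  have ikR : (i w).-1%:R <= k.-1%:R :> R.
    by rewrite ler_nat -!subn1; apply: leq_sub2r; case/andP: iw.
  apply: ler_pM; rewrite ?powR_ge0//.
  - exact: le_trans ler01 (ln_shift_ge1 i1).
  - exact: powR_le_mono.
  - by apply: ler_ln2; [rewrite addr_gt0// ltr0n|rewrite lerD2r].
rewrite (@integral_uniform_index _ _ _ _ _ P xi k i (fun j w => CN * step_energy j.-1 w)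
  (fun j => CN * en j.-1) Hi); last 3 first.
- move=> j /[dup] jk /pred1[_ jE]; apply: measurable_funM; first exact: measurable_cst.
  by have := measurable_step_energy (pred2 _ jk); rewrite jE.
- by move=> j w jk; rewrite mulr_ge0// step_energy_ge0// pred2.
- by move=> j jk; apply: has_expectationZ; apply: has_expectation_step_energy; exact: pred2.
rewrite lee_fin big_add1 /= -mulr_sumr.
have S1 : \sum_(uphalf k <= j < k) en j <= B.
  have hk : (uphalf k <= k)%N by rewrite leq_uphalf_double -addnn leq_addr.
  apply: le_trans hB; rewrite [leRHS](@big_cat_nat _ _ _ (uphalf k) K k)//= lerDr.
  rewrite big_seq sumr_ge0// => j; rewrite mem_index_iota => /andP[Kj _].
  by apply: en0; exact: leq_trans Kj.
have S0 : 0 <= \sum_(uphalf k <= j < k) en j.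
  rewrite big_seq sumr_ge0// => j; rewrite mem_index_iota => /andP[hj _].
  by apply: en0; exact: leq_trans (leq_trans K1 Kh) hj.
have N1 : (k - uphalf k)%:R^-1 <= 2 / k.-1%:R :> R.
  have N0 : 0 < (k - uphalf k)%:R :> R.
    by rewrite ltr0n; move: kN kp; rewrite ltr0n; case: (k - uphalf k)%N => //; rewrite muln0; case: k.-1.
  rewrite -[leLHS]mul1r ler_pdivrMr// mulrAC ler_pdivlMr// mul1r -natrM ler_nat.
  exact: kN.
rewrite k1R kE.
have -> : 96 * l k.-1 / k.-1%:R `^ (1 - nu) * B = 2 / k.-1%:R * (CN * B).
  rewrite powRB; last by apply/implyP => _; rewrite gt_eqF.
  rewrite powRr1 ?ltW// /CN invf_div; ring.
apply: ler_pM => //; first by rewrite mulr_ge0.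
by rewrite ler_wpM2l.
Qed.

End Convergence.

Lemma uphalf_bounds (k K : nat) : (2 * K <= k)%N -> (7 <= K)%N ->
  [/\ (K <= uphalf k)%N, (k <= 2 * uphalf k)%N, (14 <= k)%N
    & (k.-1 <= 2 * (k - uphalf k))%N].
Proof.
move=> Kk K7; rewrite uphalf_half; have := odd_double_half k.
move: (k./2) (odd k) => h b; rewrite -muln2; case: b => /= e; split; lia.
Qed.

Lemma EFin_affine (R : realType) (s q q' e i t3 t4 t5 t6 : R) :
  (s%:E * (q%:E - q'%:E + e%:E * i%:E + t3%:E + t4%:E + t5%:E + t6%:E)
   = (s * (q - q' + e * i + t3 + t4 + t5 + t6))%:E)%E.
Proof. by []. Qed.

(** The energy bound gives the noise term without [sqrt 2]; the stated term is larger. The next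
    lemma likewise adds an [Lb] term to the burn-in constant. *)
Lemma noise_constant_le (R : realType) (s u v : R) : 0 <= s -> 0 <= u -> 0 < v ->
  3 / (2 * v) * s * u <= 3 * Num.sqrt 2 * s * u / (2 * v).
Proof.
move=> s0 u0 v0.
have -> : 3 / (2 * v) * s * u = 3 * 1 * s * u / (2 * v) by rewrite mulr1 -!mulrA; congr (_ * _); ring.
rewrite ler_wpM2r ?invr_ge0 ?mulr_ge0 ?(ltW v0)// ler_wpM2r// ler_wpM2r// ler_wpM2l//.
by rewrite -[leLHS](@sqrtr1 R) ler_sqrt// ler1n.
Qed.

Lemma burnin_constant_le (R : realType) (q L Lb S u : R) : 0 <= Lb -> 0 <= S -> 0 <= u ->
  1 / 16 * (q * (L + 6 * Lb ^+ 2)) * S * u <=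
  1 / 16 * u * (Lb + q * L + 6 * q * Lb ^+ 2) * S.
Proof.
move=> Lb0 S0 u0; rewrite -subr_ge0.
have -> : 1 / 16 * u * (Lb + q * L + 6 * q * Lb ^+ 2) * S -
   1 / 16 * (q * (L + 6 * Lb ^+ 2)) * S * u = 1 / 16 * (u * Lb * S) by ring.
by rewrite !mulr_ge0.
Qed.

Theorem theorem1 (R : realType) (n m : nat)
  (* problem data *)
  (dXi : measure_display) (Xi : measurableType dXi) (mu : probability Xi R)
  (X : set 'rV[R]_n) (ft : 'rV[R]_n -> Xi -> R) (c : 'rV[R]_n -> 'rV[R]_m)
  (Lf sigma Lc Lgc Cc gamma theta Lbar : R)
  (Hset : basic_setting X ft)
  (Hbasic : basic_assumptions X mu ft c Lf sigma Lc Lgc Cc gamma theta)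
  (Havg : average_smoothness X mu ft Lbar)
  (* parameters *)
  (thetahat : R) (Hthetahat : 1 <= thetahat) :
  let f := objective mu ft in
  let L := smooth_const Lc Cc Lgc in
  let nu := nu_exp thetahat in
  let rho : nat -> R := fun k => k%:R `^ nu in
  let eta : nat -> R := fun k => k%:R `^ (- nu) / (4 * ln (k%:R + 2)) in
  let alpha : nat -> R := fun k => k%:R `^ (- (2 * nu)) in
  let K1 := K1_const nu L Lbar gamma theta in
  let C1 := C1_const nu K1 Lf Cc gamma theta in
  forall (dT : measure_display) (T : measurableType dT) (P : probability T R)
    (xi : nat -> {mfun T >-> Xi}) (x1 : 'rV[R]_n)
    (x g : nat -> T -> 'rV[R]_n) (iota : nat -> {mfun T >-> nat}),
  iid_samples P mu xi ->
  X x1 ->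
  truncated_recursive_momentum X ft c Lf alpha rho eta x1 xi x g ->
  (forall k, (2 <= k)%N -> uniform_index P xi k (iota k)) ->
  forall k : nat, 2 * K1 <= k%:R ->
  ('E_P[fun w =>
      let y := x (iota k w) w in
      (edist 0 [set (grad f y + rho (iota k w).-1 *: nablac_c c y + v)%R
               | v in normal_cone X y] ^+ 2)%R]
   <= (102 * ln (k%:R + 1) / (k%:R - 1) `^ (1 - nu))%:E
      * ((Qpen mu ft c 1 x1)%:E - Q1star X mu ft c
         + 'E_P[fun w => (enorm (g 1%N w - grad f x1) ^+ 2)%R] * (2 * ln 3)^-1%:E
         + (1 / 2 * C1 * Num.max 1 (k%:R `^ (nu - 2 * nu / theta))
            * (1 + ln k%:R))%:E
         + (1 / 2 * Cc ^+ 2 * (K1 `^ nu - 1))%:E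
         + (3 * Num.sqrt 2 * sigma ^+ 2 * (1 + ln k%:R) / (2 * ln 3))%:E
         + (1 / 16 * (1 + ln K1)
            * (Lbar + K1 `^ (1 / 2) * L + 6 * K1 `^ (1 / 2) * Lbar ^+ 2)
            * (Lf ^+ 2 + Cc ^+ 2 * Lc ^+ 2 * K1))%:E))%E
  /\
  (forall w, enorm (c (x (iota k w) w)) ^+ 2
     <= 2 * C1 * (k%:R / 2) `^ (- (2 * nu / theta))).

Proof.
move=> f L nu rho eta alpha K1 C1 dT T P xi x1 x g iota Hiid Xx1 Htrm Hiota k Hk.
have /andP[nu_ge nu_le] := nu_exp_bounds Hthetahat.
rewrite -/nu in nu_ge nu_le.
have nu_gt0 : 0 < nu by apply: lt_le_trans nu_ge.
have th1 := theta_ge1 Hbasic.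
have th0 : 0 < theta by exact: lt_le_trans th1.
have [K [K1E K7 [KLb KLb2 KL Kth Kgr]]] :=
  K1_const_spec L gamma nu_gt0 Havg.1 th1.
rewrite -/K1 in K1E.
have C1_ge1 : 1 <= C1 by rewrite /C1 /C1_const le_max lexx.
have C1_base : K%:R `^ (2 * nu / theta) * Cc ^+ 2 / 2 <= C1.
  by rewrite /C1 /C1_const K1E !le_max lexx orbT.
have C1_step : 2 `^ (3 - theta) * Lf ^+ 2 * gamma ^- 2 <= C1.
  by rewrite /C1 /C1_const !le_max lexx !orbT.
have K2k : (2 * K <= k)%N.
  by move: Hk; rewrite K1E -natrM ler_nat.
have [Kh kh2 k14 kN] := uphalf_bounds K2k K7.
have k2 : (2 <= k)%N by exact: leq_trans k14.
have k0R : 0 < k%:R :> R by rewrite ltr0n; exact: leq_trans k14.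
have [rng unif indep] := Hiota k k2.
have decay j w : (K <= j)%N ->
    enorm (c (x j w)) ^+ 2 / 2 <= C1 * j%:R `^ (- (2 * nu / theta)).
  exact: (feasibility_decay Hset Hbasic nu_ge nu_le Xx1 Htrm K7 KL Kth Kgr C1_ge1 C1_base C1_step w).
split; last first.
  move=> w; have /andP[i1 i2] := rng w.
  have Ki : (K <= iota k w)%N by exact: leq_trans Kh (ltnW i1).
  have := decay _ w Ki.
  (* The index exceeds the rounded-up half of [k], so decay at the index is at least as good as
     decay at [k / 2]; the factor 2 undoes the halving of the squared norm. *)
  have ki : k%:R / 2 <= (iota k w)%:R :> R.
    rewrite ler_pdivrMr// -natrM ler_nat mulnC; apply: leq_trans kh2 _.
    by rewrite leq_mul2l ltnW ?orbT.
  have k0 : 0 < k%:R / 2 :> R by rewrite divr_gt0.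
  have p0 : 0 <= 2 * nu / theta by rewrite divr_ge0 ?mulr_ge0 ?(ltW th0) ?(ltW nu_gt0).
  have pw : (iota k w)%:R `^ (- (2 * nu / theta)) <= (k%:R / 2) `^ (- (2 * nu / theta)) :> R.
    rewrite !powRN lef_pV2 ?posrE ?powR_gt0//; last exact: lt_le_trans ki.
    by apply: powR_le_mono => //; exact: ltW.
  have C10 : 0 <= C1 by exact: le_trans C1_ge1.
  have := ler_wpM2l C10 pw; move: (_ `^ _) (_ `^ _) (enorm _ ^+ 2) => A B D; lra.
have Qfin := Q1star_finite Hbasic.
have Qmin y : X y -> fine (Q1star X mu ft c) <= Qpen mu ft c 1 y.
  move=> Xy; rewrite -lee_fin fineK//; apply: ereal_inf_lbound.
  by exists y.
have KNk : (K <= k)%N.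
  by apply: leq_trans K2k; rewrite leq_pmull.
have energy := expected_energy_bound Hset Hbasic Havg nu_ge nu_le Hiid Xx1 Htrm
  K7 KLb KLb2 KL Kth Kgr C1_ge1 C1_base C1_step KNk Qmin.
have bound := expected_stationarity Hset Hbasic Havg nu_ge Xx1 Htrm
  K7 KLb KL Kth (Hiota k k2) Kh k2 kN energy.
have Efirst : ('E_P[fun w => (enorm (g 1%N w - grad f x1) ^+ 2)%R]
    = (\int[P]_w sqr_error mu ft x g 1 w)%:E)%E.
  rewrite unlock -(has_expectation_sqr_error P Hset Hbasic Havg Xx1 Htrm (leqnn 1)).2.
  by apply: eq_integral => w _; rewrite /sqr_error (trm_x1 Htrm).
have QE : Q1star X mu ft c = (fine (Q1star X mu ft c))%:E by rewrite fineK.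
rewrite Efirst QE K1E unlock.
apply: le_trans bound _; rewrite EFin_affine lee_fin.
set B := (X in _ * X <= _).
set B' := (X in _ <= _ * X).
have kR1 : 1 <= k%:R :> R by rewrite ler1n; exact: ltnW.
have KR1 : 1 <= K%:R :> R by rewrite ler1n; exact: leq_trans K7.
have lk0 : 0 <= 1 + ln k%:R :> R by rewrite addr_ge0 ?ln_ge0.
have lK0 : 0 <= 1 + ln K%:R :> R by rewrite addr_ge0 ?ln_ge0.
have BB' : B <= B'.
  rewrite /B /B'; apply: lerD; last first.
    apply: burnin_constant_le => //; first exact: Havg.1.
    by rewrite addr_ge0 ?sqr_ge0// mulr_ge0// mulr_ge0 ?sqr_ge0.
  apply: lerD => //; apply: noise_constant_le => //; first exact: sqr_ge0.
  exact: lt_le_trans ln3_ge1.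
have k1 : 0 < k%:R - 1 :> R by rewrite subr_gt0 ltr1n.
have lk1 : 0 <= ln (k%:R + 1) :> R by rewrite ln_ge0// lerDr.
(* The sign is needed to enlarge the prefactor from 96 to 102; it follows because [B] dominates a
   sum of nonnegative energies. *)
have B0 : 0 <= B.
  apply: le_trans energy; rewrite big_seq sumr_ge0// => j; rewrite mem_index_iota => /andP[Kj _].
  have j1 : (1 <= j)%N by exact: leq_trans (leq_trans _ K7) Kj.
  apply: has_expectation_ge0 (has_expectation_step_energy P Hset Hbasic Havg nu_ge Xx1 Htrm j1) _ => w.
  exact: step_energy_ge0.
apply: (@le_trans _ _ (102 * ln (k%:R + 1) / (k%:R - 1) `^ (1 - nu) * B)).
  by rewrite ler_wpM2r// ler_wpM2r ?invr_ge0 ?powR_ge0// ler_wpM2r// ler_nat.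
by rewrite ler_wpM2l// divr_ge0 ?powR_ge0// mulr_ge0.
Qed.
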